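(* Let $J_\Lambda^{(1/\beta)}$ denote the Jack superpolynomial with parameter $\beta$ indexed by the superpartition $\Lambda$. Then, coefficientwise in the supermonomial expansion, for every superpartition $\Lambda$, $$\lim_{\beta\to0}J_\Lambda^{(1/\beta)}=m_\Lambda,\qquad \lim_{\beta\to\infty}J_\Lambda^{(1/\beta)}=\overleftarrow{e_{\Lambda'}},$$ and, at $\beta=1$, for the superpartitions $(n)$ and $(n;0)$, $$J_{(n)}^{(1)}=h_n\qquad\text{and}\qquad J_{(n;0)}^{(1)}=\frac1{n+1}\tilde h_n .$$
   Context: Superpartitions. A superpartition of $(n|m)$ is $\Lambda=(\Lambda^a;\Lambda^s)=(\Lambda_1,\dots,\Lambda_m;\Lambda_{m+1},\Lambda_{m+2},\dots)$ with nonnegative integer entries, $\Lambda_1>\dots>\Lambda_m\ge 0$, $\Lambda_{m+1}\ge\Lambda_{m+2}\ge\dots\ge0$ (finitely many nonzero; trailing zeros of $\Lambda^s$ ignored) and $\sum_i\Lambda_i=n$; $\ell(\Lambda)=m+\#\{\text{nonzero parts of }\Lambda^s\}$. When $m=0$ the semicolon is omitted: $(n)$ is the superpartition of $(n|0)$ with single part $n$, while $(n;0)$ is the superpartition of $(n|1)$ with $\Lambda^a=(n)$, $\Lambda^s=\emptyset$. The diagram of $\Lambda$ is obtained by reordering all entries decreasingly, circling each entry coming from $\Lambda^a$ (when such an entry equals entries of $\Lambda^s$, the leftmost one is circled), drawing left-justified rows of boxes of these lengths from top to bottom, and adding a circle at the end of each row corresponding to a circled entry (a circled $0$ gives a row consisting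 of just a circle). The conjugate $\Lambda'$ is the superpartition whose diagram is the transpose of that of $\Lambda$. Bruhat order. For superpartitions $\Lambda,\Omega$ of the same $(n|m)$, let $\Lambda^c$, $\Omega^c$ be the compositions obtained by replacing the semicolon by a comma (padded with zeros to a common length). For compositions $\lambda,\mu$ let $\lambda^+$ be the decreasing rearrangement and $w_\lambda$ the minimal-length permutation with $\lambda=w_\lambda\lambda^+$; $\lambda\ge\mu$ iff either $\lambda^+>\mu^+$ in dominance order, or $\lambda^+=\mu^+$ and $w_\lambda\le w_\mu$ in the Bruhat order of the symmetric group. Set $\Omega\le\Lambda$ iff $\Omega^c\le\Lambda^c$. Symmetric superfunctions. The $x_i$ commute, the $\theta_i$ anticommute ($\theta_i^2=0$) and commute with the $x_i$. $\mathscr{P}^{S_N}(\beta)$ (resp. $\mathscr{P}^{S_\infty}(\beta)$) is the $\mathbb{Q}(\beta)$-algebra of polynomials in $N$ pairs (resp. formal series of bounded degree in infinitely many pairs) of variables invariant under simultaneous permutations of the pairs $(x_i,\theta_i)$. $m_\Lambda$ is the sum of all distinct terms obtained from $\theta_1\cdots\theta_m x_1^{\Lambda_1}x_2^{\Lambda_2}\cdots$ by simultaneous permutations of the pairs $(x_i,\theta_i)$. The superfunctions $e_n,\tilde e_n,h_n,\tilde h_n$ are defined by $\sum_{n\ge0}t^n(e_n+\tau\tilde e_n)=\prod_i(1+tx_i+\tau\theta_i)$ and $\sum_{n\ge0}t^n(h_n+\tau\tilde h_n)=\prod_i(1-tx_i-\tau\theta_i)^{-1}$, where $t$ commutes with everything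 and $\tau$ is anticommuting. $e_\Lambda=\tilde e_{\Lambda_1}\cdots\tilde e_{\Lambda_m}e_{\Lambda_{m+1}}\cdots e_{\Lambda_{\ell(\Lambda)}}$, and $\overleftarrow{f}=(-1)^{m(m-1)/2}f$ for $f$ of degree $m$ in the $\theta$'s, so $\overleftarrow{e_\Lambda}=\tilde e_{\Lambda_m}\cdots\tilde e_{\Lambda_1}e_{\Lambda_{m+1}}\cdots e_{\Lambda_{\ell(\Lambda)}}$. Jack superpolynomials. Let $K_{ij}$ exchange $x_i,x_j$; $\kappa_{ij}$ exchange $\theta_i,\theta_j$; $\mathcal{K}_\sigma$ permute the pairs $(x_i,\theta_i)$. On $\mathscr{P}^{S_N}(\beta)$ define $$\mathcal{H}=\sum_i (x_i\partial_{x_i})^2+\beta\sum_{i<j}\frac{x_i+x_j}{x_i-x_j}(x_i\partial_{x_i}-x_j\partial_{x_j})-2\beta\sum_{i<j}\frac{x_ix_j}{(x_i-x_j)^2}(1-\kappa_{ij}),$$ $$\mathcal{I}=\frac1{(N-1)!}\sum_{\sigma\in S_N}\mathcal{K}_\sigma\bigl(\theta_1\partial_{\theta_1}\mathcal{D}_1\bigr)\mathcal{K}_\sigma^{-1},\qquad \mathcal{D}_1=x_1\partial_{x_1}+\beta\sum_{k>1}\frac{x_k}{x_1-x_k}(1-K_{1k}).$$ It is known that there is a unique basis $\{J_\Lambda\}_{\ell(\Lambda)\le N}$ of $\mathscr{P}^{S_N}(\beta)$ with each $J_\Lambda$ an eigenfunction of both $\mathcal{H}$ and $\mathcal{I}$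 and $J_\Lambda=m_\Lambda+\sum_{\Omega<\Lambda}c_{\Lambda\Omega}(\beta)m_\Omega$. For $\Lambda$ of $(n|m)$ and $N\ge n+m$ the coefficients do not depend on $N$, and the same expansion defines $J_\Lambda$ in infinitely many variables. $J_\Lambda^{(1/\beta)}$ denotes this $J_\Lambda$ with parameter $\beta$. *)

(* Defs.v *)
From HB Require Import structures.
From mathcomp Require Import all_classical all_reals topology normedtype.
From mathcomp Require Import all_boot all_order all_algebra all_fingroup finmap.
From mathcomp Require Import fraction generic_quotient.
(* Some notations of mpoly clash with those of analysis. *)
From mathcomp Require Import -(notations) mpoly.

Set Implicit Arguments.
Unset Strict Implicit.
Unset Printing Implicit Defensive.

Import Order.TTheory GRing.Theory Num.Theory.
Import numFieldNormedType.Exports.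
Local Open Scope nat_scope.

(* The pair (Lambda^a, Lambda^s); the zeros of Lambda^s are never recorded. *)
Definition is_spart (p : seq nat * seq nat) : bool :=
  [&& sorted gtn p.1, sorted geq p.2 & 0 \notin p.2].

Record spart : Type := SPart { spval : seq nat * seq nat; spvalP : is_spart spval }.

HB.instance Definition _ := [isSub for spval].
HB.instance Definition _ := [Choice of spart by <:].

Definition asym (L : spart) : seq nat := (spval L).1.
Definition ssym (L : spart) : seq nat := (spval L).2.
Definition fdeg (L : spart) : nat := size (asym L).
Definition tdeg (L : spart) : nat := sumn (asym L) + sumn (ssym L).
Definition splen (L : spart) : nat := size (asym L) + size (ssym L).

Lemma row_spart_subproof (n : nat) : is_spart ([::], if n == 0 then [::] else [:: n]).
Proof. by case: n. Qed.

(* The superpartition (n) of (n|0); for n = 0 it is empty. *)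
Definition spart_row (n : nat) : spart := SPart (row_spart_subproof n).

Lemma arow_spart_subproof (n : nat) : is_spart ([:: n], [::]).
Proof. by []. Qed.

(* The superpartition (n;0) of (n|1). *)
Definition spart_arow (n : nat) : spart := SPart (arow_spart_subproof n).

(* Rows of the diagram: their number of boxes, and whether they end with a
   circle; among rows of equal length the circled one comes first. *)
Definition row_ge (p q : nat * bool) : bool :=
  (q.1 < p.1) || (p.1 == q.1) && (q.2 ==> p.2).

Definition rows (L : spart) : seq (nat * bool) :=
  sort row_ge ([seq (a, true) | a <- asym L] ++ [seq (b, false) | b <- ssym L]).

Definition has_box (L : spart) (i j : nat) : bool := j < (nth (0, false) (rows L) i).1.
Definition has_circle (L : spart) (i j : nat) : bool :=
  nth (0, false) (rows L) i == (j, true).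

Definition colht (L : spart) (j : nat) : nat := count (fun r => j < r.1) (rows L).
Definition ncols (L : spart) : nat := \max_(r <- rows L) r.1.

(* A circle at the end of a row of length a lies in column a (counted from 0),
   so the circled columns are those indexed by the entries of Lambda^a. *)
Definition conj_pair (L : spart) : seq nat * seq nat :=
  ([seq colht L j | j <- rev (asym L)],
   [seq colht L j | j <- iota 0 (ncols L) & j \notin asym L]).

Lemma colht_le (L : spart) (i j : nat) : i <= j -> colht L j <= colht L i.
Proof. by move=> ij; apply: sub_count => r /= /(leq_ltn_trans ij). Qed.

Lemma colht_lt (L : spart) (i j : nat) :
  i < j -> j \in asym L -> colht L j < colht L i.
Proof.
move=> ij jL; rewrite /colht.
have jr : (j, true) \in rows L.
  by rewrite mem_sort mem_cat map_f.
have E := seq.permP (perm_to_rem jr); rewrite !E /= ltnn ij.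
by rewrite add0n add1n ltnS; apply: sub_count => r /= /(ltn_trans ij).
Qed.

Lemma conj_pair_subproof (L : spart) : is_spart (conj_pair L).
Proof.
rewrite /is_spart /conj_pair /=; apply/and3P; split.
- have : sorted ltn (rev (asym L)).
    by rewrite rev_sorted; case/and3P: (spvalP L).
  have : {subset rev (asym L) <= asym L} by move=> x; rewrite mem_rev.
  elim: (rev _) => [|x [|y s] IH] //= sub /andP[xy p].
  rewrite colht_lt ?sub ?inE ?eqxx ?orbT //=.
  by apply: IH => // z zs; apply: sub; rewrite inE zs orbT.
- apply: (@homo_sorted _ _ (colht L) leq); first by move=> x y; exact: colht_le.
  by apply: sorted_filter; [exact: leq_trans | exact: iota_sorted].
- apply/mapP => -[j]; rewrite mem_filter mem_iota /= add0n => /andP[_ jn] /esym h.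
  have : ~~ has (fun r => j < r.1) (rows L) by rewrite has_count -[count _ _]/(colht L j) h.
  move/hasPn => H; move: jn; rewrite ltnNge => /negP; apply.
  by apply/bigmax_leqP_seq => r rL _; rewrite leqNgt H.
Qed.

Definition spconj (L : spart) : spart := SPart (conj_pair_subproof L).

Lemma row_ge_total : total row_ge.
Proof.
by move=> [a x] [b y]; rewrite /row_ge /=; case: (ssrnat.ltngtP a b); case: x; case: y.
Qed.

Lemma row_ge_trans : transitive row_ge.
Proof.
move=> [b y] [a x] [c z]; rewrite /row_ge /=.
case/orP => [h1|/andP[/eqP-> h1]]; case/orP => [h2|/andP[/eqP<- h2]].
- by rewrite (ltn_trans h2 h1).
- by rewrite h1.
- by rewrite h2.
- by rewrite eqxx; move: h1 h2; case: (x); case: (y); case: (z); rewrite ?orbT.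
Qed.

Lemma row_ge_anti : antisymmetric row_ge.
Proof.
move=> [a x] [b y]; rewrite /row_ge /=; case: (ssrnat.ltngtP a b) => //= -> h.
by move: h; case: x; case: y.
Qed.

Lemma rows_sorted (L : spart) : sorted row_ge (rows L).
Proof. exact: sort_sorted row_ge_total _. Qed.

Lemma row_ge_nth (s : seq (nat * bool)) (j k : nat) :
  sorted row_ge s -> j <= k -> row_ge (nth (0, false) s j) (nth (0, false) s k).
Proof.
move=> ss jk; have [ks|sk] := ltnP k (size s).
  apply: (sorted_leq_nth row_ge_trans _ _ ss) => //.
  - by move=> x; rewrite /row_ge eqxx implybb orbT.
  - by rewrite inE (leq_ltn_trans jk ks).
rewrite [X in row_ge _ X]nth_default // /row_ge /= andbT.
by case: posnP.
Qed.

Lemma count_rows (s : seq (nat * bool)) (x j : nat) : sorted row_ge s ->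
  (j < count (fun r => x < r.1) s) = (x < (nth (0, false) s j).1).
Proof.
elim: s j => [|r s IH] j; first by rewrite nth_nil !ltn0.
move=> srs; have ss := path_sorted srs; case: j => [|j] /=.
  case: (ltnP x r.1) => // rx; rewrite add0n; apply/negbTE.
  rewrite -leqNgt leqn0 eqn0Ngt -has_count; apply/hasPn => q qs.
  have /allP/(_ _ qs) : all (row_ge r) s by apply: order_path_min srs; exact: row_ge_trans.
  rewrite -leqNgt /row_ge => /orP[/ltnW h|/andP[/eqP<- _]] //.
  exact: leq_trans h rx.
rewrite -IH //; case: (ltnP x r.1) => rx; rewrite ?add1n ?ltnS // add0n.
have h : count (fun r : nat * bool => x < r.1) s = 0.
  apply/eqP; rewrite eqn0Ngt -has_count; apply/hasPn => q qs.
  have /allP/(_ _ qs) : all (row_ge r) s by apply: order_path_min srs; exact: row_ge_trans.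
  rewrite -leqNgt /row_ge => /orP[/ltnW h|/andP[/eqP<- _]] //.
  exact: leq_trans h rx.
by rewrite h.
Qed.

Lemma asym_uniq (L : spart) : uniq (asym L).
Proof.
by apply: (@sorted_uniq _ gtn); [move=> a b c /= h1 h2; exact: ltn_trans h2 h1
  | move=> a /=; exact: ltnn | case/and3P: (spvalP L)].
Qed.

Lemma mem_rowsT (L : spart) (a : nat) : ((a, true) \in rows L) = (a \in asym L).
Proof.
rewrite mem_sort mem_cat mem_map; last by move=> u v [].
by rewrite orbC; case: mapP => // -[].
Qed.

Lemma nth_rows_spconj (L : spart) (i : nat) :
  nth (0, false) (rows (spconj L)) i = (colht L i, i \in asym L).
Proof.
set f := fun j => (colht L j, j \in asym L).
set M := ncols L.
have bnd r : r \in rows L -> r.1 <= M.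
  by move=> rL; rewrite /M /ncols (big_rem r) //= leq_maxl.
have abnd a : a \in asym L -> a <= M.
  by rewrite -mem_rowsT => /bnd.
have c0 j : M <= j -> colht L j = 0.
  move=> Mj; apply/eqP; rewrite eqn0Ngt -has_count; apply/hasPn => r /bnd h.
  by rewrite -leqNgt (leq_trans h).
set s := [seq f j | j <- iota 0 M.+1 & (j < M) || (j \in asym L)].
have sE : s = [seq f j | j <- iota 0 (M + (M \in asym L))].
  rewrite /s -addn1 iotaD filter_cat /= add0n ltnn /= iotaD map_cat map_cat add0n.
  congr (_ ++ _); last by case: (M \in _).
  by congr map; apply/all_filterP/allP => j; rewrite mem_iota /= add0n => ->.
have ss : sorted row_ge s.
  rewrite sE; apply: (@homo_sorted _ _ f ltn); last exact: iota_ltn_sorted.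
  move=> j k jk; rewrite /row_ge /f /=; case: ssrnat.ltngtP (colht_le L (ltnW jk)) => // e _.
  by apply/implyP => /(colht_lt jk); rewrite e ltnn.
have -> : rows (spconj L) = s.
  apply: (sorted_eq row_ge_trans row_ge_anti (rows_sorted _) ss).
  rewrite perm_sort /asym /ssym /= -!map_comp.
  rewrite (eq_in_map _ (f) _).1; last first.
    by move=> j; rewrite mem_rev /f /= => ->.
  rewrite [X in _ ++ X](eq_in_map _ f _).1; last first.
    by move=> j; rewrite mem_filter /f /= => /andP[/negbTE-> _].
  rewrite -map_cat; apply: perm_map; apply: uniq_perm.
  - rewrite cat_uniq rev_uniq asym_uniq filter_uniq ?iota_uniq // andbT /=.
    by apply/hasPn => j; rewrite mem_filter mem_rev => /andP[].
  - by rewrite filter_uniq ?iota_uniq.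
  move=> j; rewrite mem_cat mem_rev !mem_filter !mem_iota /= !add0n ltnS.
  case jL: (j \in asym L) => /=; first by rewrite orbT (abnd _ jL).
  by rewrite orbF; case: ssrnat.ltngtP.
rewrite sE; have [h|h] := ltnP i (M + (M \in asym L)).
  by rewrite (nth_map 0) ?size_iota // nth_iota.
rewrite nth_default ?size_map ?size_iota // c0; last exact: leq_trans (leq_addr _ _) h.
case iL: (i \in asym L) => //; move: h; have := abnd _ iL.
rewrite leq_eqVlt => /orP[/eqP e|h1 h2]; first by rewrite -e iL addn1 ltnn.
by move: (leq_trans h1 (leq_trans (leq_addr _ _) h2)); rewrite ltnn.
Qed.

(* The diagram of the conjugate is the transpose of the diagram. *)
Lemma has_box_spconj (L : spart) (i j : nat) :
  has_box (spconj L) i j = has_box L j i.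
Proof. by rewrite /has_box nth_rows_spconj /= count_rows // rows_sorted. Qed.

Lemma has_circle_spconj (L : spart) (i j : nat) :
  has_circle (spconj L) i j = has_circle L j i.
Proof.
rewrite /has_circle nth_rows_spconj.
have key k : nth (0, false) (rows L) k = (i, true) -> colht L i = k.
  move=> e; have kr : k < size (rows L).
    by rewrite ltnNge; apply/negP => h; rewrite nth_default in e.
  apply/eqP; rewrite eqn_leq leqNgt count_rows ?rows_sorted // e ltnn /=.
  rewrite leqNgt; apply/negP => h.
  have := row_ge_nth (rows_sorted L) (ltnW h); rewrite e /row_ge /=.
  have := count_rows i (colht L i) (rows_sorted L); rewrite ltnn => <- /=.
  set r := nth _ _ _ => /andP[/eqP r1 r2].
  have rE : r = (i, true) by move: r1 r2; case: (r) => u [] //= ->.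
  have : 1 < count_mem (i, true) (rows L).
    rewrite -[rows L](cat_take_drop k) count_cat (drop_nth (0, false)) // e /= eqxx.
    rewrite addnCA ltnS; apply: leq_trans (leq_addr _ _).
    rewrite -has_count has_pred1 -rE.
    by rewrite /r -(nth_take (0, false) h) mem_nth // size_take kr.
  rewrite count_sort count_cat count_map.
  rewrite [X in _ + X](_ : _ = 0); last first.
    by apply/eqP; rewrite eqn0Ngt -has_count; apply/hasPn => _ /mapP[b _ ->] /=; rewrite xpair_eqE andbF.
  rewrite addn0 (eq_count (a2 := pred1 i)); last first.
    by move=> a /=; rewrite xpair_eqE andbT.
  by rewrite count_uniq_mem ?asym_uniq //; case: (_ \in _).
apply/eqP/eqP => [[<-]|e].
  rewrite -mem_rowsT => ir.
  by rewrite (key _ (nth_index (0, false) ir)) nth_index.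
rewrite (key _ e) -mem_rowsT -{1}e mem_nth // ltnNge.
by apply/negP => h; rewrite nth_default in e.
Qed.

Definition spcomp (n : nat) (L : spart) : seq nat :=
  let s := asym L ++ ssym L in s ++ nseq (n - size s) 0.

Definition dsort (s : seq nat) : seq nat := sort geq s.

Definition dom_gt (l m : seq nat) : Prop :=
  [/\ l <> m, sumn l = sumn m & forall k, sumn (take k m) <= sumn (take k l)].

Definition plen (n : nat) (w : 'S_n) : nat :=
  #|[set p : 'I_n * 'I_n | (p.1 < p.2) && (w p.2 < w p.1)]|.

(* Length-increasing multiplications by arbitrary transpositions; their chains
   generate the Bruhat order. *)
Definition bruhat_step (n : nat) (u v : 'S_n) : bool :=
  (plen u < plen v) && [exists i, exists j, v == (tperm i j * u)%g].
Definition bruhat_le (n : nat) (u v : 'S_n) : bool := connect (@bruhat_step n) u v.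

(* l = w l^+, where w acts on compositions by (w l)_i = l_(w^-1 i). *)
Definition sorted_by (n : nat) (l : seq nat) (w : 'S_n) : bool :=
  [forall i : 'I_n, nth 0 l i == nth 0 (dsort l) ((w^-1)%g i)].
Definition min_sorted_by (n : nat) (l : seq nat) (w : 'S_n) : Prop :=
  sorted_by l w /\ forall v : 'S_n, sorted_by l v -> plen w <= plen v.

(* l >= m, for compositions of the same length n. *)
Definition comp_ge (n : nat) (l m : seq nat) : Prop :=
  dom_gt (dsort l) (dsort m) \/
  dsort l = dsort m /\
    (exists wl wm : 'S_n,
       [/\ min_sorted_by l wl, min_sorted_by m wm & bruhat_le wl wm]).

(* W <= L, for superpartitions of the same bidegree. *)
Definition sp_le (W L : spart) : Prop :=
  let n := maxn (splen W) (splen L) in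
  [/\ fdeg W = fdeg L, tdeg W = tdeg L & comp_ge n (spcomp n L) (spcomp n W)].

Local Open Scope ring_scope.

(* The free module with basis the monomials theta_S, S a set of indices, where
   theta_S is the product of the theta_i, i in S, in increasing order of i. *)
Notation super n R := {ffun {set 'I_n} -> R}.

Section Grassmann.
Variables (n : nat) (R : pzRingType).
Implicit Types f g : super n R.

Definition gconst (c : R) : super n R := [ffun S : {set 'I_n} => if S == finset.set0 then c else 0].
Definition theta (i : 'I_n) : super n R := [ffun S : {set 'I_n} => (S == [set i])%:R].

(* theta_S theta_T = (-1)^(cross S T) theta_(S u T) for disjoint S and T. *)
Definition cross (S T : {set 'I_n}) : nat :=
  #|[set p : 'I_n * 'I_n | [&& p.1 \in S, p.2 \in T & (p.2 < p.1)%N]]|.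

Definition gmul f g : super n R :=
  [ffun S : {set 'I_n} => \sum_(T : {set 'I_n} | T \subset S)
               (-1) ^+ cross T (S :\: T) * (f T * g (S :\: T))].

Definition gexp f (k : nat) : super n R := iter k (gmul f) (gconst 1).

(* Reordering sign of theta_(w i_1) .. theta_(w i_k), where S = {i_1 < .. < i_k}. *)
Definition inv_on (w : 'S_n) (S : {set 'I_n}) : nat :=
  #|[set p : 'I_n * 'I_n | [&& p.1 \in S, p.2 \in S, (p.1 < p.2)%N & (w p.2 < w p.1)%N]]|.

(* theta_i |-> theta_(w i), together with phi on the coefficients. *)
Definition gperm (phi : R -> R) (w : 'S_n) f : super n R :=
  [ffun S : {set 'I_n} => let T := w @^-1: S in (-1) ^+ inv_on w T * phi (f T)].
End Grassmann.

Notation polyx n k := (mpoly n k).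

Section SuperPolynomials.
Variables (n : nat) (k : fieldType).

Definition xvar (i : 'I_n) : polyx n k := mpolyX k (mnm1 i).

(* Simultaneous permutation of the pairs: x_i |-> x_(w i), theta_i |-> theta_(w i). *)
Definition pair_perm (w : 'S_n) (f : super n (polyx n k)) : super n (polyx n k) :=
  gperm (msym w) w f.

Definition symmetric_super (f : super n (polyx n k)) : Prop :=
  forall w : 'S_n, pair_perm w f = f.

Definition smonomial (L : spart) : super n (polyx n k) :=
  [ffun S : {set 'I_n} => if S == [set i : 'I_n | (i < fdeg L)%N]
             then \prod_(i < n) xvar i ^+ nth 0%N (asym L ++ ssym L) i else 0].

(* When L has more than n parts, the restriction of m_L to n pairs vanishes. *)
Definition msuper (L : spart) : super n (polyx n k) :=
  if (splen L <= n)%N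
  then \sum_(f <- undup [seq pair_perm w (smonomial L) | w : 'S_n]) f
  else 0.

(* The linear combination of supermonomials with coefficients a. *)
Definition smon_comb (a : {fsfun spart -> k with 0}) : super n (polyx n k) :=
  \sum_(W <- finsupp a) a W *: msuper W.

(* Generating functions: the Grassmann generator tau has index ord0, theta_i has
   index lift ord0 i, and the coefficients are polynomials in t. *)
Definition tau_theta (i : 'I_n) : super n.+1 {poly polyx n k} :=
  gconst n.+1 ('X * (xvar i)%:P) + gmul (theta _ ord0) (theta _ (lift ord0 i)).

Definition gen_e : super n.+1 {poly polyx n k} :=
  \big[@gmul _ _ / gconst _ 1]_(i < n) (gconst _ 1 + tau_theta i).

(* The product of the geometric series of the tau_theta i, each cut at exponent N:
   since (tau theta_i)^2 = 0, the powers from N on only involve t^d, d >= N - 1. *)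
Definition gen_h (N : nat) : super n.+1 {poly polyx n k} :=
  \big[@gmul _ _ / gconst _ 1]_(i < n) \sum_(j < N) gexp (tau_theta i) j.

Definition even_coef (d : nat) (G : super n.+1 {poly polyx n k}) :
  super n (polyx n k) := [ffun S : {set 'I_n} => (G (lift ord0 @: S))`_d].
Definition tau_coef (d : nat) (G : super n.+1 {poly polyx n k}) :
  super n (polyx n k) := [ffun S : {set 'I_n} => (G (ord0 |: lift ord0 @: S))`_d].

Definition esuper (d : nat) := even_coef d gen_e.
Definition etsuper (d : nat) := tau_coef d gen_e.
Definition hsuper (d : nat) := even_coef d (gen_h d.+2).
Definition htsuper (d : nat) := tau_coef d (gen_h d.+2).

Definition eprod (L : spart) : super n (polyx n k) :=
  gmul (\big[@gmul _ _ / gconst _ 1]_(d <- asym L) etsuper d)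
       (\big[@gmul _ _ / gconst _ 1]_(d <- ssym L) esuper d).

(* Reversal of f of degree m in the thetas. *)
Definition reversal (m : nat) (f : super n (polyx n k)) : super n (polyx n k) :=
  (-1) ^+ (m * m.-1)./2 *: f.
End SuperPolynomials.

Notation Qbeta := {fraction {poly rat}}.

Definition beta : Qbeta := tofrac 'X.

Section Jack.
Variable n : nat.
Notation P := (polyx n.+1 Qbeta).
Notation F := {fraction P}.
Notation x i := (xvar Qbeta i).

Definition fcst (c : Qbeta) : F := tofrac (mpolyC n.+1 c).

Definition euler (i : 'I_n.+1) (p : P) : P := x i * mderiv i p.

Definition kappa (i j : 'I_n.+1) (f : super n.+1 P) : super n.+1 P :=
  gperm id (tperm i j) f.

(* The operators are applied to polynomials; their values are a priori rational. *)
Definition Hop (f : super n.+1 P) : super n.+1 F :=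
  [ffun S : {set 'I_n.+1} =>
     \sum_(i < n.+1) tofrac (euler i (euler i (f S)))
     + fcst beta * \sum_(i < n.+1) \sum_(j < n.+1 | (i < j)%N)
         tofrac (x i + x j) / tofrac (x i - x j)
         * tofrac (euler i (f S) - euler j (f S))
     - 2%:R * fcst beta * \sum_(i < n.+1) \sum_(j < n.+1 | (i < j)%N)
         tofrac (x i * x j) / tofrac ((x i - x j) ^+ 2)
         * tofrac ((f - kappa i j f) S)].

Definition D1 (p : P) : F :=
  tofrac (euler ord0 p)
  + fcst beta * \sum_(j < n.+1 | j != ord0)
      tofrac (x j) / tofrac (x ord0 - x j)
      * tofrac (p - msym (tperm ord0 j) p).

Definition theta1_dtheta1_D1 (f : super n.+1 P) : super n.+1 F :=
  [ffun S : {set 'I_n.+1} => if ord0 \in S then D1 (f S) else 0].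

(* Independent of the chosen representative, since msym w is injective. *)
Definition frac_sym (w : 'S_n.+1) (z : F) : F :=
  tofrac (msym w (fraction.frac (repr z)).1)
  / tofrac (msym w (fraction.frac (repr z)).2).

Definition Iop (f : super n.+1 P) : super n.+1 F :=
  [ffun S : {set 'I_n.+1} => (n`!%:R)^-1 *
     (\sum_(w : 'S_n.+1)
        gperm (frac_sym w) w (theta1_dtheta1_D1 (pair_perm (w^-1)%g f))) S].

Definition eigenfunction (Op : super n.+1 P -> super n.+1 F) (f : super n.+1 P) : Prop :=
  f != 0 /\ exists e : Qbeta, Op f = [ffun S : {set 'I_n.+1} => tofrac (e *: f S)].

(* (J L), for L of length at most n.+1, is a basis of the symmetric superpolynomials. *)
Definition symmetric_basis (J : spart -> super n.+1 P) : Prop :=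
  (forall L, (splen L <= n.+1)%N -> symmetric_super (J L)) /\
  forall f, symmetric_super f ->
    exists! a : {fsfun spart -> Qbeta with 0},
      (forall L, a L != 0 -> (splen L <= n.+1)%N) /\
      f = \sum_(L <- finsupp a) a L *: J L.

(* c L W is the coefficient of m_W in J_L. *)
Definition jack_basis (c : spart -> {fsfun spart -> Qbeta with 0}) : Prop :=
  symmetric_basis (fun L => smon_comb n.+1 (c L)) /\
  forall L, (splen L <= n.+1)%N ->
    [/\ c L L = 1,
        forall W, c L W != 0 -> sp_le W L /\ (splen W <= n.+1)%N,
        eigenfunction Hop (smon_comb n.+1 (c L)) &
        eigenfunction Iop (smon_comb n.+1 (c L))].
End Jack.

Definition eval_real (R : realType) (p : {poly rat}) (b : R) : R :=
  (map_poly ratr p).[b].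

Definition coef_cvg (R : realType) (F : set_system R) (c : Qbeta) (l : rat) : Prop :=
  exists p q : {poly rat},
    [/\ q != 0, c = tofrac p / tofrac q &
        ((fun b : R => eval_real p b / eval_real q b) @ F --> (ratr l : R))%classic].

Definition coef_value (b : rat) (c : Qbeta) (v : rat) : Prop :=
  exists p q : {poly rat},
    [/\ q.[b] != 0, c = tofrac p / tofrac q & v = p.[b] / q.[b]].

(* A formal series of bounded degree in infinitely many pairs of variables is
   given by its restrictions to n pairs, x_i = theta_i = 0 for i >= n, for all n. *)
Definition sseries := forall n : nat, super n (polyx n rat).

Definition coefwise (rel : Qbeta -> rat -> Prop)
    (c : {fsfun spart -> Qbeta with 0}) (f : sseries) : Prop :=
  exists a : {fsfun spart -> rat with 0},
    (forall W, rel (c W) (a W)) /\ forall n, f n = smon_comb n a.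

Definition limit_at_0 (R : realType) c f : Prop :=
  coefwise (@coef_cvg R (0^')%classic) c f.
Definition limit_at_infty (R : realType) c f : Prop :=
  coefwise (fun z l => @coef_cvg R (+oo)%classic z l /\ @coef_cvg R (-oo)%classic z l) c f.
Definition value_at_1 c f : Prop := coefwise (coef_value 1) c f.

(* Main.v *)
(* With M variables, on symmetric superpolynomials, H = H0 + beta H1 and I = I0 + beta I1, where H0
   and I0 are diagonal on the supermonomials: their eigenvalues on m_W are a_W, the sum of the squares
   of all entries of W, and a'_W, the sum of the entries of W^a. Up to a constant on each theta-degree,
   H1 and I1 are derivations having all e_n and etilde_n as eigenvectors, so every e_(W') is a common
   eigenvector, of eigenvalues E_W and E'_W. The expansion e_(W') = +- m_W + lower terms then makes H1
   and I1 triangular on the m_W, with rational entries and diagonals E_W, E'_W.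

   An f = m_L + lower terms that is a common eigenvector of s H0 + t H1 and s I0 + t I1 is therefore
   given by a recursion on its coefficients whose denominators are s (a_L - a_G) + t (E_L - E_G), or the
   same with primes; for s, t >= 0 not both zero one of the two is nonzero as soon as G < L. The Jack
   superpolynomial solves it for (s, t) = (1, beta), and also, after division by beta, for (1/beta, 1);
   m_L solves it for (1, 0), the reversed e_(L') for (0, 1), h_n and htilde_n / (n+1) for (1, 1).
   Limits and specialisations of beta are compatible with the recursion. *)
Require Import Defs.
From mathcomp Require Import all_classical all_reals topology normedtype.
From mathcomp Require Import all_boot all_order all_algebra all_fingroup finmap.
From mathcomp Require Import fraction generic_quotient.
From mathcomp Require Import -(notations) mpoly.
From mathcomp Require Import zify ring lra.
Set Implicit Arguments.
Unset Strict Implicit.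
Unset Printing Implicit Defensive.
Import Order.TTheory GRing.Theory Num.Theory.
Local Open Scope ring_scope.

(** * Signs *)

(** Triangularity of e_(L') is proved for [lep], a relation implied by the Bruhat order: dominance
    of the rearrangements and, when these agree, entrywise comparison of the fermionic parts. If G
    strictly precedes L and the rearrangements differ, the sum of squares of the rows is smaller for
    G and that of the columns is larger; if they agree, the same holds for the sums of the fermionic
    entries of G and of G'. For a fixed bidegree E_W is a constant minus the sum of squares of the
    columns, and E'_W a constant minus the sum of the fermionic entries of W'. Hence a_L - a_G and
    E_L - E_G are both positive, or both primed differences are. Signs matter for the limit of (s,
    t) only, so infinity may be approached from either end of the line.

    The recursion runs over the finitely many superpartitions of one bidegree (d|m), in at least d +
    m variables, so that none of their supermonomials vanishes. As the matrices are rational, it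
    serves both the Jack coefficients over Q(beta) and the rational coefficients of the target.
    Targets are formal series: their coefficients are compared in one number of variables and do not
    depend on it. *)

Section Signs.
Variable n : nat.
Implicit Types (w v : 'S_n) (S A B : {set 'I_n}).

(** Parities of inversion and crossing numbers become iterated exclusive ors. After reindexing and
    exchanging the sums, sign identities reduce to Boolean checks on a single pair of indices. *)
Lemma odd_card_pairs (T : finType) (P : rel T) :
  odd #|[set p : T * T | P p.1 p.2]| =
  \big[addb/false]_p \big[addb/false]_q P p q.
Proof.
rewrite -sum1dep_card big_mkcond /= (big_morph odd oddD (erefl _)).
rewrite pair_big /=; apply: eq_bigr => -[p q] _ /=.
by case: (P p q).
Qed.

Lemma odd_inv_on w S : odd (inv_on w S) = \big[addb/false]_p \big[addb/false]_q
  [&& p \in S, q \in S, (p < q)%N & (w q < w p)%N].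
Proof. exact: odd_card_pairs. Qed.

Lemma odd_cross A B : odd (cross A B) = \big[addb/false]_p \big[addb/false]_q
  [&& p \in A, q \in B & (q < p)%N].
Proof. exact: odd_card_pairs. Qed.

Lemma big_perm_im w (F : 'I_n -> bool) :
  \big[addb/false]_p F p = \big[addb/false]_p F (w p).
Proof. by rewrite (reindex_inj (@perm_inj _ w)). Qed.

(** The sign cocycle behind multiplicativity of substitutions of the thetas. Pairs inside A or
    inside B count equally on both sides; for p in A and q in B, the order of p, q and that of w p,
    w q differ exactly when w inverts the pair. *)
Lemma inv_on_setU w A B : [disjoint A & B] ->
  odd (inv_on w (A :|: B)) (+) odd (cross A B) =
  odd (inv_on w A) (+) odd (inv_on w B) (+) odd (cross (w @: A) (w @: B)).
Proof.
move=> dAB; rewrite !odd_inv_on !odd_cross.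
set cAB := \big[addb/false]_p \big[addb/false]_q [&& p \in A, q \in B & (q < p)%N].
rewrite [X in _ = _ (+) X](big_perm_im w).
under [X in _ = _ (+) X]eq_bigr do rewrite (big_perm_im w).
under [X in _ = _ (+) X]eq_bigr do
  under eq_bigr do rewrite !(mem_imset _ _ (@perm_inj _ w)).
have -> : \big[addb/false]_p \big[addb/false]_q
   [&& p \in A :|: B, q \in A :|: B, (p < q)%N & (w q < w p)%N] =
   \big[addb/false]_p \big[addb/false]_q [&& p \in A, q \in A, (p < q)%N & (w q < w p)%N] (+)
   \big[addb/false]_p \big[addb/false]_q [&& p \in B, q \in B, (p < q)%N & (w q < w p)%N] (+)
   \big[addb/false]_p \big[addb/false]_q [&& p \in A, q \in B, (p < q)%N & (w q < w p)%N] (+)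
   \big[addb/false]_p \big[addb/false]_q [&& p \in A, q \in B, (q < p)%N & (w p < w q)%N].
  rewrite [X in _ = _ (+) X]exchange_big /= -!big_split /=.
  apply: eq_bigr => p _; rewrite -!big_split /=; apply: eq_bigr => q _.
  have hA r : ~~ ((r \in A) && (r \in B)).
    by apply/negP => /andP[rA]; rewrite (disjointFr dAB rA).
  move: (hA p) (hA q); rewrite !inE; case: (p \in A); case: (q \in A);
  case: (p \in B); case: (q \in B) => //=;
  by case: (_ < _)%N; case: (_ < _)%N.
rewrite -!addbA; congr (_ (+) (_ (+) _)); rewrite -!big_split /=.
apply: eq_bigr => p _; rewrite -!big_split /=; apply: eq_bigr => q _.
case pA: (p \in A) => //=; case qB: (q \in B) => //=.
have npq : p != q by apply: contraTneq pA => ->; rewrite (disjointFl dAB qB).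
have nw : w p != w q by rewrite (inj_eq (@perm_inj _ w)).
move: npq nw; rewrite -!val_eqE /=.
by case: (ltngtP p q) => //=; case: (ltngtP (w p) (w q)).
Qed.

(** A pair of S is inverted by the product when exactly one of w and v, the latter acting on the
    image pair, inverts it. *)
Lemma inv_on_mul w v S :
  odd (inv_on (w * v)%g S) = odd (inv_on w S) (+) odd (inv_on v (w @: S)).
Proof.
rewrite !odd_inv_on.
rewrite [X in _ = _ (+) X](big_perm_im w).
under [X in _ = _ (+) X]eq_bigr do rewrite (big_perm_im w).
under [X in _ = _ (+) X]eq_bigr do
  under eq_bigr do rewrite !(mem_imset _ _ (@perm_inj _ w)).
have -> : \big[addb/false]_p \big[addb/false]_q
   [&& p \in S, q \in S, (w p < w q)%N & (v (w q) < v (w p))%N] =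
   \big[addb/false]_p \big[addb/false]_q
     [&& p \in S, q \in S, (p < q)%N, (w p < w q)%N & (v (w q) < v (w p))%N] (+)
   \big[addb/false]_p \big[addb/false]_q
     [&& p \in S, q \in S, (p < q)%N, (w q < w p)%N & (v (w p) < v (w q))%N].
  rewrite [X in _ = _ (+) X]exchange_big /= -!big_split /=.
  apply: eq_bigr => p _; rewrite -!big_split /=; apply: eq_bigr => q _.
  have := perm_inj (s := w) (x1 := p) (x2 := q).
  case: (p \in S); case: (q \in S) => //= H.
  case: (ltngtP p q) => //= [|pq]; rewrite ?addbF //.
  by rewrite (val_inj pq) ltnn.
rewrite -!big_split /=.
apply: eq_bigr => p _; rewrite -!big_split /=; apply: eq_bigr => q _.
rewrite !permM; case: (p \in S) => //=; case: (q \in S) => //=.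
case: (ltngtP p q) => //= pq.
have nw : w p != w q by rewrite (inj_eq (@perm_inj _ w)) -val_eqE /= ltn_eqF.
have nv : v (w p) != v (w q) by rewrite (inj_eq (@perm_inj _ v)).
move: nw nv; rewrite -!val_eqE /=.
by case: (ltngtP (w p) (w q)) => //=; case: (ltngtP (v (w p)) (v (w q))).
Qed.

Lemma inv_on_id w S : {in S, forall i, w i = i} -> inv_on w S = 0%N.
Proof.
move=> h; apply/eqP; rewrite cards_eq0; apply/eqP/setP => -[p q].
rewrite !inE /=; apply/negP => /and4P[pS qS]; rewrite !h // => a b.
by have := ltn_trans a b; rewrite ltnn.
Qed.

Lemma inv_on1 w i : inv_on w [set i] = 0%N.
Proof.
apply/eqP; rewrite cards_eq0; apply/eqP/setP => -[p q].
by rewrite !inE /=; apply/negP => /and4P[/eqP-> /eqP->]; rewrite ltnn.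
Qed.

Lemma inv_on0 w : inv_on w finset.set0 = 0%N.
Proof. by apply: inv_on_id => i; rewrite inE. Qed.

Lemma preim_perm w S : w @^-1: S = (w^-1)%g @: S.
Proof.
apply/setP => i; rewrite inE; apply/idP/imsetP => [h|[j jS ->]].
  by exists (w i); rewrite ?permK.
by rewrite permKV.
Qed.

Lemma im_perm w S : w @: S = (w^-1)%g @^-1: S.
Proof. by rewrite preim_perm invgK. Qed.

Lemma im_permK w S : (w^-1)%g @: (w @: S) = S.
Proof. by rewrite -preim_perm; apply/setP=> i; rewrite !inE mem_imset //; apply: perm_inj. Qed.

Lemma im_permKV w S : w @: ((w^-1)%g @: S) = S.
Proof. by rewrite -{1}[w]invgK im_permK. Qed.

Lemma im_tperm_pair (i j : 'I_n) : tperm i j @: [set i; j] = [set i; j].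
Proof.
by rewrite imsetU1 imset_set1 tpermL tpermR finset.setUC.
Qed.

Lemma im_tperm_in (i j : 'I_n) S : i \in S -> j \in S -> tperm i j @: S = S.
Proof.
move=> iS jS; apply/setP => x; rewrite im_perm inE tpermV.
by case: tpermP => [->|->|//]; rewrite iS jS.
Qed.

Lemma im_tperm_notin (i j : 'I_n) S : i \notin S -> j \notin S -> tperm i j @: S = S.
Proof.
move=> iS jS; apply/setP => x; rewrite im_perm inE tpermV.
by case: tpermP => [->|->|//]; rewrite (negbTE iS) (negbTE jS).
Qed.

(** With S split into {i, j} and the rest, the transposition preserves both pieces. The crossing
    number is therefore unchanged and the parity is that of the single inverted pair. *)
Lemma odd_inv_on_tperm (i j : 'I_n) S : i != j -> i \in S -> j \in S ->
  odd (inv_on (tperm i j) S).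
Proof.
move=> nij iS jS; set A := [set i; j].
have SE : S = A :|: (S :\: A).
  by rewrite -{1}(finset.setID S A); congr (_ :|: _); apply/setIidPr/subsetP => x;
     rewrite !inE => /orP[]/eqP->.
have dA : [disjoint A & S :\: A] by rewrite -setI_eq0 setDE setICA setICr setI0.
have := inv_on_setU (tperm i j) dA; rewrite -SE im_tperm_pair im_tperm_notin ?inE ?eqxx ?orbT //.
move=> /addIb ->.
rewrite [X in _ (+) odd X](inv_on_id (w := tperm i j)) ?addbF; last first.
  move=> k; rewrite !inE negb_or => /andP[/andP[ki kj] _]; rewrite tpermD // eq_sym //.
have H (a b : 'I_n) : (a < b)%N -> odd (inv_on (tperm a b) [set a; b]).
  move=> ab; rewrite /inv_on (_ : [set p | _] = [set (a, b)]) ?cards1 //.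
  apply/setP => -[p q]; rewrite !inE xpair_eqE /=; apply/and4P/andP => [|[/eqP-> /eqP->]]; last first.
    by rewrite !eqxx ?orbT tpermL tpermR.
  case=> /orP[]/eqP-> /orP[]/eqP-> //; rewrite ?ltnn //.
  by move=> ba; have := ltn_trans ab ba; rewrite ltnn.
rewrite /A; case: (ltngtP i j) => [h|h|h]; first exact: H.
  by rewrite tpermC finset.setUC; exact: H.
by move: nij; rewrite (val_inj h) eqxx.
Qed.

End Signs.

(** * Grassmann calculus *)
Section Grassmann.
Variables (n : nat) (R : comNzRingType).
Implicit Types (f g h : super n R) (S T : {set 'I_n}) (w v : 'S_n) (i j : 'I_n).

(** Scales by the coefficient ring itself, whereas [*:] on superpolynomials scales by the base
    field. *)
Definition gscale (c : R) f : super n R := [ffun S : {set 'I_n} => c * f S].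
Definition gproj (b : pred {set 'I_n}) f : super n R :=
  [ffun S : {set 'I_n} => if b S then f S else 0].
Definition swap i j f := gperm id (tperm i j) f.

Lemma gmulE f g S : gmul f g S =
  \sum_(T : {set 'I_n} | T \subset S) (-1) ^+ cross T (S :\: T) * (f T * g (S :\: T)).
Proof. by rewrite ffunE. Qed.

Lemma gsubE f g S : (f - g) S = f S - g S.
Proof. by rewrite ffunE [X in _ + X = _]ffunE. Qed.

Lemma gaddE f g S : (f + g) S = f S + g S.
Proof. by rewrite ffunE. Qed.

Lemma gmulDl f g h : gmul (f + g) h = gmul f h + gmul g h.
Proof.
apply/ffunP => S; rewrite !(ffunE, gmulE) -big_split; apply: eq_bigr => T _ /=.
by rewrite !ffunE mulrDl mulrDr.
Qed.

Lemma gmulDr f g h : gmul f (g + h) = gmul f g + gmul f h.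
Proof.
apply/ffunP => S; rewrite !(ffunE, gmulE) -big_split; apply: eq_bigr => T _ /=.
by rewrite !ffunE !mulrDr.
Qed.

Lemma gmulZl c f g : gmul (gscale c f) g = gscale c (gmul f g).
Proof.
apply/ffunP => S; rewrite !(ffunE, gmulE) big_distrr; apply: eq_bigr => T _ /=.
by rewrite ffunE -mulrA mulrCA.
Qed.

Lemma gmulZr c f g : gmul f (gscale c g) = gscale c (gmul f g).
Proof.
apply/ffunP => S; rewrite !(ffunE, gmulE) big_distrr; apply: eq_bigr => T _ /=.
by rewrite ffunE [f T * _]mulrCA [LHS]mulrCA.
Qed.

Lemma gscaleN1 f : gscale (-1) f = - f.
Proof. by apply/ffunP => S; rewrite !ffunE mulN1r. Qed.

Lemma gmulNl f g : gmul (- f) g = - gmul f g.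
Proof. by rewrite -!gscaleN1 gmulZl. Qed.

Lemma gmulNr f g : gmul f (- g) = - gmul f g.
Proof. by rewrite -!gscaleN1 gmulZr. Qed.

Lemma gmul0l f : gmul 0 f = 0.
Proof. by apply/ffunP => S; rewrite gmulE ffunE big1 // => T _; rewrite ffunE mul0r mulr0. Qed.

Lemma gmul0r f : gmul f 0 = 0.
Proof. by apply/ffunP => S; rewrite gmulE ffunE big1 // => T _; rewrite ffunE !mulr0. Qed.

Lemma cross0l S : cross finset.set0 S = 0%N.
Proof. by apply/eqP; rewrite cards_eq0; apply/eqP/setP => -[p q]; rewrite !inE. Qed.

Lemma cross0r S : cross S finset.set0 = 0%N.
Proof. by apply/eqP; rewrite cards_eq0; apply/eqP/setP => -[p q]; rewrite !inE andbF. Qed.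

Lemma gmul1l f : gmul (gconst n 1) f = f.
Proof.
apply/ffunP => S; rewrite gmulE (bigD1 finset.set0) ?sub0set //= big1 ?addr0.
  by rewrite ffunE eqxx setD0 cross0l expr0 !mul1r.
by move=> T /andP[_ /negbTE T0]; rewrite ffunE T0 mul0r mulr0.
Qed.

Lemma gmul1r f : gmul f (gconst n 1) = f.
Proof.
apply/ffunP => S; rewrite gmulE (bigD1 S) //= big1 ?addr0.
  by rewrite ffunE finset.setDv eqxx cross0r expr0 mulr1 mul1r.
move=> T /andP[sTS nTS]; rewrite ffunE ifF ?mulr0 //.
by apply: contraNF nTS; rewrite setD_eq0 => sST; rewrite eqEsubset sTS.
Qed.

Lemma gpermE phi w f S : gperm phi w f S = (-1) ^+ inv_on w (w @^-1: S) * phi (f (w @^-1: S)).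
Proof. by rewrite ffunE. Qed.

Lemma gpermD (phi : {additive R -> R}) w f g : gperm phi w (f + g) = gperm phi w f + gperm phi w g.
Proof. by apply/ffunP => S; rewrite gpermE [RHS]ffunE !gpermE ffunE raddfD mulrDr. Qed.

Lemma gpermN (phi : {additive R -> R}) w f : gperm phi w (- f) = - gperm phi w f.
Proof. by apply/ffunP => S; rewrite gpermE [RHS]ffunE !gpermE ffunE raddfN mulrN. Qed.

Lemma gperm0 (phi : {additive R -> R}) w : gperm phi w 0 = 0.
Proof. by apply/ffunP => S; rewrite gpermE !ffunE raddf0 mulr0. Qed.

Lemma gpermM (phi : {rmorphism R -> R}) w f g :
  gperm phi w (gmul f g) = gmul (gperm phi w f) (gperm phi w g).
Proof.
apply/ffunP => S; rewrite gpermE !gmulE rmorph_sum big_distrr /=.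
rewrite [RHS](reindex (fun U : {set 'I_n} => w @: U)) /=; last first.
  exists (fun U : {set 'I_n} => (w^-1)%g @: U) => U _; [exact: im_permK | exact: im_permKV].
apply: eq_big => [T|T sTS]; first by rewrite sub_imset_pre.
set S' := w @^-1: S in sTS *.
have wT : w @^-1: (w @: T) = T by rewrite preim_perm im_permK.
have SwT : w @^-1: (S :\: w @: T) = S' :\: T by rewrite preimsetD wT.
have SE : S = w @: S' by rewrite im_perm; apply/setP => x; rewrite !inE permKV.
rewrite !gpermE SwT wT !rmorphM /= rmorph_sign.
have dT : [disjoint T & S' :\: T] by rewrite -setI_eq0 setDE setICA setICr setI0.
have := inv_on_setU w dT.
have -> : T :|: S' :\: T = S'.
  by rewrite -{2}(finset.setID S' T); congr (_ :|: _); symmetry; apply/setIidPr.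
have -> : w @: (S' :\: T) = S :\: w @: T.
  by rewrite -SwT im_perm; apply/setP => x; rewrite !inE permKV.
move=> E; transitivity ((-1) ^+ (odd (inv_on w S') (+) odd (cross T (S' :\: T))) *
   (phi (f T) * phi (g (S' :\: T)))).
  by rewrite signr_addb !signr_odd -[RHS]mulrA.
by rewrite E !signr_addb !signr_odd; ring.
Qed.

Lemma gperm_comp (phi psi : {rmorphism R -> R}) w v f :
  gperm psi v (gperm phi w f) = gperm (psi \o phi) (w * v)%g f.
Proof.
apply/ffunP => S; rewrite !gpermE rmorphM /= rmorph_sign mulrA.
have -> : (w * v)%g @^-1: S = w @^-1: (v @^-1: S) by apply/setP => x; rewrite !inE permM.
congr (_ * _); rewrite -signr_odd -[in X in _ * X]signr_odd -signr_addb -[RHS]signr_odd inv_on_mul.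
rewrite addbC; congr (_ ^+ nat_of_bool (_ (+) odd (inv_on v _))).
by rewrite [in RHS]im_perm; apply/setP => x; rewrite !inE permKV.
Qed.

Lemma gperm1 f : gperm id 1%g f = f.
Proof.
apply/ffunP => S; rewrite gpermE inv_on_id => [|i _]; last by rewrite perm1.
by rewrite expr0 mul1r; congr (f _); apply/setP => x; rewrite inE perm1.
Qed.

Lemma gperm_proj (phi : {additive R -> R}) w b f :
  gperm phi w (gproj b f) = gproj (fun S => b (w @^-1: S)) (gperm phi w f).
Proof. by apply/ffunP => S; rewrite gpermE [RHS]ffunE ffunE gpermE; case: ifP => //; rewrite raddf0 mulr0. Qed.

Lemma swapK i j f : swap i j (swap i j f) = f.
Proof. by rewrite /swap (gperm_comp idfun idfun) tperm2 gperm1. Qed.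

Lemma swapM i j f g : swap i j (gmul f g) = gmul (swap i j f) (swap i j g).
Proof. exact: (gpermM idfun). Qed.

Lemma swapD i j f g : swap i j (f + g) = swap i j f + swap i j g.
Proof. exact: (gpermD idfun). Qed.

Lemma swapN i j f : swap i j (- f) = - swap i j f.
Proof. exact: (gpermN idfun). Qed.

Lemma swap_proj i j (b b' : pred {set 'I_n}) f :
  (forall S, b (tperm i j @^-1: S) = b' S) -> swap i j (gproj b f) = gproj b' (swap i j f).
Proof.
move=> bb; rewrite /swap (gperm_proj idfun) /=.
by apply/ffunP => S; rewrite ffunE [RHS]ffunE bb.
Qed.

Lemma swap_in i j f S : i != j -> i \in S -> j \in S -> swap i j f S = - f S.
Proof.
move=> nij iS jS; rewrite gpermE preim_perm tpermV im_tperm_in //.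
by rewrite -signr_odd odd_inv_on_tperm // mulN1r.
Qed.

Lemma swap_out i j f S : i \notin S -> j \notin S -> swap i j f S = f S.
Proof.
move=> iS jS; rewrite gpermE preim_perm tpermV im_tperm_notin //.
rewrite inv_on_id ?mul1r // => k kS; rewrite tpermD //;
by apply: contraTneq kS => <-.
Qed.

Lemma swap1 i j k f : swap i j f [set k] = f [set tperm i j k].
Proof.
by rewrite gpermE preim_perm tpermV imset_set1 inv_on1 mul1r.
Qed.

(** Absence of 2-torsion: antisymmetry by itself only shows that a component equals its opposite. *)
Definition nosign_char := forall x : R, x = - x -> x = 0.

(* f - swap i j f is a multiple of theta_i - theta_j, which squares to zero. *)
Lemma gmul_antiswap i j f g : nosign_char -> i != j ->
  gmul (f - swap i j f) (g - swap i j g) = 0.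
Proof.
move=> h2 nij; set u := f - _; set v := g - _.
have anti e : swap i j (e - swap i j e) = - (e - swap i j e).
  by rewrite swapD swapN swapK opprB addrC.
have z (e : super n R) (U : {set 'I_n}) : i \notin U -> j \notin U -> (e - swap i j e) U = 0.
  by move=> iU jU; rewrite gsubE swap_out // subrr.
apply/ffunP => S; rewrite [RHS]ffunE.
have hT (x : 'I_n) (T : {set 'I_n}) : T \subset S -> x \in S = false -> (x \in T = false) * (x \in S :\: T = false).
  by move=> sTS xS; split; [apply/negP => /(subsetP sTS); rewrite xS | rewrite inE xS andbF].
case iS: (i \in S); case jS: (j \in S).
(* Both factors change sign under [swap i j], so the product is fixed; but a component at a set
   containing i and j is negated. *)
- by apply: h2; rewrite -(swap_in _ nij iS jS) swapM !anti gmulNl gmulNr opprK.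
all: rewrite gmulE big1 // => T sTS.
- rewrite /u /v; case iT: (i \in T).
    by rewrite [(g - _) _]z ?mulr0 ?(hT _ _ sTS jS) // inE iT.
  by rewrite z ?mul0r ?mulr0 ?iT ?(hT _ _ sTS jS).
- rewrite /u /v; case jT: (j \in T).
    by rewrite [(g - _) _]z ?mulr0 ?(hT _ _ sTS iS) // inE jT.
  by rewrite z ?mul0r ?mulr0 ?jT ?(hT _ _ sTS iS).
- by rewrite /u z ?mul0r ?mulr0 ?(hT _ _ sTS iS) ?(hT _ _ sTS jS).
Qed.

Definition gder (d : super n R -> super n R) :=
  forall f g, d (gmul f g) = gmul (d f) g + gmul f (d g).

(** As K = [swap i j] is multiplicative, 1 - K satisfies the Leibniz rule up to the term (f - K f)(g
    - K g), which vanishes. *)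
Lemma gder_antiswap i j : nosign_char -> i != j -> gder (fun f => f - swap i j f).
Proof.
move=> h2 nij f g; have := gmul_antiswap f g h2 nij.
rewrite !(gmulDl, gmulDr, gmulNl, gmulNr) swapM opprK => E.
rewrite -[LHS]addr0 -E.
set a := gmul f g; set b := gmul f (swap _ _ _); set c := gmul _ g; set e := gmul _ _.
by rewrite addrACA [- e + _]addrCA addNr addr0 addrA addrACA -!addrA [- b + _]addrC.
Qed.

(** This projection is theta_i d/d(theta_i). *)
Lemma gder_proj i : gder (gproj (fun S : {set 'I_n} => i \in S)).
Proof.
move=> f g; apply/ffunP => S; rewrite !(ffunE, gmulE).
case iS: (i \in S).
  rewrite -big_split; apply: eq_bigr => T sTS; rewrite !ffunE inE iS andbT.
  by case: (i \in T) => /=; rewrite ?mul0r ?mulr0 ?addr0 ?add0r.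
rewrite -big_split big1 //= => T sTS; rewrite !ffunE inE iS andbF.
have -> : i \in T = false by apply/negP => /(subsetP sTS); rewrite iS.
by rewrite mul0r !mulr0 addr0.
Qed.

(* The derivation theta_i d/d(theta_j). *)
Definition gmove i j f := gproj (fun S : {set 'I_n} => (i \in S) && (j \notin S)) (swap i j f).

Lemma gder_move i j : i != j -> gder (gmove i j).
Proof.
move=> nij f g; apply/ffunP => S; rewrite [LHS]ffunE [RHS]ffunE.
case iS: (i \in S) => /=; last first.
  rewrite !gmulE -big_split big1 // => T sTS; rewrite /= !ffunE inE iS andbF /=.
  have -> : i \in T = false by apply/negP => /(subsetP sTS); rewrite iS.
  by rewrite mul0r !mulr0 addr0.
case jS: (j \in S) => /=; last first.
  rewrite swapM !gmulE -big_split; apply: eq_bigr => T sTS.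
  have jT : j \in T = false by apply/negP => /(subsetP sTS); rewrite jS.
  have jU : j \in S :\: T = false by rewrite inE jS andbF.
  rewrite /= [gmove _ _ _ _]ffunE [gmove _ _ _ _]ffunE jT jU !andbT inE iS andbT.
  case iT: (i \in T); rewrite ?mul0r ?mulr0 ?addr0 ?add0r /=.
    by rewrite (swap_out g) ?jU // inE iT.
  by rewrite (swap_out f) ?jT ?iT.
(* When S contains both i and j the left side is 0. On the right only the splittings of S that
   separate i from j contribute; [swap i j] interchanges the two sums and negates the component at
   S, so they cancel. *)
pose b1 := fun S : {set 'I_n} => (i \in S) && (j \notin S).
pose b2 := fun S : {set 'I_n} => (j \in S) && (i \notin S).
have b12 T : b1 (tperm i j @^-1: T) = b2 T by rewrite /b1 /b2 !inE tpermL tpermR.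
have b21 T : b2 (tperm i j @^-1: T) = b1 T by rewrite /b1 /b2 !inE tpermL tpermR.
have h1 : gmul (gmove i j f) g S = gmul (gmove i j f) (gproj b2 g) S.
  rewrite !gmulE; apply: eq_bigr => T sTS; rewrite [gmove i j f T]ffunE.
  case: ifP => [/andP[iT jT]|]; last by rewrite !mul0r.
  by rewrite [gproj b2 g _]ffunE /b2 !inE iT jT jS.
have h2 : gmul f (gmove i j g) S = gmul (gproj b2 f) (gmove i j g) S.
  rewrite !gmulE; apply: eq_bigr => T sTS; rewrite [gmove i j g _]ffunE !inE iS jS !andbT negbK.
  by rewrite [gproj b2 f T]ffunE /b2 andbC; case: ifP => //; rewrite !mulr0.
rewrite h1 h2 -[X in X + _]opprK -(swap_in _ nij iS jS) swapM.
by rewrite (swap_proj _ b21) /gmove (swap_proj (b' := b2)) ?swapK ?addNr.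
Qed.

End Grassmann.

(** * Derivations along a morphism of coefficient rings *)

Section GrassmannMap.
Variables (n : nat) (R R' : comNzRingType) (phi : {rmorphism R -> R'}).
Implicit Types (f g h : super n R).

Definition gmap f : super n R' := [ffun S : {set 'I_n} => phi (f S)].

Lemma gmapM f g : gmap (gmul f g) = gmul (gmap f) (gmap g).
Proof.
apply/ffunP => S; rewrite !(ffunE, gmulE) rmorph_sum; apply: eq_bigr => T _ /=.
by rewrite !ffunE !rmorphM /= rmorph_sign.
Qed.

Lemma gmapD f g : gmap (f + g) = gmap f + gmap g.
Proof. by apply/ffunP => S; rewrite !ffunE rmorphD. Qed.

Lemma gmap_const c : gmap (gconst n c) = gconst n (phi c).
Proof. by apply/ffunP => S; rewrite !ffunE; case: ifP => //; rewrite rmorph0. Qed.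

(** The operators take values with rational coefficients a priori, so the Leibniz rule is stated
    along the embedding of polynomials into fractions. *)
Definition gderalong (D : super n R -> super n R') :=
  forall f g, D (gmul f g) = gmul (D f) (gmap g) + gmul (gmap f) (D g).

Lemma gderalong_map d : gder d -> gderalong (gmap \o d).
Proof. by move=> hd f g; rewrite /= hd gmapD !gmapM. Qed.

Lemma gderalong_scale c D : gderalong D -> gderalong (gscale c \o D).
Proof.
move=> hD f g; rewrite /= hD gmulZl gmulZr.
by apply/ffunP => S; rewrite !ffunE mulrDr.
Qed.

Lemma gderalong_sum (I : Type) (r : seq I) (P : pred I) (D : I -> _) :
  (forall x, P x -> gderalong (D x)) -> gderalong (fun f => \sum_(x <- r | P x) D x f).
Proof.
move=> hD f g; elim/big_rec3: _ => [|x a b c Px IH]; first by rewrite gmul0l gmul0r addr0.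
rewrite hD // IH gmulDl gmulDr.
by apply/ffunP => S; rewrite !ffunE; ring.
Qed.

Lemma gderalong1 D : gderalong D -> D (gconst n 1) = 0.
Proof.
move=> /(_ (gconst n 1) (gconst n 1)); rewrite gmap_const rmorph1 !gmul1l gmul1r => /eqP.
by rewrite addrC -subr_eq subrr eq_sym => /eqP.
Qed.

Lemma gderalong_eigen_prod (T : Type) D (s : seq T) (F : T -> _) (E : T -> R') :
  gderalong D -> (forall x, D (F x) = gscale (E x) (gmap (F x))) ->
  D (\big[@gmul n R/gconst n 1]_(x <- s) F x) =
  gscale (\sum_(x <- s) E x) (gmap (\big[@gmul n R/gconst n 1]_(x <- s) F x)).
Proof.
move=> hD hE; elim: s => [|x s IH].
  by rewrite !big_nil gderalong1 //; apply/ffunP => S; rewrite !ffunE mul0r.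
rewrite !big_cons hD IH hE gmulZl gmulZr gmapM.
by apply/ffunP => S; rewrite !ffunE mulrDl.
Qed.
End GrassmannMap.

(** * Symmetric superpolynomials *)
Section Symmetric.
Variables (n : nat) (k : fieldType).
Implicit Types (f g : super n (polyx n k)) (S T : {set 'I_n}) (w v : 'S_n)
  (L G : spart) (c : multinom n).

Definition mperm c w : multinom n := Multinom [tuple c (w i) | i < n].

Lemma mpermE c w i : mperm c w i = c (w i).
Proof. by rewrite multinomE tnth_mktuple. Qed.

Lemma pair_permE w f S :
  pair_perm w f S = (-1) ^+ inv_on w (w @^-1: S) * msym w (f (w @^-1: S)).
Proof. exact: gpermE. Qed.

Lemma mcoeff_sign m c (p : polyx n k) : mcoeff c ((-1) ^+ m * p) = (-1) ^+ m * mcoeff c p.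
Proof. by rewrite -signr_odd -[in RHS]signr_odd; case: (odd m); rewrite ?expr0 ?expr1 ?mulN1r ?mul1r ?mcoeffN. Qed.

Lemma mcoeff_pair_perm w f S c : mcoeff c (pair_perm w f S) =
  (-1) ^+ inv_on w (w @^-1: S) * mcoeff (mperm c w) (f (w @^-1: S)).
Proof. by rewrite pair_permE mcoeff_sign mcoeff_sym. Qed.

Lemma superP f g : (forall S c, mcoeff c (f S) = mcoeff c (g S)) -> f = g.
Proof. by move=> h; apply/ffunP => S; apply/mpolyP => c. Qed.

Lemma pair_permD w f g : pair_perm w (f + g) = pair_perm w f + pair_perm w g.
Proof. exact: (gpermD (msym w)). Qed.

Lemma pair_perm0 w : pair_perm w (0 : super n (polyx n k)) = 0.
Proof. exact: (gperm0 (msym w)). Qed.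

Lemma pair_permZ w (a : k) f : pair_perm w (a *: f) = a *: pair_perm w f.
Proof.
apply: superP => S c; rewrite mcoeff_pair_perm [in RHS]ffunE mcoeffZ mcoeff_pair_perm.
by rewrite ffunE mcoeffZ mulrCA.
Qed.

Lemma pair_permM w f g : pair_perm w (gmul f g) = gmul (pair_perm w f) (pair_perm w g).
Proof. exact: (gpermM (msym w)). Qed.

Lemma pair_perm_comp w v f : pair_perm v (pair_perm w f) = pair_perm (w * v)%g f.
Proof.
rewrite /pair_perm (gperm_comp (msym w) (msym v)).
by apply/ffunP => S; rewrite gpermE [RHS]gpermE; congr (_ * _); exact: (esym (msymMm _ _ _)).
Qed.

Lemma pair_perm1 f : pair_perm 1%g f = f.
Proof.
by rewrite -[RHS]gperm1; apply/ffunP => S; rewrite !gpermE /= msym1m.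
Qed.

Lemma sym_swap f i j S : symmetric_super f -> swap i j f S = msym (tperm i j) (f S).
Proof.
move=> /(_ (tperm i j)) fE; rewrite -{2}fE pair_permE gpermE.
by rewrite rmorphM /= rmorph_sign -msymMm tperm2 msym1m.
Qed.

Lemma symmetric0 : symmetric_super (0 : super n (polyx n k)).
Proof. by move=> w; rewrite pair_perm0. Qed.

Lemma symmetricD f g : symmetric_super f -> symmetric_super g -> symmetric_super (f + g).
Proof. by move=> hf hg w; rewrite pair_permD hf hg. Qed.

Lemma symmetricZ (a : k) f : symmetric_super f -> symmetric_super (a *: f).
Proof. by move=> hf w; rewrite pair_permZ hf. Qed.

Lemma symmetricM f g : symmetric_super f -> symmetric_super g -> symmetric_super (gmul f g).
Proof. by move=> hf hg w; rewrite pair_permM hf hg. Qed.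

Lemma symmetric_sum (I : Type) (r : seq I) (P : pred I) (F : I -> super n (polyx n k)) :
  (forall x, P x -> symmetric_super (F x)) -> symmetric_super (\sum_(x <- r | P x) F x).
Proof.
move=> h; elim/big_rec: _ => [|x a Px]; first exact: symmetric0.
by apply: symmetricD; apply: h.
Qed.

(* A symmetric f is determined by its coefficients scoef L f of theta_1 .. theta_m x^L. *)
Definition rep_set L : {set 'I_n} := [set i : 'I_n | (i < fdeg L)%N].
Definition rep_mon L : multinom n := Multinom [tuple nth 0%N (asym L ++ ssym L) i | i < n].
Definition scoef L f : k := mcoeff (rep_mon L) (f (rep_set L)).

Lemma rep_monE L i : rep_mon L i = nth 0%N (asym L ++ ssym L) i.
Proof. by rewrite multinomE tnth_mktuple. Qed.

(** Records for each index whether it carries a theta, and its exponent: two terms with the same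
    multiset of such pairs are exchanged, up to sign, by a simultaneous permutation. *)
Definition skey S c : n.-tuple (bool * nat) := [tuple (i \in S, c i) | i < n].

Lemma skey_perm S c T (d : multinom n) : perm_eq (skey S c) (skey T d) ->
  exists w : 'S_n, S = w @^-1: T /\ c = mperm d w.
Proof.
case/tuple_permP => w /val_inj E; exists w.
have h (i : 'I_n) : (i \in S, c i) = (w i \in T, d (w i)).
  by have := congr1 (fun t => tnth t i) E; rewrite !tnth_mktuple.
split; first by apply/setP => i; rewrite inE; case: (h i).
by apply/mnmP => i; rewrite mpermE; case: (h i).
Qed.

Lemma perm_skey S c w : perm_eq (skey (w @^-1: S) (mperm c w)) (skey S c).
Proof.
apply/tuple_permP; exists w; congr tval; apply: eq_mktuple => i.
by rewrite inE mpermE tnth_mktuple.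
Qed.

Lemma sym_mcoeff f S c T (d : multinom n) : symmetric_super f -> perm_eq (skey S c) (skey T d) ->
  mcoeff d (f T) = 0 -> mcoeff c (f S) = 0.
Proof.
move=> fs /skey_perm[w [-> ->]]; rewrite -{1}(fs w) mcoeff_pair_perm => /eqP.
by rewrite mulf_eq0 signr_eq0 => /eqP.
Qed.

Lemma skey_rep L : (splen L <= n)%N -> skey (rep_set L) (rep_mon L) =
  [seq (true, a) | a <- asym L] ++ [seq (false, b) | b <- ssym L] ++
  nseq (n - splen L) (false, 0%N) :> seq _.
Proof.
move=> Ln; apply: (@eq_from_nth _ (false, 0%N)).
  rewrite size_tuple !size_cat !size_map size_nseq addnA.
  by rewrite -/(splen L) subnKC.
move=> i; rewrite size_tuple => ilt; rewrite -(tnth_nth _ _ (Ordinal ilt)) tnth_mktuple.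
rewrite inE /= rep_monE /= /fdeg !nth_cat !size_map.
have [h|h] := ltnP i (size (asym L)); first by rewrite (nth_map 0%N).
have [h'|h'] := ltnP (i - size (asym L)) (size (ssym L)); first by rewrite (nth_map 0%N).
by rewrite nth_nseq nth_default //; case: ifP.
Qed.

Lemma skey_split S c : perm_eq (skey S c)
  ([seq (true, c i) | i <- enum S] ++ [seq (false, c i) | i <- enum (~: S)]).
Proof.
have -> : skey S c = [seq (i \in S, c i) | i <- enum 'I_n] :> seq _ by [].
have : perm_eq (enum 'I_n) (enum S ++ enum (~: S)).
  apply: uniq_perm; first exact: enum_uniq.
    rewrite cat_uniq !enum_uniq andbT /=; apply/hasPn => i.
    by rewrite !mem_enum inE => /negbTE->.
  by move=> i; rewrite mem_cat !mem_enum !inE orbN.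
move/(perm_map (fun i => (i \in S, c i))); rewrite map_cat => /perm_trans; apply.
apply: perm_cat; apply/seq.permP => a; congr count; apply/eq_in_map => i.
  by rewrite mem_enum => ->.
by rewrite mem_enum inE => /negbTE->.
Qed.

Lemma spart_eq L G : asym L = asym G -> ssym L = ssym G -> L = G.
Proof.
move=> h1 h2; apply: val_inj => /=.
by move: h1 h2; rewrite /asym /ssym; case: (spval L) (spval G) => a b [a' b'] /= -> ->.
Qed.

Lemma asym_sorted L : sorted gtn (asym L).
Proof. by case/and3P: (spvalP L). Qed.

Lemma ssym_sorted L : sorted geq (ssym L).
Proof. by case/and3P: (spvalP L). Qed.

Lemma ssym_n0 L : 0%N \notin ssym L.
Proof. by case/and3P: (spvalP L). Qed.

Lemma geq_trans : transitive geq.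
Proof. by move=> a b d /= h1 h2; exact: leq_trans h2 h1. Qed.

Lemma geq_anti : antisymmetric geq.
Proof. by move=> a b /=; rewrite andbC => /anti_leq. Qed.

Lemma geq_total : total geq.
Proof. by move=> a b; exact: leq_total. Qed.

Lemma gtn_sorted s : sorted gtn s = uniq s && sorted geq s.
Proof.
by have := ltn_sorted_uniq_leq (rev s); rewrite !rev_sorted rev_uniq.
Qed.

Lemma spart_perm_eq L G : perm_eq (asym L) (asym G) -> perm_eq (ssym L) (ssym G) -> L = G.
Proof.
move=> hA hB; apply: spart_eq; apply: (sorted_eq geq_trans geq_anti) => //;
  try exact: ssym_sorted.
- by have := asym_sorted L; rewrite gtn_sorted => /andP[].
- by have := asym_sorted G; rewrite gtn_sorted => /andP[].
Qed.

Lemma skey_rep_inj L G : (splen L <= n)%N -> (splen G <= n)%N ->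
  perm_eq (skey (rep_set L) (rep_mon L)) (skey (rep_set G) (rep_mon G)) -> L = G.
Proof.
move=> Ln Gn; rewrite !skey_rep // => h.
pose p1 (x : bool * nat) := x.1.
pose p2 (x : bool * nat) := ~~ x.1 && (x.2 != 0%N).
have e1 H : [seq x.2 | x <- [seq x <- [seq (true, a) | a <- asym H] ++ [seq (false, b) | b <- ssym H] ++
  nseq (n - splen H) (false, 0%N) | p1 x]] = asym H.
  rewrite !filter_cat !filter_map filter_nseq /= cats0 filter_pred0 cats0.
  by rewrite -map_comp filter_predT map_id.
have e2 H : [seq x.2 | x <- [seq x <- [seq (true, a) | a <- asym H] ++ [seq (false, b) | b <- ssym H] ++
  nseq (n - splen H) (false, 0%N) | p2 x]] = ssym H.
  rewrite !filter_cat !filter_map filter_nseq /= cats0 filter_pred0 /=.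
  rewrite -map_comp (@eq_in_filter _ _ predT) ?filter_predT ?map_id //.
  by move=> b bH; rewrite /p2 /=; apply: contraTneq bH => ->; rewrite (negbTE (ssym_n0 H)).
apply: spart_perm_eq.
- by rewrite -(e1 L) -(e1 G); apply: perm_map; apply: perm_filter.
- by rewrite -(e2 L) -(e2 G); apply: perm_map; apply: perm_filter.
Qed.

(** Injectivity of c on S makes the circled entries distinct. Zero exponents outside S are dropped
    from [ssym] and reappear as the padding of the representative. *)
Lemma type_exists S c : {in S &, injective c} ->
  exists2 L, (splen L <= n)%N & perm_eq (skey S c) (skey (rep_set L) (rep_mon L)).
Proof.
move=> cinj.
set A := sort geq [seq c i | i <- enum S].
set B0 := [seq c i | i <- enum (~: S)].
set B := sort geq [seq b <- B0 | b != 0%N].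
have AB : is_spart (A, B).
  apply/and3P; split => /=.
  - rewrite gtn_sorted sort_uniq sort_sorted ?andbT; last exact: geq_total.
    rewrite map_inj_in_uniq ?enum_uniq // => i j; rewrite !mem_enum; exact: cinj.
  - exact: sort_sorted geq_total _.
  - by rewrite mem_sort mem_filter eqxx.
have sz : (size A + size B0 = n)%N.
  by rewrite size_sort !size_map -!cardE cardsC card_ord.
have szB : (size B <= size B0)%N by rewrite size_sort size_filter count_size.
exists (SPart AB); first by rewrite /splen /= -sz leq_add2l.
apply: perm_trans (skey_split S c) _; rewrite skey_rep /splen /=; last first.
  by rewrite -sz leq_add2l.
apply: perm_cat.
  rewrite (map_comp (pair true)); apply: perm_map; rewrite perm_sym; exact/permPl/perm_sort.
rewrite (map_comp (pair false)) -/B0.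
have -> : nseq (n - (size A + size B)) (false, 0%N) = [seq (false, b) | b <- nseq (size B0 - size B) 0%N].
  by rewrite map_nseq -sz subnDl.
rewrite -map_cat; apply: perm_map.
have := permEl (perm_filterC (fun b => b != 0%N) B0); rewrite perm_sym => /perm_trans; apply.
apply: perm_cat; first by rewrite perm_sym; exact/permPl/perm_sort.
have -> : (size B0 - size B)%N = size [seq b <- B0 | predC (fun b => b != 0%N) b].
  by rewrite size_sort !size_filter -(count_predC (fun b => b != 0%N) B0) addKn.
set s := filter _ _; have : all (pred1 0%N) s.
  by apply/allP => b; rewrite mem_filter /= negbK => /andP[].
by move/all_pred1P => {1}->.
Qed.

(** A term with equal exponents at two indices of S is its own opposite, by the transposition of
    these indices. Any other term is in the orbit of the representative of some superpartition. *)
Lemma symmetric_ext f : (forall x : k, x = - x -> x = 0) -> symmetric_super f ->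
  (forall L, (splen L <= n)%N -> scoef L f = 0) -> f = 0.
Proof.
move=> h2 fs f0; apply: superP => S c; rewrite ffunE mcoeff0.
have [/injectiveP ci|] := boolP (injectiveb (fun i : {i | i \in S} => c (val i))).
  have cinj : {in S &, injective c}.
    by move=> i j iS jS e; have := ci (exist _ i iS) (exist _ j jS) e => -[].
  have [L Ln h] := type_exists cinj.
  exact: sym_mcoeff fs h (f0 L Ln).
case/injectivePn => -[i iS] [[j jS]] /= nij e.
have nij' : j != i by apply: contra nij => /eqP ji; apply/eqP/val_inj.
apply: h2; rewrite -{1}(fs (tperm j i)) mcoeff_pair_perm preim_perm tpermV im_tperm_in //.
rewrite -signr_odd odd_inv_on_tperm //= mulN1r; congr (- mcoeff _ _).
by apply/mnmP => l; rewrite mpermE; case: tpermP => // ->.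
Qed.

Lemma smonomialE L S : smonomial n k L S = if S == rep_set L then mpolyX k (rep_mon L) else 0.
Proof.
rewrite ffunE; case: ifP => // _; rewrite mpolyXE_id.
by apply: eq_bigr => i _; rewrite rep_monE.
Qed.

Lemma mcoeff_smonomial w L S c :
  mcoeff c (pair_perm w (smonomial n k L) S) =
  (-1) ^+ inv_on w (w @^-1: S) * ((w @^-1: S == rep_set L) && (mperm c w == rep_mon L))%:R.
Proof.
rewrite mcoeff_pair_perm smonomialE; case: eqP => _ /=; last by rewrite mcoeff0.
by rewrite mcoeffX eq_sym.
Qed.

Lemma mcoeff_msuper_neq0 L S c : mcoeff c (msuper n k L S) != 0 ->
  (splen L <= n)%N /\ perm_eq (skey S c) (skey (rep_set L) (rep_mon L)).
Proof.
rewrite /msuper; case: ifP => Ln; last by rewrite ffunE mcoeff0 eqxx.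
rewrite sum_ffunE raddf_sum /= => h; split => //.
have [f /= fin] : exists2 f, f \in undup [seq pair_perm w (smonomial n k L) | w : 'S_n]
    & mcoeff c (f S) != 0.
  apply/hasP; apply: contraNT h => /hasPn h; rewrite big_seq big1 // => f /h.
  by rewrite negbK => /eqP.
move: fin; rewrite mem_undup => /mapP[w _ ->]; rewrite mcoeff_smonomial.
case: (_ =P rep_set L) => [<-|_] /=; last by rewrite mulr0 eqxx.
case: (_ =P rep_mon L) => [<-|_] /=; last by rewrite mulr0 eqxx.
by rewrite perm_sym perm_skey.
Qed.

Lemma rep_mon_inj L : {in rep_set L &, injective (rep_mon L)}.
Proof.
move=> i j; rewrite !inE !rep_monE !nth_cat /fdeg => iL jL; rewrite iL jL => /eqP.
by rewrite nth_uniq ?asym_uniq // => /eqP /val_inj.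
Qed.

Lemma scoef_msuper L G : (splen G <= n)%N -> scoef G (msuper n k L) = (L == G)%:R.
Proof.
have [<-|nLG] := eqVneq L G => Gn; last first.
  apply/eqP; apply: contraNT nLG => /mcoeff_msuper_neq0[Ln] /skey_rep_inj -> //.
rewrite /scoef /msuper Gn sum_ffunE raddf_sum /=.
set l := undup _.
have sl : smonomial n k L \in l.
  by rewrite mem_undup; apply/mapP; exists 1%g; rewrite ?mem_enum // pair_perm1.
rewrite (bigD1_seq _ sl) ?undup_uniq //= smonomialE eqxx mcoeffX eqxx big_seq_cond big1 ?addr0 //.
move=> f /andP[]; rewrite mem_undup => /mapP[w _ ->] nf.
rewrite mcoeff_smonomial; case: eqP => [wS|]; last by rewrite mulr0.
case: eqP => [wm|]; last by rewrite mulr0.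
case/eqP: nf.
(* Fermionic exponents are distinct, so a permutation preserving the representative term fixes every
   fermionic index. No sign arises and the permuted [smonomial] is the original one, which [undup]
   counts once. *)
have fixS : {in rep_set L, forall i, w i = i}.
  move=> i iS; apply: (@rep_mon_inj L) => //; last by rewrite -mpermE wm.
  by move: iS; rewrite -{1}wS inE.
apply: superP => S c; rewrite mcoeff_smonomial smonomialE.
have -> : (w @^-1: S == rep_set L) = (S == rep_set L).
  rewrite -{1}wS; apply/eqP/eqP => [|-> //]; rewrite !preim_perm.
  by move/(congr1 (fun T : {set 'I_n} => w @: T)); rewrite !im_permKV.
case: eqP => [->|] /=; last by rewrite mulr0 mcoeff0.
rewrite wS inv_on_id // mul1r mcoeffX; congr (nat_of_bool _)%:R.
rewrite -{1}wm [RHS]eq_sym; apply/eqP/eqP => [|-> //] /mnmP h; apply/mnmP => i.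
by have := h (w^-1 i)%g; rewrite !mpermE permKV.
Qed.

Lemma msuper_symmetric L : symmetric_super (msuper n k L).
Proof.
rewrite /msuper; case: ifP => _; last exact: symmetric0.
move=> v; set l := undup _.
have -> : pair_perm v (\sum_(f <- l) f) = \sum_(f <- l) pair_perm v f.
  by rewrite (big_morph (pair_perm v) (pair_permD v) (pair_perm0 v)).
rewrite -(big_map (pair_perm v) predT id); apply: perm_big.
have vinj : injective (pair_perm (k := k) v).
  move=> f g /(congr1 (pair_perm (v^-1)%g)).
  by rewrite !pair_perm_comp mulgV !pair_perm1.
apply: uniq_perm; rewrite ?map_inj_uniq ?undup_uniq //.
move=> f; rewrite mem_undup; apply/mapP/mapP => [[g]|[w _ ->]].
  rewrite mem_undup => /mapP[w _ ->] ->; exists (w * v)%g; first by rewrite mem_enum.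
  exact: pair_perm_comp.
exists (pair_perm (w * v^-1)%g (smonomial n k L)); last by rewrite pair_perm_comp mulgKV.
by rewrite mem_undup; apply/mapP; exists (w * v^-1)%g; first by rewrite mem_enum.
Qed.

Lemma scoef_sum (I : Type) (r : seq I) (P : pred I) (F : I -> super n (polyx n k)) G :
  scoef G (\sum_(x <- r | P x) F x) = \sum_(x <- r | P x) scoef G (F x).
Proof. by rewrite /scoef sum_ffunE raddf_sum. Qed.

Lemma scoefZ (a : k) f G : scoef G (a *: f) = a * scoef G f.
Proof. by rewrite /scoef ffunE mcoeffZ. Qed.

Lemma scoefB f g G : scoef G (f - g) = scoef G f - scoef G g.
Proof. by rewrite /scoef !ffunE mcoeffB. Qed.

Lemma scoef_comb (a : {fsfun spart -> k with 0}) G : (splen G <= n)%N ->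
  scoef G (smon_comb n a) = a G.
Proof.
move=> Gn; rewrite /smon_comb scoef_sum.
under eq_bigr => W _ do rewrite scoefZ scoef_msuper //.
have [Ga|Ga] := boolP (G \in finsupp a).
  rewrite (bigD1_seq G) ?fset_uniq //= eqxx mulr1 big1 ?addr0 // => W /negbTE->.
  by rewrite mulr0.
rewrite fsfun_dflt // big_seq big1 // => W Wa; case: eqP => [WG|]; last by rewrite mulr0.
by rewrite WG (negbTE Ga) in Wa.
Qed.

Lemma smon_comb_symmetric (a : {fsfun spart -> k with 0}) : symmetric_super (smon_comb n a).
Proof. by apply: symmetric_sum => W _; apply: symmetricZ; exact: msuper_symmetric. Qed.

Lemma symmetric_comb f (a : {fsfun spart -> k with 0}) :
  (forall x : k, x = - x -> x = 0) -> symmetric_super f ->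
  (forall L, (splen L <= n)%N -> scoef L f = a L) -> f = smon_comb n a.
Proof.
move=> h2 fs fa; apply/eqP; rewrite -subr_eq0; apply/eqP; apply: symmetric_ext => //.
  rewrite -scaleN1r; apply: symmetricD => //; apply: symmetricZ; exact: smon_comb_symmetric.
by move=> L Ln; rewrite scoefB scoef_comb // fa // subrr.
Qed.
End Symmetric.

(** * A coarsening of the Bruhat order *)
Section TailSums.
Local Open Scope nat_scope.
Implicit Types (s : seq nat) (W L : spart).

(** With truncated subtraction this counts the boxes in the columns t, t + 1, ... of the diagram
    with rows s. It is additive over the entries and ignores their order, which makes it handier
    than partial sums of sorted sequences. *)
Definition tail s t := \sum_(v <- s) (v - t).

Lemma tail_cat s s' t : tail (s ++ s') t = tail s t + tail s' t.
Proof. exact: big_cat. Qed.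

Lemma tail_perm s s' t : perm_eq s s' -> tail s t = tail s' t.
Proof. exact: perm_big. Qed.

Lemma tail0 s : tail s 0 = sumn s.
Proof. by rewrite sumnE; apply: eq_bigr => v _; rewrite subn0. Qed.

Lemma tail_nseq0 m t : tail (nseq m 0) t = 0.
Proof. by rewrite /tail big_nseq; elim: m => //= m ->; rewrite sub0n. Qed.

Lemma tailS s t : tail s t = tail s t.+1 + count (fun v => t < v) s.
Proof.
rewrite -sum1_count big_mkcond -big_split; apply: eq_bigr => v _ /=.
by case: ltnP => h; lia.
Qed.

Lemma tail_count s s' : (forall t, tail s t = tail s' t) ->
  forall t, count (fun v => t < v) s = count (fun v => t < v) s'.
Proof. by move=> h t; have := tailS s t; rewrite h tailS h => /addnI. Qed.

Lemma count_perm_eq s s' : size s = size s' ->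
  (forall t, count (fun v => t < v) s = count (fun v => t < v) s') -> perm_eq s s'.
Proof.
move=> sz h; apply/allP => x _ /=; apply/eqP.
have e (r : seq nat) t : count (fun v => t < v) r = count_mem t.+1 r + count (fun v => t.+1 < v) r.
  rewrite -[RHS]count_predUI [X in _ + X](@eq_count _ _ pred0) ?count_pred0 ?addn0.
    by apply: eq_count => v /=; lia.
  by move=> v /=; lia.
case: x => [|x]; last by have := e s x; rewrite h e h => /addIn.
have e0 (r : seq nat) : size r = count_mem 0 r + count (fun v => 0 < v) r.
  rewrite -(count_predC (pred1 0)); congr addn; apply: eq_count => v /=; lia.
by have := e0 s; rewrite h sz e0 => /addIn.
Qed.

Lemma count_gt_nth s i t : sorted geq s -> (i < count (fun v => t < v) s) = (t < nth 0 s i).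
Proof.
move=> ss; have ss' : sorted row_ge [seq (v, false) | v <- s].
  apply: homo_sorted ss => a b /= ab; rewrite /row_ge /= andbT orbC eq_sym -leq_eqVlt //.
have := count_rows t i ss'; rewrite count_map /= => ->.
have [h|h] := ltnP i (size s); first by rewrite (nth_map 0).
by rewrite !nth_default ?size_map.
Qed.

Lemma count_le_nth s s' : sorted geq s -> sorted geq s' ->
  (forall t, count (fun v => t < v) s <= count (fun v => t < v) s') ->
  forall i, nth 0 s i <= nth 0 s' i.
Proof.
move=> ss ss' h i; rewrite leqNgt; apply/negP => lt.
have := leq_trans _ (h (nth 0 s' i)) => /(_ i.+1).
by rewrite !count_gt_nth // ltnn lt => /(_ isT).
Qed.

(** For k the number of entries of s above t, the tail of s is the k-th partial sum minus k t. For
    s' the same difference is at most the tail, whatever k is. *)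
Lemma tail_le_take s s' : sorted geq s -> 
  (forall k, sumn (take k s) <= sumn (take k s')) -> forall t, tail s t <= tail s' t.
Proof.
move=> ss h t; pose k := count (fun v => t < v) s.
have e1 : tail s t + k * t = sumn (take k s).
  rewrite -{1}(cat_take_drop k s) tail_cat.
  have kz : k <= size s by exact: count_size.
  have -> : tail (drop k s) t = 0.
    rewrite /tail big_seq big1 // => v /(nthP 0)[i]; rewrite size_drop nth_drop => hi <-.
    have := count_gt_nth (k + i) t ss; rewrite -/k ltnNge leq_addr /= => /esym/negbT.
    by rewrite -leqNgt -subn_eq0 => /eqP.
  rewrite addn0 sumnE -{2}(size_takel kz) -sum1_size big_distrl -big_split.
  rewrite big_seq [RHS]big_seq; apply: eq_bigr => v /(nthP 0)[i] /=.
  rewrite size_takel // => hi; rewrite nth_take // => <-.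
  have := count_gt_nth i t ss; rewrite -/k hi => /esym lt; lia.
have e2 : sumn (take k s') <= tail s' t + k * t.
  rewrite -{2}(cat_take_drop k s') tail_cat.
  suff : sumn (take k s') <= tail (take k s') t + k * t by lia.
  apply: leq_trans (_ : tail (take k s') t + size (take k s') * t <= _).
    rewrite sumnE -sum1_size big_distrl -big_split; apply: leq_sum => v _ /=; lia.
  by rewrite leq_add2l leq_mul2r size_take_min geq_minl orbT.
by rewrite -(leq_add2r (k * t)) e1 (leq_trans (h k)).
Qed.

Lemma ltn_sum_nth (f g : nat -> nat) s s' i : size s = size s' -> i < size s' ->
  (forall l, f (nth 0 s l) <= g (nth 0 s' l)) -> f (nth 0 s i) < g (nth 0 s' i) ->
  \sum_(v <- s) f v < \sum_(v <- s') g v.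
Proof.
elim: s s' i => [|x s IH] [|y s'] // i [sz] ilt le lt; rewrite !big_cons.
case: i ilt lt => [|i] /= ilt lt.
  rewrite -addSn leq_add // (big_nth 0) [X in _ <= X](big_nth 0) sz.
  by apply: leq_sum => l _; apply: (le l.+1).
rewrite -addnS leq_add //; first exact: (le 0).
by apply: (IH s' i) => // l; apply: (le l.+1).
Qed.

Definition parts L := asym L ++ ssym L.

Lemma tail_parts0 L : tail (parts L) 0 = tdeg L.
Proof. by rewrite tail0 sumn_cat. Qed.

Lemma colhtE L j : colht L j = count (fun v => j < v) (parts L).
Proof. by rewrite /colht count_sort count_cat !count_map -count_cat. Qed.

Lemma mem_leq_sumn s v : v \in s -> v <= sumn s.
Proof. by move=> vs; rewrite (perm_sumn (perm_to_rem vs)) leq_addr. Qed.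

Lemma parts_le L v : v \in parts L -> v <= tdeg L.
Proof. by move/mem_leq_sumn; rewrite sumn_cat. Qed.

Lemma asym_le L v : v \in asym L -> v <= tdeg L.
Proof. by move=> vL; apply: parts_le; rewrite mem_cat vL. Qed.

(** Double counting of the boxes, a box of column j having weight x j. *)
Lemma sum_colht_gen L (x : nat -> nat) B : (forall v, v \in parts L -> v <= B) ->
  \sum_(j < B) colht L j * x j = \sum_(v <- parts L) \sum_(j < v) x j.
Proof.
move=> hB; transitivity (\sum_(v <- parts L) \sum_(j < B) (j < v) * x j).
  rewrite exchange_big /=; apply: eq_bigr => j _; rewrite -big_distrl /= colhtE.
  by congr (_ * _); rewrite -sum1_count big_mkcond; apply: eq_bigr => v _; case: ifP.
apply: eq_big_seq => v /hB vB; rewrite (big_ord_widen _ (fun j => x j) vB) [RHS]big_mkcond.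
by apply: eq_bigr => j _; case: ifP => _; rewrite ?mul1n ?mul0n.
Qed.

Lemma sum_colht_tail L t B : (forall v, v \in parts L -> v <= B) ->
  \sum_(j < B | t <= j) colht L j = tail (parts L) t.
Proof.
move=> hB; transitivity (\sum_(j < B) colht L j * (t <= j)).
  by rewrite big_mkcond; apply: eq_bigr => j _; case: ifP; rewrite ?muln1 ?muln0.
rewrite (sum_colht_gen (fun j => t <= j)) //; apply: eq_bigr => v _.
elim: v => [|v IH]; first by rewrite big_ord0.
by rewrite big_ord_recr /= IH; case: leqP; lia.
Qed.

(** The columns in the order of [conj_pair]: circled ones from left to right, then the remaining
    ones containing a box. A circled column may contain no box. *)
Definition circ_cols L := rev (asym L) ++ [seq j <- iota 0 (ncols L) | j \notin asym L].

Lemma parts_spconj L : parts (spconj L) = [seq colht L j | j <- circ_cols L].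
Proof. by rewrite map_cat. Qed.

Lemma circ_cols_uniq L : uniq (circ_cols L).
Proof.
rewrite cat_uniq rev_uniq asym_uniq filter_uniq ?iota_uniq // andbT /=.
by apply/hasPn => j; rewrite mem_filter mem_rev => /andP[].
Qed.

Lemma sum_circ_cols L (x : nat -> nat) B : (forall v, v \in parts L -> v < B) ->
  (forall j, colht L j = 0 -> x j = 0) ->
  \sum_(j <- circ_cols L) x j = \sum_(j < B) x j.
Proof.
move=> hB x0; rewrite -(big_mkord predT) [RHS](bigID (mem (circ_cols L))) /= [X in _ + X]big1 ?addn0.
  rewrite -[RHS]big_filter; apply: perm_big; apply: uniq_perm.
  - exact: circ_cols_uniq.
  - by rewrite filter_uniq // iota_uniq.
  move=> j; rewrite mem_filter mem_index_iota /= andb_idr //.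
  rewrite mem_cat mem_rev mem_filter mem_iota /= add0n => /orP[jL|/andP[_]].
    by apply: hB; rewrite mem_cat jL.
  move=> h; apply: leq_trans h _; apply/bigmax_leqP_seq => r.
  rewrite mem_sort mem_cat => /orP[]/mapP[v vL ->] _ /=; apply: ltnW;
  by apply: hB; rewrite mem_cat vL ?orbT.
move=> j; rewrite mem_cat mem_rev mem_filter mem_iota /= add0n negb_or negb_and negbK.
case/andP => /negbTE-> /=; rewrite -leqNgt => h; apply: x0.
apply/eqP; rewrite eqn0Ngt -has_count; apply/hasPn => r rL; rewrite -leqNgt.
by apply: leq_trans h; rewrite /ncols (big_rem r) //= leq_maxl.
Qed.

Definition sqparts L := \sum_(v <- parts L) v ^ 2.

Lemma sum_sub_sq v B : v <= B -> 2 * \sum_(t < B) (v - t) = v ^ 2 + v.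
Proof.
elim: v B => [|v IH] [|B] // vB; rewrite ?big_ord0 //.
  by rewrite big1.
rewrite big_ord_recl subn0 mulnDr; under eq_bigr do rewrite lift0 subSS.
rewrite IH //; lia.
Qed.

(** Since v^2 + v is twice the sum of the (v - t)^+ over t, [sqparts] is, at fixed size, an
    increasing function of the tails. *)
Lemma sqparts_tail L : sqparts L + tdeg L = 2 * \sum_(t < (tdeg L).+1) tail (parts L) t.
Proof.
rewrite exchange_big /= big_distrr /= -tail_parts0 -big_split /=.
apply: eq_big_seq => v vL; rewrite sum_sub_sq ?subn0 //.
by rewrite tail_parts0; apply: leqW; apply: parts_le.
Qed.

Lemma sqparts_spconj L B : tdeg L < B -> sqparts (spconj L) = \sum_(j < B) colht L j ^ 2.
Proof.
move=> LB; rewrite /sqparts parts_spconj big_map (@sum_circ_cols _ (fun j => colht L j ^ 2) B) //.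
  by move=> v /parts_le vL; apply: leq_ltn_trans vL LB.
by move=> j ->.
Qed.

(* Dominance of the rearrangements, through the sums of (v - t)^+, and, for equal rearrangements,
   comparison of the fermionic entries. *)
Definition lep W L := [/\ fdeg W = fdeg L, tdeg W = tdeg L,
  forall t, tail (parts W) t <= tail (parts L) t &
  (forall t, tail (parts W) t = tail (parts L) t) ->
    forall i, nth 0 (asym W) i <= nth 0 (asym L) i].

Lemma asym_sorted_geq L : sorted geq (asym L).
Proof. by have := asym_sorted L; rewrite gtn_sorted => /andP[]. Qed.

Lemma lep_count W L : fdeg W = fdeg L -> tdeg W = tdeg L ->
  (forall t, tail (parts W) t <= tail (parts L) t) ->
  ((forall t, tail (parts W) t = tail (parts L) t) ->
    forall t, count (fun v => t < v) (asym W) <= count (fun v => t < v) (asym L)) -> lep W L.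
Proof.
move=> h1 h2 h3 h4; split=> // e i; apply: count_le_nth; last exact: h4.
- exact: asym_sorted_geq.
- exact: asym_sorted_geq.
Qed.

Lemma lep_refl L : lep L L.
Proof. by split. Qed.

Lemma tail_asym_eq W L : (forall t, tail (parts W) t = tail (parts L) t) ->
  asym W = asym L -> W = L.
Proof.
move=> h e; apply: spart_perm_eq; rewrite ?e //.
have c t : count (fun v => t < v) (ssym W) = count (fun v => t < v) (ssym L).
  by have := tail_count h t; rewrite !count_cat e => /addnI.
apply: count_perm_eq => //.
have z H : size (ssym H) = count (fun v => 0 < v) (ssym H).
  symmetry; apply/eqP; rewrite -all_count; apply/allP => v vH; rewrite lt0n.
  by apply: contraTneq vH => ->; exact: ssym_n0.
by rewrite !z c.
Qed.

Lemma lep_sep W L : lep W L -> W <> L ->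
  sqparts W < sqparts L /\ sqparts (spconj L) < sqparts (spconj W) \/
  [/\ sqparts W = sqparts L, sqparts (spconj W) = sqparts (spconj L),
    sumn (asym W) < sumn (asym L) & sumn (asym (spconj L)) < sumn (asym (spconj W))].
Proof.
case=> hf ht hT hA nWL; set B := (tdeg L).+1.
have WB v : v \in parts W -> v <= B by move=> /parts_le h; rewrite /B -ht leqW.
have LB v : v \in parts L -> v <= B by move=> /parts_le h; rewrite /B leqW.
have sqW := sqparts_tail W; have sqL := sqparts_tail L; rewrite ht -/B in sqW sqL.
have cW : sqparts (spconj W) = \sum_(j < B) colht W j ^ 2 by apply: sqparts_spconj; rewrite /B ht.
have cL : sqparts (spconj L) = \sum_(j < B) colht L j ^ 2 by apply: sqparts_spconj; rewrite /B.
have Tbig H (HB : forall v, v \in parts H -> v <= B) t : B <= t -> tail (parts H) t = 0.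
  by move=> Bt; rewrite /tail big_seq big1 // => v /HB vB; apply/eqP; rewrite subn_eq0 (leq_trans vB).
case: (boolP [forall t : 'I_B, tail (parts W) t == tail (parts L) t]) => [/forallP e|].
  right; have {}e t : tail (parts W) t = tail (parts L) t.
    have [tB|tB] := ltnP t B; first exact/eqP/(e (Ordinal tB)).
    by rewrite !Tbig.
  have hc j : colht W j = colht L j by rewrite !colhtE (tail_count e).
  have nA : exists2 i, i < size (asym L) & nth 0 (asym W) i < nth 0 (asym L) i.
    have [/existsP[i hi]|/existsPn h] := boolP [exists i : 'I_(size (asym L)), nth 0 (asym W) i < nth 0 (asym L) i].
      by exists i.
    case: nWL; apply: tail_asym_eq => //; apply: (@eq_from_nth _ 0) => // i; rewrite -/(fdeg W) hf => iL.
    by apply/eqP; rewrite eqn_leq hA //= leqNgt (h (Ordinal iL)).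
  have [i iL lti] := nA.
  have sz : size (asym W) = size (asym L) := hf.
  split.
  - by apply/eqP; rewrite -(eqn_add2r (tdeg L)) sqW sqL; apply/eqP; congr (2 * _); apply: eq_bigr.
  - by rewrite cW cL; apply: eq_bigr => j _; rewrite hc.
  - by rewrite !sumnE; apply: (@ltn_sum_nth id id _ _ i) => // l; apply: hA.
  - rewrite !sumnE /= !big_map.
    have rv H : \sum_(j <- rev (asym H)) colht H j = \sum_(j <- asym H) colht H j.
      by apply: perm_big; rewrite perm_rev.
    rewrite !rv; apply: (@ltn_sum_nth _ _ _ _ i); rewrite ?sz //.
      by move=> l; rewrite hc colht_le // hA.
    by rewrite hc colht_lt // mem_nth.
rewrite negb_forall => /existsP[t nt]; left.
have ltT : tail (parts W) t < tail (parts L) t by rewrite ltn_neqAle nt hT.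
split.
  have : \sum_(t < B) tail (parts W) t < \sum_(t < B) tail (parts L) t.
    rewrite (bigD1 t) //= [X in _ < X](bigD1 t) //= -addSn leq_add //.
    by apply: leq_sum => l _; apply: hT.
  by lia.
(* By double counting, both sides sum over the rows v of L the number of boxes in the first v
   columns, which is the size minus the tail at v. *)
have key : \sum_(j < B) colht L j * colht L j <= \sum_(j < B) colht L j * colht W j.
  rewrite !sum_colht_gen //; rewrite big_seq [X in _ <= X]big_seq; apply: leq_sum => v /LB vB.
  have sp H (HB : forall v, v \in parts H -> v <= B) :
      \sum_(j < v) colht H j + tail (parts H) v = tdeg H.
    rewrite -tail_parts0 -(sum_colht_tail v HB) -(sum_colht_tail 0 HB).
    rewrite [RHS](bigID (fun j : 'I_B => j < v)) /=; congr (_ + _).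
      by rewrite (big_ord_widen _ (fun j => colht H j) vB).
    by apply: eq_bigl => j; rewrite -leqNgt.
  have := sp _ WB; have := sp _ LB; have := hT v; lia.
have [j nj] : exists j : 'I_B, colht W j != colht L j.
  apply/existsP; apply: contraLR ltT => /existsPn h; rewrite -leqNgt.
  rewrite -(sum_colht_tail t WB) -(sum_colht_tail t LB) leq_sum // => j _.
  by have := h j; rewrite negbK => /eqP->.
have : 2 * \sum_(j < B) colht L j * colht W j <
       \sum_(j < B) colht L j ^ 2 + \sum_(j < B) colht W j ^ 2.
  rewrite -big_split big_distrr /= (bigD1 j) //= [X in _ < X](bigD1 j) //= -addSn leq_add //.
    by rewrite (ltn_leqif (nat_Cauchy _ _)) eq_sym.
  by apply: leq_sum => l _; case: (nat_Cauchy (colht L l) (colht W l)).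
rewrite cW cL; move: key; under eq_bigr do rewrite mulnn.
by lia.
Qed.

(** Codes a lexicographic pair in one number: the sum of fermionic entries stays below the base,
    being at most [tdeg L]. *)
Definition sprank L := sqparts L * (tdeg L).+1 + sumn (asym L).

Lemma lep_rank W L : lep W L -> W <> L -> sprank W < sprank L.
Proof.
move=> h nWL; have [_ ht _ _] := h; rewrite /sprank ht.
have hW : sumn (asym W) <= tdeg L by rewrite -ht leq_addr.
case: (lep_sep h nWL) => [[lt _]|[-> _ lt _]]; last by rewrite ltn_add2l.
have : (sqparts W).+1 * (tdeg L).+1 <= sqparts L * (tdeg L).+1 by rewrite leq_mul2r lt orbT.
by rewrite mulSn; lia.
Qed.

End TailSums.

(** * From the Bruhat order to its coarsening *)

Section Bruhat.
Local Open Scope nat_scope.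
Implicit Types (W L : spart).

(** With t the transposition, inversions of t u inject into those of u: a pair (a, b) goes to (t a,
    t b) if this is still increasing, and stays in place otherwise. In the second case the
    hypotheses on i and j ensure that u inverts (a, b). *)
Lemma plen_tperm n (u : 'S_n) (i j : 'I_n) : i < j -> u j < u i ->
  plen (tperm i j * u)%g <= plen u.
Proof.
move=> ij uij; set t := tperm i j.
pose phi (p : 'I_n * 'I_n) := if t p.1 < t p.2 then (t p.1, t p.2) else p.
pose Inv (v : 'S_n) := [set p : 'I_n * 'I_n | (p.1 < p.2) && (v p.2 < v p.1)].
rewrite /plen -/(Inv _) -/(Inv u).
have phi_inj : {in Inv (t * u)%g &, injective phi}.
  move=> [a b] [c d]; rewrite !inE /phi /= => /andP[ab _] /andP[cd _].
  case: ifP => h1; case: ifP => h2 // [].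
  - by move=> /perm_inj-> /perm_inj->.
  - by move=> ac bd; move: h2; rewrite -ac -bd /t !tpermK ab.
  - by move=> ac bd; move: h1; rewrite ac bd /t !tpermK cd.
rewrite -(card_in_imset phi_inj); apply: subset_leq_card; apply/subsetP => p.
case/imsetP => -[a b]; rewrite inE /= !permM -/t => /andP[ab uba] ->.
rewrite inE /phi /=; case: ifP => [-> //|/negbT]; rewrite -leqNgt /= ab /= => tba.
move: ab uba tba; rewrite /t; case: (tpermP i j a) => [->|->|_ _]; case: (tpermP i j b) => [->|->|_ _]; lia.
Qed.

Section Step.
Variables (n m : nat) (lam : 'I_n -> nat).
Hypothesis lam_sorted : forall i j : 'I_n, i <= j -> lam j <= lam i.

(* For lam = l^+, the number of fermionic entries larger than t in the composition u l^+. *)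
Definition head_count (u : 'S_n) t := \sum_(k < n) (u k < m) * (t < lam k).

(** A length-increasing exchange of i < j has u i < u j. It moves the larger entry, that of i, to
    the right and the smaller one to the left, so no head count rises. *)
Lemma head_count_step u v t : bruhat_step u v -> head_count v t <= head_count u t.
Proof.
case/andP => lt /existsP[i /existsP[j /eqP vE]].
wlog ij : i j vE / i < j => [H|].
  case: (ltngtP i j) => [h|h|h]; first exact: H vE h.
    by apply: (H j i) => //; rewrite vE tpermC.
  by move: lt; rewrite vE (val_inj h) tperm1 mul1g ltnn.
have uij : u i < u j.
  rewrite ltnNge leq_eqVlt negb_or -leqNgt; apply/andP; split.
    by rewrite val_eqE (inj_eq perm_inj) -val_eqE /= gtn_eqF.
  by rewrite leqNgt; apply/negP => h; move: lt; rewrite vE ltnNge plen_tperm.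
have nji : j != i by rewrite -val_eqE /= gtn_eqF.
rewrite /head_count (bigD1 i) //= (bigD1 j) //= [X in _ <= X](bigD1 i) //= [X in _ <= _ + X](bigD1 j) //=.
rewrite !addnA; apply: leq_add; last first.
  apply: leq_sum => k /andP[ki kj]; rewrite vE permM tpermD // eq_sym //.
rewrite vE !permM tpermL tpermR.
have := lam_sorted (ltnW ij).
case: (ltnP (u j) m) => h1; case: (ltnP (u i) m) => h2; case: (ltnP t (lam i)) => h3;
case: (ltnP t (lam j)) => h4; lia.
Qed.

Lemma head_count_le u v t : bruhat_le u v -> head_count v t <= head_count u t.
Proof.
case/connectP => p; elim: p u => [|x p IH] u /= => [_ -> //|/andP[/head_count_step h] /IH{}IH /IH].
by move/leq_trans; apply.
Qed.
End Step.

Lemma dsort_sorted s : sorted geq (dsort s).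
Proof. exact: sort_sorted geq_total _. Qed.

Lemma tail_dsort n L t : tail (dsort (spcomp n L)) t = tail (parts L) t.
Proof.
rewrite (tail_perm t (permEl (perm_sort _ _))) /spcomp tail_cat tail_nseq0 addn0 //.
Qed.

Lemma size_spcomp n L : splen L <= n -> size (spcomp n L) = n.
Proof. by move=> h; rewrite size_cat size_nseq subnKC // size_cat. Qed.

Lemma head_count_asym n L (w : 'S_n) t : splen L <= n -> sorted_by (spcomp n L) w ->
  head_count (fdeg L) (fun i => nth 0 (dsort (spcomp n L)) i) w t =
  count (fun v => t < v) (asym L).
Proof.
move=> Ln /forallP h; rewrite /head_count (reindex_inj (@perm_inj _ (w^-1)%g)) /=.
transitivity (\sum_(i < n) (i < fdeg L) * (t < nth 0 (asym L) i)).
  apply: eq_bigr => i _; rewrite permKV -(eqP (h i)) nth_cat.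
  case: (ltnP i (fdeg L)) => iL //; rewrite !mul1n size_cat.
  by rewrite (leq_trans iL) ?leq_addr // nth_cat iL.
have fL : size (asym L) <= n by rewrite (leq_trans _ Ln) // leq_addr.
have -> : count (fun v => t < v) (asym L) = \sum_(i < size (asym L)) (t < nth 0 (asym L) i).
  rewrite -sum1_count big_mkcond (big_nth 0) big_mkord.
  by apply: eq_bigr => i _; case: ifP.
rewrite (big_ord_widen n (fun i => nat_of_bool (t < nth 0 (asym L) i))) // [RHS]big_mkcond.
by apply: eq_bigr => i _; rewrite /fdeg; case: ifP => _; rewrite ?mul1n.
Qed.

(** In the case of strict dominance, equality of all tails would force equal rearrangements, so the
    fermionic clause is vacuous. In the Bruhat case the tails agree and the head counts give that
    clause. *)
Lemma sp_le_lep W L : sp_le W L -> lep W L.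
Proof.
rewrite /sp_le; set n := maxn _ _ => -[hf ht hc].
have Wn : splen W <= n by rewrite leq_maxl.
have Ln : splen L <= n by rewrite leq_maxr.
case: hc => [[ne _ le]|[e [wl [wm [[sl _] [sm _] br]]]]].
  have hT t : tail (parts W) t <= tail (parts L) t.
    by rewrite -(tail_dsort n W) -(tail_dsort n L) tail_le_take // dsort_sorted.
  apply: lep_count => // eT; case: ne; symmetry.
  apply: (sorted_eq geq_trans geq_anti); rewrite ?dsort_sorted //.
  apply: count_perm_eq; first by rewrite !size_sort !size_spcomp.
  by apply: tail_count => t; rewrite !tail_dsort.
apply: lep_count => // [t|_ t]; first by rewrite -(tail_dsort n W) -(tail_dsort n L) e.
rewrite -(head_count_asym t Ln sl) -(head_count_asym t Wn sm) hf e.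
apply: head_count_le br => i j ij.
have [h|h] := leqP (nth 0 (dsort (spcomp n W)) j) (nth 0 (dsort (spcomp n W)) i) => //.
have := count_gt_nth j (nth 0 (dsort (spcomp n W)) i) (dsort_sorted (spcomp n W)).
rewrite h => lt; have := leq_ltn_trans ij lt.
by rewrite count_gt_nth ?dsort_sorted // ltnn.
Qed.
End Bruhat.

(** * Coefficients of e, etilde, h and htilde *)
Section DualNumbers.
Variables (n : nat) (R : comNzRingType).
Implicit Types (a : R) (b : 'I_n -> R) (S : {set 'I_n.+1}) (i j k : 'I_n).

(* gdual a b is a + tau (sum of the b_i theta_i); as tau^2 = 0, these multiply as dual numbers. *)
Definition dset i : {set 'I_n.+1} := [set ord0; lift ord0 i].
Definition gnil b : super n.+1 R :=
  [ffun S : {set 'I_n.+1} => \sum_(i | S == dset i) b i].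
Definition gdual a b : super n.+1 R := gconst n.+1 a + gnil b.

Lemma gnil0 b S : ord0 \notin S -> gnil b S = 0.
Proof.
move=> h; rewrite ffunE big_pred0 // => i; apply: contraNF h => /eqP->.
by rewrite !inE eqxx.
Qed.

Lemma gconst_scale m a : gconst m a = gscale a (gconst m 1) :> super m R.
Proof. by apply/ffunP => S; rewrite !ffunE; case: ifP; rewrite ?mulr1 ?mulr0. Qed.

Lemma gnilM b b' : gmul (gnil b) (gnil b') = 0.
Proof.
apply/ffunP => S; rewrite gmulE [RHS]ffunE big1 // => T sTS.
have [T0|T0] := boolP (ord0 \in T).
  by rewrite [gnil b' _]gnil0 ?mulr0 // inE T0.
by rewrite [gnil b _]gnil0 // mul0r mulr0.
Qed.

Lemma gdualM a b a' b' :
  gmul (gdual a b) (gdual a' b') = gdual (a * a') (fun i => a * b' i + a' * b i).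
Proof.
rewrite /gdual gmulDl !gmulDr gnilM addr0.
rewrite !(gconst_scale _ a) (gconst_scale _ a') !gmulZl !gmulZr !gmul1l gmul1r.
rewrite (gconst_scale _ (_ * _)) -addrA; congr (_ + _).
  by apply/ffunP => S; rewrite !ffunE mulrA.
apply/ffunP => S; rewrite [LHS]ffunE [gscale _ _ _]ffunE [X in _ + X]ffunE !ffunE.
by rewrite !big_distrr -big_split.
Qed.

Lemma gdualD a b a' b' : gdual a b + gdual a' b' = gdual (a + a') (fun i => b i + b' i).
Proof.
rewrite /gdual addrACA; congr (_ + _); apply/ffunP => S; rewrite !ffunE.
  by case: ifP; rewrite ?addr0.
by rewrite -big_split.
Qed.

Lemma gdual0 : gdual 0 (fun _ => 0) = 0.
Proof. by apply/ffunP => S; rewrite !ffunE big1 // if_same addr0. Qed.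

Lemma eq_gdual a b b' : b =1 b' -> gdual a b = gdual a b'.
Proof. by move=> h; congr (_ + _); apply/ffunP => S; rewrite !ffunE; apply: eq_bigr. Qed.

Lemma gdual_sum (I : Type) (r : seq I) (a : I -> R) (b : I -> 'I_n -> R) :
  \sum_(x <- r) gdual (a x) (b x) = gdual (\sum_(x <- r) a x) (fun i => \sum_(x <- r) b x i).
Proof.
elim: r => [|x r IH].
  by rewrite !big_nil -gdual0; apply: eq_gdual => i; rewrite big_nil.
by rewrite !big_cons IH gdualD; apply: eq_gdual => i; rewrite big_cons.
Qed.

Lemma gdual_prod (a b : 'I_n -> R) :
  \big[@gmul _ _/gconst n.+1 1]_(i < n) gdual (a i) (fun k => if k == i then b i else 0) =
  gdual (\prod_i a i) (fun k => b k * \prod_(i | i != k) a i).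
Proof.
suff H s : uniq s ->
  \big[@gmul _ _/gconst n.+1 1]_(i <- s) gdual (a i) (fun k => if k == i then b i else 0) =
  gdual (\prod_(i <- s) a i) (fun k => if k \in s then b k * \prod_(i <- s | i != k) a i else 0).
  rewrite H ?index_enum_uniq //; apply: eq_gdual => k.
  by rewrite mem_index_enum.
elim: s => [_|i s IH /= /andP[iNs us]].
  rewrite !big_nil /gdual; apply/ffunP => S; rewrite [RHS]ffunE [gnil _ _]ffunE big1 ?addr0 //.
rewrite !big_cons IH // gdualM; apply: eq_gdual => k; rewrite inE big_cons.
have [->|nki] := eqVneq k i; last by rewrite /= mulr0 addr0; case: ifP; rewrite ?mulr0 // mulrCA.
rewrite (negbTE iNs) mulr0 add0r /= mulrC; congr (_ * _).
by rewrite [RHS]big_seq_cond [LHS]big_seq; apply: eq_bigl => l; case: eqP => [->|_]; rewrite ?(negbTE iNs) ?andbT ?andbF.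
Qed.

Lemma theta_gdual i :
  gmul (theta R ord0) (theta R (lift ord0 i)) = gnil (fun k => if k == i then 1 else 0).
Proof.
apply/ffunP => S; rewrite gmulE.
have [S0|S0] := boolP (ord0 \in S); last first.
  rewrite gnil0 // big1 // => T sTS; rewrite ffunE.
  case: eqP => [T0|_]; last by rewrite mul0r mulr0.
  by move: sTS; rewrite T0 sub1set (negbTE S0).
rewrite (bigD1 [set ord0]) ?sub1set //= big1 ?addr0; last first.
  by move=> T /andP[_ /negbTE nT]; rewrite ffunE nT mul0r mulr0.
have -> : cross [set ord0] (S :\: [set ord0]) = 0%N.
  apply/eqP; rewrite cards_eq0; apply/eqP/setP => -[p q].
  by rewrite !inE /=; apply/negP => /and3P[/eqP->].
rewrite !ffunE eqxx expr0 !mul1r.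
have -> : (S :\: [set ord0] == [set lift ord0 i]) = (S == dset i).
  apply/eqP/eqP => [E|->].
    by rewrite -(setD1K S0) -/(S :\: [set ord0]) E.
  apply/setP => x; rewrite !inE; case: eqP => //= ->.
  by apply/esym/negbTE; rewrite neq_lift.
case: eqP => [->|nS]; last first.
  by rewrite big1 // => k /eqP E; case: eqP => // ki; case: nS; rewrite E ki.
rewrite (bigD1 i) //= eqxx big1 ?addr0 //.
by move=> k /andP[_ /negbTE->].
Qed.
End DualNumbers.

(** * The generating functions as dual numbers *)

Section GenCoef.
Variables (n : nat) (k : fieldType).
Implicit Types (c : multinom n) (S : {set 'I_n}) (i l : 'I_n).

Lemma tau_theta_gdual i : tau_theta k i =
  gdual ('X * (xvar k i)%:P) (fun j => if j == i then 1 else 0).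
Proof. by rewrite /tau_theta theta_gdual. Qed.

Lemma gexp_tau_theta i m : gexp (tau_theta k i) m =
  gdual (('X * (xvar k i)%:P) ^+ m)
    (fun j => if j == i then m%:R * ('X * (xvar k i)%:P) ^+ m.-1 else 0).
Proof.
rewrite tau_theta_gdual; set u := 'X * _; elim: m => [|m IH].
  rewrite /gexp /= expr0 /gdual; apply/ffunP => S; rewrite [RHS]ffunE [gnil _ _]ffunE big1 ?addr0 // => j _.
  by rewrite mul0r if_same.
rewrite /gexp iterS -/(gexp _ m) IH gdualM -exprS; apply: eq_gdual => j.
case: eqP => _; last by rewrite !mulr0 addr0.
case: m {IH} => [|m]; first by rewrite expr0 mul0r mulr0 add0r !mulr1.
by rewrite /= exprS [in RHS]mulrS mulrDl mul1r addrC mulr1; congr (_ + _); rewrite mulrCA.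
Qed.

(** The common shape of the factors: 1 + t x for e, the constant 1 at the fermionic index for
    etilde, a truncated geometric series for h, and its derivative, with weights j + 1, at the
    fermionic index for htilde. *)
Definition wpoly (N : nat) (A : nat -> nat) (i : 'I_n) : {poly polyx n k} :=
  \sum_(j < N) (A j)%:R * ('X * (xvar k i)%:P) ^+ j.

Lemma gen_e_gdual : gen_e n k =
  gdual (\prod_i wpoly 2 (fun j => (j <= 1)%N) i)
    (fun l => wpoly 2 (fun j => j == 0%N) l * \prod_(i | i != l) wpoly 2 (fun j => (j <= 1)%N) i).
Proof.
rewrite -gdual_prod /gen_e; apply: eq_bigr => i _.
rewrite tau_theta_gdual /gdual addrA; congr (_ + _).
  apply/ffunP => S; rewrite !ffunE /wpoly !big_ord_recl big_ord0 /= expr0 expr1 !mul1r addr0.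
  by case: ifP; rewrite ?addr0.
apply/ffunP => S; rewrite !ffunE; apply: eq_bigr => l _; case: ifP => // _.
by rewrite /wpoly !big_ord_recl big_ord0 /= expr0 mul0r mul1r !addr0.
Qed.

Lemma gen_h_gdual d : gen_h n k d.+2 =
  gdual (\prod_i wpoly d.+2 (fun=> 1%N) i)
    (fun l => wpoly d.+1 succn l * \prod_(i | i != l) wpoly d.+2 (fun=> 1%N) i).
Proof.
rewrite -gdual_prod /gen_h; apply: eq_bigr => i _.
under eq_bigr do rewrite gexp_tau_theta.
rewrite gdual_sum; have -> : \sum_(j < d.+2) ('X * (xvar k i)%:P) ^+ j = wpoly d.+2 (fun=> 1%N) i.
  by apply: eq_bigr => j _; rewrite mul1r.
apply: eq_gdual => l; case: eqP => _; last by rewrite big1.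
by rewrite big_ord_recl mul0r add0r; apply: eq_bigr => j _; rewrite lift0.
Qed.

(** The weights vanish from [N i] up to d, so the truncation loses nothing in t-degree d. *)
Lemma mcoeff_wprod (N : 'I_n -> nat) (A : 'I_n -> nat -> nat) d c :
  (forall i j, (N i <= j)%N -> (j <= d)%N -> A i j = 0%N) ->
  mcoeff c ((\prod_i wpoly (N i) (A i) i)`_d) =
  (mdeg c == d)%:R * \prod_i (A i (c i))%:R.
Proof.
move=> hN.
(* A common truncation above all the [N i] and all exponents of c, so that c itself is one of the
   choices in the expanded product. *)
pose M := (maxn (\max_i N i) (maxn d (\max_i c i))).+1.
have wM i : exists B : nat -> nat, [/\ wpoly (N i) (A i) i = wpoly M B i &
    forall j, (j < M)%N -> (B j = if (j < N i)%N then A i j else 0%N)].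
  exists (fun j => if (j < N i)%N then A i j else 0%N); split=> //.
  have NM : (N i <= M)%N by rewrite leqW // leq_max leq_bigmax.
  rewrite /wpoly (big_ord_widen M (fun j => (A i j)%:R * ('X * (xvar k i)%:P) ^+ j)) //.
  rewrite big_mkcond; apply: eq_bigr => j _; case: ifP => // _; by rewrite mul0r.
have [B hB] := choice wM.
have -> : \prod_i wpoly (N i) (A i) i = \prod_i wpoly M (B i) i.
  by apply: eq_bigr => i _; case: (hB i).
rewrite /wpoly bigA_distr_bigA /= coef_sum raddf_sum /=.
have cM i : (c i < M)%N by rewrite ltnS !leq_max (leq_bigmax i) !orbT.
pose f0 := [ffun i => Ordinal (cM i)].
have term (f : {ffun 'I_n -> 'I_M}) : mcoeff c ((\prod_i ((B i (f i))%:R * ('X * (xvar k i)%:P) ^+ f i))`_d) =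
    ((\sum_i f i == d)%N && (f == f0))%:R * \prod_i (B i (f i))%:R.
  have -> : \prod_i ((B i (f i))%:R * ('X * (xvar k i)%:P) ^+ f i) =
     ((\prod_i (B i (f i))%:R) *: mpolyX k (Multinom [tuple nat_of_ord (f i) | i < n]))%:P * 'X^(\sum_i f i).
    rewrite big_split /=; under [X in _ * X]eq_bigr do rewrite exprMn.
    rewrite big_split /= -mul_mpolyC polyCM -mulrA; congr (_ * _).
      by rewrite !rmorph_prod /=; apply: eq_bigr => i _; rewrite !rmorph_nat.
    rewrite mulrC; congr (_ * _); last by rewrite -expr_sum.
    rewrite mpolyXE_id rmorph_prod; apply: eq_bigr => i _.
    by rewrite rmorphXn /= multinomE tnth_mktuple.
  rewrite coefCM coefXn; case: eqP => sd; last first.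
    have -> : (\sum_i f i == d)%N = false by apply/eqP => e; apply: sd.
    by rewrite mulr0 mcoeff0 mul0r.
  rewrite mulr1 mcoeffZ mcoeffX mulrC sd eqxx /=; congr ((nat_of_bool _)%:R * _).
  apply/eqP/eqP => [E|->].
    apply/ffunP => i; apply/val_inj; rewrite ffunE /=.
    by move/mnmP: E => /(_ i) <-; rewrite multinomE tnth_mktuple.
  by apply/mnmP => i; rewrite multinomE tnth_mktuple ffunE.
under eq_bigr do rewrite term.
rewrite (bigD1 f0) //= [X in _ + X]big1 ?addr0; last by move=> f /negbTE->; rewrite andbF mul0r.
rewrite eqxx andbT.
have -> : (\sum_i f0 i = mdeg c)%N by rewrite mdegE; apply: eq_bigr => i _; rewrite ffunE.
case: eqP => cd; last by rewrite !mul0r.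
congr (_ * _); apply: eq_bigr => i _; rewrite ffunE /=.
have [_ ->] := hB i; rewrite ?cM //; case: ltnP => // /hN -> //.
by rewrite -cd mdegE (bigD1 i) //= leq_addr.
Qed.

(* (A j, G j) is ([j <= 1], [j = 0]) for e and etilde, and (1, j + 1) for h and htilde. *)
Definition is_bos (A : nat -> nat) d (f : super n (polyx n k)) := forall S c,
  mcoeff c (f S) = ((S == finset.set0) && (mdeg c == d))%:R * \prod_i (A (c i))%:R.

Definition is_ferm (A G : nat -> nat) d (f : super n (polyx n k)) := forall S c,
  mcoeff c (f S) = (mdeg c == d)%:R *
    \sum_(l | S == [set l]) \prod_i (if i == l then G (c i) else A (c i))%:R.

Lemma even_coef_gdual d (a : {poly polyx n k}) b S : even_coef d (gdual a b) S = if S == finset.set0 then a`_d else 0.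
Proof.
rewrite ffunE [gdual _ _ _]ffunE gnil0 ?addr0; last first.
  by apply/negP => /imsetP[x _]; apply/eqP; rewrite neq_lift.
by rewrite ffunE imset_eq0; case: ifP => //; rewrite coef0.
Qed.

Lemma tau_coef_gdual d (a : {poly polyx n k}) b S : tau_coef d (gdual a b) S = \sum_(l | S == [set l]) (b l)`_d.
Proof.
rewrite ffunE [gdual _ _ _]ffunE [gconst _ _ _]ffunE ifF ?add0r; last first.
  by apply/negbTE/set0Pn; exists ord0; rewrite !inE eqxx.
rewrite ffunE coef_sum; apply: eq_bigl => l.
apply/eqP/eqP => [/setP E|->]; last by rewrite imset_set1.
apply/setP => x; have := E (lift ord0 x).
rewrite !inE (mem_imset _ _ (lift_inj (h := ord0))) (inj_eq (lift_inj (h := ord0))).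
by rewrite eq_sym (negbTE (neq_lift _ _)).
Qed.

Lemma bos_gdual N A d b : (forall j, (N <= j)%N -> (j <= d)%N -> A j = 0%N) ->
  is_bos A d (even_coef d (gdual (\prod_i wpoly N A i) b)).
Proof.
move=> h S c; rewrite even_coef_gdual; case: eqP => _; last by rewrite mcoeff0 mul0r.
by rewrite (mcoeff_wprod (N := fun=> N) (A := fun=> A)).
Qed.

Lemma ferm_gdual N N' A G d (a : {poly polyx n k}) : (forall j, (N <= j)%N -> (j <= d)%N -> A j = 0%N) ->
  (forall j, (N' <= j)%N -> (j <= d)%N -> G j = 0%N) ->
  is_ferm A G d (tau_coef d (gdual a (fun l => wpoly N' G l * \prod_(i | i != l) wpoly N A i))).
Proof.
move=> hA hG S c; rewrite tau_coef_gdual raddf_sum big_distrr; apply: eq_bigr => l _ /=.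
have hN i j : ((if i == l then N' else N) <= j)%N -> (j <= d)%N -> (if i == l then G else A) j = 0%N.
  by case: eqP => _; [apply: hG | apply: hA].
transitivity ((mdeg c == d)%:R * \prod_i ((if i == l then G else A) (c i))%:R : k); last first.
  by congr (_ * _); apply: eq_bigr => i _; case: ifP.
rewrite -(mcoeff_wprod c hN) [in RHS](bigD1 l) //= eqxx; congr (mcoeff _ (nth 0 (polyseq (_ * _)) d)).
by apply: eq_bigr => i /negbTE->.
Qed.

Lemma esuper_bos d : is_bos (fun j => (j <= 1)%N) d (esuper n k d).
Proof. by rewrite /esuper gen_e_gdual; apply: bos_gdual => -[|[|j]]. Qed.

Lemma etsuper_ferm d : is_ferm (fun j => (j <= 1)%N) (fun j => j == 0%N) d (etsuper n k d).
Proof. by rewrite /etsuper gen_e_gdual; apply: ferm_gdual => -[|[|j]]. Qed.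

Lemma hsuper_bos d : is_bos (fun=> 1%N) d (hsuper n k d).
Proof.
by rewrite /hsuper gen_h_gdual; apply: bos_gdual => j; lia.
Qed.

Lemma htsuper_ferm d : is_ferm (fun=> 1%N) succn d (htsuper n k d).
Proof. by rewrite /htsuper gen_h_gdual; apply: ferm_gdual => j; lia. Qed.
End GenCoef.

(** * First-order identities for e and h *)
Section Slices.
Variables (n : nat) (k : fieldType).
Implicit Types (c : multinom n) (S : {set 'I_n}) (i j l : 'I_n) (p q : polyx n k)
  (phi : nat -> nat -> k) (r : nat -> multinom n -> k) (s : k)
  (f : super n (polyx n k)).

Definition eul i p : polyx n k := xvar k i * mderiv i p.

Definition cdec c i : multinom n := Multinom [tuple if l == i then (c l).-1 else c l | l < n].

Lemma cdecE c i l : cdec c i l = if l == i then (c l).-1 else c l.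
Proof. by rewrite multinomE tnth_mktuple. Qed.

Lemma cdecK c i : c i != 0%N -> c = mnm_add (mnm1 i) (cdec c i).
Proof.
move=> ci; apply/mnmP => l; rewrite mnmDE mnm1E cdecE eq_sym.
by case: eqP => [->|//]; rewrite add1n prednK // lt0n.
Qed.

Lemma mdeg_cdec c i : c i != 0%N -> mdeg (cdec c i) = (mdeg c).-1.
Proof. by move=> ci; rewrite [in RHS](cdecK ci) mdegD mdeg1 add1n. Qed.

Lemma mcoeff_xM c i p :
  mcoeff c (xvar k i * p) = if c i is 0%N then 0 else mcoeff (cdec c i) p.
Proof.
case E: (c i) => [|m]; last by rewrite {1}(@cdecK c i) ?E // mulrC mcoeffMX.
apply/eqP; rewrite mcoeff_eq0 mulrC (perm_mem (msuppMX _ _)).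
apply/mapP => -[d _ cE]; move: E; rewrite cE mnmDE mnm1E eqxx.
by [].
Qed.

Lemma mcoeff_eul c i p : mcoeff c (eul i p) = (c i)%:R * mcoeff c p.
Proof.
rewrite mcoeff_xM; case E: (c i) => [|m]; first by rewrite mul0r.
have ci : c i != 0%N by rewrite E.
by rewrite mcoeff_mderiv cdecE eqxx E /= mulr_natl addmC -cdecK.
Qed.

(* Multiplication by x^2, y^2, x y, x and y on the coefficient function of a polynomial in x, y. *)
Definition up_xx phi (a b : nat) : k := if a is a'.+2 then phi a' b else 0.
Definition up_yy phi (a b : nat) : k := if b is b'.+2 then phi a b' else 0.
Definition up_xy phi (a b : nat) : k :=
  if a is a'.+1 then if b is b'.+1 then phi a' b' else 0 else 0.
Definition up_x phi (a b : nat) : k := if a is a'.+1 then phi a' b else 0.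
Definition up_y phi (a b : nat) : k := if b is b'.+1 then phi a b' else 0.

(** Separates the exponents of x_i and x_j from the others. The total degree is its own argument of
    r because multiplying by x_i or x_j changes it without touching the other exponents. *)
Definition slice phi r i j p := forall c, mcoeff c p = phi (c i) (c j) * r (mdeg c) c.
Definition off_pair r i j := forall d c c',
  (forall l, l != i -> l != j -> c l = c' l) -> r d c = r d c'.

Lemma slice_xx phi r i j p c : i != j -> off_pair r i j -> slice phi r i j p ->
  mcoeff c (xvar k i * (xvar k i * p)) =
  up_xx phi (c i) (c j) * r (mdeg c).-2 c.
Proof.
move=> nij hr hp; rewrite !mcoeff_xM /up_xx /up_x; case E: (c i) => [|a]; first by rewrite mul0r.
have ci : c i != 0%N by rewrite E.
rewrite cdecE eqxx E /=; case: a E => [|a] E; first by rewrite mul0r.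
rewrite hp !cdecE eqxx (eq_sym j) (negbTE nij) E mdeg_cdec ?cdecE ?eqxx ?E // mdeg_cdec //.
by congr (_ * _); apply: hr => l li lj; rewrite !cdecE (negbTE li).
Qed.

Lemma slice_xx' phi r i j p c : i != j -> off_pair r i j -> slice phi r i j p ->
  mcoeff c (xvar k j * (xvar k j * p)) =
  up_yy phi (c i) (c j) * r (mdeg c).-2 c.
Proof.
move=> nij hr hp; rewrite (@slice_xx (fun b a => phi a b) r j i) //.
- by rewrite eq_sym.
- by move=> d c1 c2 h; apply: hr => l li lj; apply: h.
Qed.

Lemma slice_x phi r i j p c : i != j -> off_pair r i j -> slice phi r i j p ->
  mcoeff c (xvar k i * p) =
  up_x phi (c i) (c j) * r (mdeg c).-1 c.
Proof.
move=> nij hr hp; rewrite !mcoeff_xM /up_xx /up_x; case E: (c i) => [|a]; first by rewrite mul0r.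
have ci : c i != 0%N by rewrite E.
rewrite hp !cdecE eqxx (eq_sym j) (negbTE nij) E mdeg_cdec //.
by congr (_ * _); apply: hr => l li lj; rewrite !cdecE (negbTE li).
Qed.

Lemma slice_x' phi r i j p c : i != j -> off_pair r i j -> slice phi r i j p ->
  mcoeff c (xvar k j * p) =
  up_y phi (c i) (c j) * r (mdeg c).-1 c.
Proof.
move=> nij hr hp; rewrite (@slice_x (fun b a => phi a b) r j i) //.
- by rewrite eq_sym.
- by move=> d c1 c2 h; apply: hr => l li lj; apply: h.
Qed.

Lemma slice_xy phi r i j p c : i != j -> off_pair r i j -> slice phi r i j p ->
  mcoeff c (xvar k i * (xvar k j * p)) =
  up_xy phi (c i) (c j) * r (mdeg c).-2 c.
Proof.
move=> nij hr hp; rewrite mcoeff_xM /up_xy; case E: (c i) => [|a]; first by rewrite mul0r.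
have ci : c i != 0%N by rewrite E.
rewrite (slice_x' _ nij hr hp) !cdecE eqxx (eq_sym j) (negbTE nij) E mdeg_cdec //=.
by congr (_ * _); apply: hr => l li lj; rewrite !cdecE (negbTE li).
Qed.

(* The identities of [structured] below, read on the coefficients of x_i^a x_j^b. *)
Definition quad_id s phi phi' := forall a b : nat,
  up_xx (fun a b => (a%:R - b%:R) * phi a b) a b - up_yy (fun a b => (a%:R - b%:R) * phi a b) a b
  - 2%:R * up_xy (fun a b => phi a b - phi' a b) a b =
  up_xx (fun a b => (a%:R + b%:R + 2%:R * s * (a%:R * b%:R)) * phi a b) a b
  - 2%:R * up_xy (fun a b => (a%:R + b%:R + 2%:R * s * (a%:R * b%:R)) * phi a b) a b
  + up_yy (fun a b => (a%:R + b%:R + 2%:R * s * (a%:R * b%:R)) * phi a b) a b.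

Definition lin_id s phi phi' := forall a b : nat,
  up_y (fun a b => phi a b - phi' a b) a b =
  up_x (fun a b => s * b%:R * phi a b) a b - up_y (fun a b => s * b%:R * phi a b) a b.

(** Every term is x_i^2, x_i x_j or x_j^2 times a slice with the same r. All of them shift the
    degree by two, so a common factor splits off and an identity between phi and phi' remains. *)
Lemma slice_quad s phi phi' r i j p q : i != j -> off_pair r i j -> slice phi r i j p ->
  slice phi' r i j q -> quad_id s phi phi' ->
  (xvar k i ^+ 2 - xvar k j ^+ 2) * (eul i p - eul j p) - 2%:R * (xvar k i * xvar k j) * (p - q) =
  (xvar k i - xvar k j) ^+ 2 * (eul i p + eul j p + (2%:R * s) *: eul i (eul j p)).
Proof.
move=> nij hr hp hq hid; set x := xvar k i; set y := xvar k j.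
set A := eul i p - eul j p; set B := p - q; set C := _ + _ *: _.
have hA : slice (fun a b => (a%:R - b%:R) * phi a b) r i j A.
  by move=> c; rewrite mcoeffB !mcoeff_eul hp -mulrA mulrBl.
have hB : slice (fun a b => phi a b - phi' a b) r i j B.
  by move=> c; rewrite mcoeffB hp hq mulrBl.
have hC : slice (fun a b => (a%:R + b%:R + 2%:R * s * (a%:R * b%:R)) * phi a b) r i j C.
  by move=> c; rewrite !mcoeffD mcoeffZ !mcoeff_eul hp; ring.
transitivity (x * (x * A) - y * (y * A) - 2%:R * (x * (y * B))); first by ring.
transitivity (x * (x * C) - 2%:R * (x * (y * C)) + y * (y * C)); last by ring.
apply/mpolyP => c; rewrite !mulr_natl !(mcoeffD, mcoeffN, mcoeffMn).
rewrite !(slice_xx _ nij hr hA) !(slice_xx' _ nij hr hA) !(slice_xy _ nij hr hB).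
rewrite !(slice_xx _ nij hr hC) !(slice_xx' _ nij hr hC) !(slice_xy _ nij hr hC).
have E := congr1 (fun z => z * r (mdeg c).-2 c) (hid (c i) (c j)).
by etransitivity; [|etransitivity; [exact: E|]]; rewrite /=; ring.
Qed.

Lemma slice_lin s phi phi' r i j p q : i != j -> off_pair r i j -> slice phi r i j p ->
  slice phi' r i j q -> lin_id s phi phi' ->
  xvar k j * (p - q) = (xvar k i - xvar k j) * (s *: eul j p).
Proof.
move=> nij hr hp hq hid; set B := p - q; set C := _ *: _.
have hB : slice (fun a b => phi a b - phi' a b) r i j B.
  by move=> c; rewrite mcoeffB hp hq mulrBl.
have hC : slice (fun a b => s * b%:R * phi a b) r i j C.
  by move=> c; rewrite mcoeffZ !mcoeff_eul hp !mulrA.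
apply/mpolyP => c; rewrite mulrBl mcoeffB.
rewrite !(slice_x' _ nij hr hB) !(slice_x' _ nij hr hC) !(slice_x _ nij hr hC).
by rewrite -mulrBl; congr (_ * _); rewrite hid.
Qed.

(** The cases are: neither i nor j carries the theta, i carries it, j carries it, and the linear
    identity when i does. The second function of each pair describes the image under [swap i j]. *)
Record good_wt s (A G : nat -> nat) : Prop := GoodWt {
  good_quad0 : quad_id s (fun a b => (A a)%:R * (A b)%:R) (fun a b => (A a)%:R * (A b)%:R);
  good_quad1 : quad_id s (fun a b => (G a)%:R * (A b)%:R) (fun a b => (A a)%:R * (G b)%:R);
  good_quad2 : quad_id s (fun a b => (A a)%:R * (G b)%:R) (fun a b => (G a)%:R * (A b)%:R);
  good_lin : lin_id s (fun a b => (G a)%:R * (A b)%:R) (fun a b => (A a)%:R * (G b)%:R) }.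

(** The weights vanish beyond exponent one and the identities shift exponents by at most two, so
    exponents from four on give only zeros. *)
Lemma good_wt_e : good_wt (-1) (fun m => (m <= 1)%N) (fun m => m == 0%N).
Proof.
split; rewrite /quad_id /lin_id /up_xx /up_yy /up_xy /up_x /up_y.
- by move=> [|[|[|[|a]]]] [|[|[|[|b]]]] /=; ring.
- by move=> [|[|[|[|a]]]] [|[|[|[|b]]]] /=; ring.
- by move=> [|[|[|[|a]]]] [|[|[|[|b]]]] /=; ring.
- by move=> [|[|[|a]]] [|[|[|b]]] /=; ring.
Qed.

Lemma good_wt_h : good_wt 1 (fun=> 1%N) succn.
Proof.
split; rewrite /quad_id /lin_id /up_xx /up_yy /up_xy /up_x /up_y.
- by move=> [|[|a]] [|[|b]] /=; ring.
- by move=> [|[|a]] [|[|b]] /=; ring.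
- by move=> [|[|a]] [|[|b]] /=; ring.
- by move=> [|a] [|b] /=; ring.
Qed.

(* Dividing by (x_i - x_j)^2, resp. x_i - x_j, and summing over i and j turns these into
   formulas for H1 f and I1 f; here s = -1 for e, etilde and s = 1 for h, htilde. *)
Definition structured s (f : super n (polyx n k)) := forall i j S, i != j ->
  (xvar k i ^+ 2 - xvar k j ^+ 2) * (eul i (f S) - eul j (f S))
    - 2%:R * (xvar k i * xvar k j) * (f S - swap i j f S) =
  (xvar k i - xvar k j) ^+ 2 *
    (eul i (f S) + eul j (f S) + (2%:R * s) *: eul i (eul j (f S))) /\
  (i \in S -> xvar k j * (f S - swap i j f S) =
    (xvar k i - xvar k j) * (s *: eul j (f S))).

Definition homogeneous d (f : super n (polyx n k)) :=
  forall S c, mcoeff c (f S) != 0 -> mdeg c = d.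

Lemma zero_structured s (f : super n (polyx n k)) i j S : f S = 0 -> swap i j f S = 0 ->
  (xvar k i ^+ 2 - xvar k j ^+ 2) * (eul i (f S) - eul j (f S))
    - 2%:R * (xvar k i * xvar k j) * (f S - swap i j f S) =
  (xvar k i - xvar k j) ^+ 2 *
    (eul i (f S) + eul j (f S) + (2%:R * s) *: eul i (eul j (f S))) /\
  (i \in S -> xvar k j * (f S - swap i j f S) =
    (xvar k i - xvar k j) * (s *: eul j (f S))).
Proof.
move=> -> ->; have e0 l : eul l 0 = 0 by rewrite /eul linear0 mulr0.
by rewrite !e0 scaler0 !(subrr, addr0, mulr0) scaler0 mulr0.
Qed.

Lemma bos_structured s A G d f : good_wt s A G -> is_bos A d f -> structured s f.
Proof.
move=> hg hf i j S nij; have nji : j != i by rewrite eq_sym.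
have [S0|S0] := eqVneq S finset.set0; last first.
  have z T : T != finset.set0 -> f T = 0.
    by move=> /negbTE T0; apply/mpolyP => c; rewrite hf T0 mul0r mcoeff0.
  apply: zero_structured; first exact: z.
  by rewrite gpermE z ?mulr0 // preim_perm imset_eq0.
have -> : swap i j f S = f S by apply: swap_out; rewrite S0 inE.
pose r d' c : k := (d' == d)%:R * \prod_(l | (l != i) && (l != j)) (A (c l))%:R.
have hr : off_pair r i j.
  move=> d' c c' h; congr (_ * _); apply: eq_bigr => l /andP[li lj]; by rewrite h.
have hs : slice (fun a b => (A a)%:R * (A b)%:R) r i j (f S).
  by move=> c; rewrite hf S0 eqxx andTb (bigD1 i) //= (bigD1 j) //= /r /= [RHS]mulrCA -[in RHS]mulrA.
split; first exact: (slice_quad nij hr hs hs (good_quad0 hg)).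
by rewrite S0 inE.
Qed.

Lemma ferm_structured s A G d f : good_wt s A G -> is_ferm A G d f -> structured s f.
Proof.
move=> hg hf i j S nij; have nji : j != i by rewrite eq_sym.
have [/existsP[l /eqP Sl]|S0] := boolP [exists l, S == [set l]]; last first.
  have z T : ~~ [exists l, T == [set l]] -> f T = 0.
    move=> /existsPn T0; apply/mpolyP => c; rewrite hf big1 ?mulr0 ?mcoeff0 //.
    by move=> l /eqP E; have := T0 l; rewrite E eqxx.
  apply: zero_structured; first exact: z.
  rewrite gpermE z ?mulr0 //; apply: contra S0 => /existsP[l /eqP E].
  apply/existsP; exists (tperm i j l).
  by rewrite -imset_set1 -E im_perm tpermV; apply/eqP/setP => x; rewrite !inE tpermK.
have fE m c : mcoeff c (f [set m]) = (mdeg c == d)%:R *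
    \prod_x (if x == m then G (c x) else A (c x))%:R.
  rewrite hf (big_pred1 m) // => x /=; rewrite eq_sym.
  by apply/eqP/eqP => [/set1_inj|->].
pose r d' c : k := (d' == d)%:R * \prod_(x | (x != i) && (x != j)) (if x == l then G (c x) else A (c x))%:R.
have hr : off_pair r i j.
  move=> d' c c' h; congr (_ * _); apply: eq_bigr => x /andP[xi xj]; by rewrite h.
have [li|nli] := eqVneq l i.
  have hs : slice (fun a b => (G a)%:R * (A b)%:R) r i j (f S).
    by move=> c; rewrite Sl li fE (bigD1 i) //= (bigD1 j) //= eqxx (negbTE nji) /r li /= [RHS]mulrCA -[in RHS]mulrA.
  have hs' : slice (fun a b => (A a)%:R * (G b)%:R) r i j (swap i j f S).
    move=> c; rewrite Sl swap1 li tpermL fE (bigD1 i) //= (bigD1 j) //= eqxx (negbTE nij) /r.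
    rewrite [RHS]mulrCA -[in RHS]mulrA; congr (_ * (_ * (_ * _))); apply: eq_bigr => x /andP[xi xj].
    by rewrite li (negbTE xi) (negbTE xj).
  split; first exact: (slice_quad nij hr hs hs' (good_quad1 hg)).
  by move=> _; exact: (slice_lin nij hr hs hs' (good_lin hg)).
have [lj|nlj] := eqVneq l j.
  have hs : slice (fun a b => (A a)%:R * (G b)%:R) r i j (f S).
    by move=> c; rewrite Sl lj fE (bigD1 i) //= (bigD1 j) //= eqxx (negbTE nij) /r lj /= [RHS]mulrCA -[in RHS]mulrA.
  have hs' : slice (fun a b => (G a)%:R * (A b)%:R) r i j (swap i j f S).
    move=> c; rewrite Sl swap1 lj tpermR fE (bigD1 i) //= (bigD1 j) //= eqxx (negbTE nji) /r.
    rewrite [RHS]mulrCA -[in RHS]mulrA; congr (_ * (_ * (_ * _))); apply: eq_bigr => x /andP[xi xj].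
    by rewrite lj (negbTE xi) (negbTE xj).
  split; first exact: (slice_quad nij hr hs hs' (good_quad2 hg)).
  by rewrite Sl lj inE (negbTE nij).
have il : (i == l) = false by rewrite eq_sym; apply/negbTE.
have jl : (j == l) = false by rewrite eq_sym; apply/negbTE.
have -> : swap i j f S = f S by apply: swap_out; rewrite Sl inE ?il ?jl.
have hs : slice (fun a b => (A a)%:R * (A b)%:R) r i j (f S).
  by move=> c; rewrite Sl fE (bigD1 i) //= (bigD1 j) //= il jl /r /= [RHS]mulrCA -[in RHS]mulrA.
split; first exact: (slice_quad nij hr hs hs (good_quad0 hg)).
by rewrite Sl inE il.
Qed.

Lemma bos_hom A d f : is_bos A d f -> homogeneous d f.
Proof. by move=> hf S c; rewrite hf; case: (mdeg c =P d) => //; rewrite andbF mul0r eqxx. Qed.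

Lemma ferm_hom A G d f : is_ferm A G d f -> homogeneous d f.
Proof. by move=> hf S c; rewrite hf; case: (mdeg c =P d) => //; rewrite mul0r eqxx. Qed.

Lemma mdeg_mperm c (w : 'S_n) : mdeg (mperm c w) = mdeg c.
Proof.
rewrite !mdegE [RHS](reindex_inj (@perm_inj _ w)).
by apply: eq_bigr => i _; rewrite mpermE.
Qed.

Lemma bos_symmetric A d f : is_bos A d f -> symmetric_super f.
Proof.
move=> hf w; apply: superP => S c; rewrite mcoeff_pair_perm !hf mdeg_mperm preim_perm imset_eq0.
have [->|_] := eqVneq S finset.set0; last by rewrite !mul0r mulr0.
rewrite imset0 inv_on0 mul1r; congr (_ * _).
by rewrite [RHS](reindex_inj (@perm_inj _ w)); apply: eq_bigr => i _; rewrite mpermE.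
Qed.

Lemma ferm_symmetric A G d f : is_ferm A G d f -> symmetric_super f.
Proof.
move=> hf w; apply: superP => S c; rewrite mcoeff_pair_perm !hf mdeg_mperm mulrCA; congr (_ * _).
rewrite preim_perm big_distrr (reindex_inj (@perm_inj _ (w^-1)%g)) /=; apply: eq_big => l.
  by rewrite -imset_set1 (inj_eq (imset_inj (@perm_inj _ _))).
rewrite -imset_set1 => /eqP ->; rewrite imset_set1 inv_on1 mul1r.
rewrite [RHS](reindex_inj (@perm_inj _ w)); apply: eq_bigr => i _; rewrite mpermE.
by rewrite -(inj_eq (@perm_inj _ w)) permKV.
Qed.
End Slices.

Lemma quad_frac (F : fieldType) (X Y A B R : F) : X != Y ->
  (X ^+ 2 - Y ^+ 2) * A - 2%:R * (X * Y) * B = (X - Y) ^+ 2 * R ->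
  (X + Y) / (X - Y) * A - 2%:R * (X * Y / (X - Y) ^+ 2 * B) = R.
Proof.
move=> nXY E; have D : X - Y != 0 by rewrite subr_eq0.
have D2 : (X - Y) ^+ 2 != 0 by rewrite expf_neq0.
by rewrite -[R](mulKf D2) -E; field.
Qed.

Lemma lin_frac (F : fieldType) (X Y B R : F) : X != Y ->
  Y * B = (X - Y) * R -> Y / (X - Y) * B = R.
Proof.
move=> nXY E; have D : X - Y != 0 by rewrite subr_eq0.
by rewrite -[R](mulKf D) -E; field.
Qed.

Lemma antisym_frac (F : fieldType) (X Y : F) : X != Y ->
  - (Y / (X - Y)) + - (X / (Y - X)) = 1.
Proof.
move=> nXY; have D : X - Y != 0 by rewrite subr_eq0.
have D' : Y - X != 0 by rewrite subr_eq0 eq_sym.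
by field; rewrite D D'.
Qed.

Lemma sum_pairs (V : nmodType) n (g : 'I_n -> 'I_n -> V) :
  \sum_(i < n) \sum_(j < n | (i < j)%N) (g i j + g j i) = \sum_(i < n) \sum_(j < n | j != i) g i j.
Proof.
under eq_bigr do rewrite big_split /=.
rewrite big_split /= [X in _ + X](exchange_big_dep predT) //= -big_split /=.
apply: eq_bigr => i _; rewrite [RHS](bigID (fun j : 'I_n => (i < j)%N)) /=; congr (_ + _);
by apply: eq_bigl => j; rewrite -val_eqE /=; case: ltngtP.
Qed.

Lemma sum_quad_pairs (R : comNzRingType) n (u : 'I_n -> R) (s : R) :
  \sum_(i < n) \sum_(j < n | (i < j)%N) (u i + u j + 2%:R * s * (u i * u j)) =
  (n%:R - 1) * (\sum_i u i) + s * ((\sum_i u i) ^+ 2 - \sum_i u i ^+ 2).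
Proof.
transitivity (\sum_(i < n) \sum_(j < n | (i < j)%N)
  ((u i + s * (u i * u j)) + (u j + s * (u j * u i)))).
  by apply: eq_bigr => i _; apply: eq_bigr => j _; ring.
rewrite (sum_pairs (fun i j => u i + s * (u i * u j))).
transitivity (\sum_(i < n) ((n%:R - 1) * u i + s * (u i * \sum_j u j - u i ^+ 2))); last first.
  rewrite big_split /= -big_distrr /= -big_distrr /= sumrB -big_distrl /=.
  by rewrite -expr2.
apply: eq_bigr => i _; rewrite big_split /= sumr_const -!big_distrr /=.
rewrite [in RHS](bigD1 i) //=; have -> : #|[pred j | j != i]| = n.-1.
  by have := cardC1 i; rewrite card_ord => <-; apply: eq_card.
have -> : u i *+ n.-1 = (n%:R - 1) * u i.
  rewrite -[LHS]mulr_natl; congr (_ * _); case: n i u => [[]//|m] _ _.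
  by rewrite /= -addn1 natrD addrK.
by ring.
Qed.

(** * The operators H1 and I1 *)
Section Operators.
Variables (n : nat) (k : fieldType).
Hypothesis h2 : nosign_char k.
Notation P := (polyx n k).
Notation F := {fraction P}.
Notation x i := (xvar k i).
Implicit Types (f g : super n P) (S : {set 'I_n}) (i j l : 'I_n) (p q : P) (s : k).

Definition tofracr : {rmorphism P -> F} := @tofrac P.
Notation iota := (gmap tofracr).
Definition fconst (a : k) : F := tofrac (mpolyC n a).

Lemma nosign_poly : nosign_char P.
Proof.
move=> p pN; apply/mpolyP => c; rewrite mcoeff0; apply: h2.
by rewrite {1}pN mcoeffN.
Qed.

Lemma xvar_neq i j : i != j -> tofrac (x i) != tofrac (x j) :> F.
Proof.
move=> nij; rewrite tofrac_eq; apply: contra nij => /eqP /(congr1 (mcoeff (mnm1 i))).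
rewrite !mcoeffX eqxx /=; case: eqP => [|_ /eqP]; last by rewrite oner_eq0.
by move=> /mnmP/(_ i); rewrite !mnm1E eqxx; case: eqP => // ->.
Qed.

Lemma eulD i p q : eul i (p + q) = eul i p + eul i q.
Proof. by rewrite /eul mderivD mulrDr. Qed.

Lemma eulZ i (a : k) p : eul i (a *: p) = a *: eul i p.
Proof. by rewrite /eul mderivZ scalerAr. Qed.

Lemma eul0 i : eul i (0 : P) = 0.
Proof. by rewrite /eul mderiv0 mulr0. Qed.

Lemma eulM i p q : eul i (p * q) = eul i p * q + p * eul i q.
Proof. by rewrite /eul mderivM; ring. Qed.

Lemma eul_sign i m p : eul i ((-1) ^+ m * p) = (-1) ^+ m * eul i p.
Proof.
rewrite -signr_odd; case: (odd m); rewrite ?expr0 ?expr1 ?mul1r ?mulN1r //.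
by rewrite /eul mderivN mulrN.
Qed.

Definition geul i f : super n P := [ffun S : {set 'I_n} => eul i (f S)].

Lemma gder_eul i : gder (geul i).
Proof.
move=> f g; apply/ffunP => S; rewrite [LHS]ffunE [RHS]gaddE.
rewrite (gmulE f g S) (gmulE (geul i f) g S) (gmulE f (geul i g) S).
rewrite -big_split (big_morph (eul i) (eulD i) (eul0 i)); apply: eq_bigr => T _ /=.
by rewrite eul_sign eulM ![geul _ _ _]ffunE mulrDr.
Qed.

Definition H1 f : super n F := [ffun S : {set 'I_n} =>
  \sum_(i < n) \sum_(j < n | (i < j)%N)
    tofrac (x i + x j) / tofrac (x i - x j) * tofrac (eul i (f S) - eul j (f S))
  - 2%:R * \sum_(i < n) \sum_(j < n | (i < j)%N)
    tofrac (x i * x j) / tofrac ((x i - x j) ^+ 2) * tofrac ((f - swap i j f) S)].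

(** For symmetric f, exchanging x_i and x_j in f S amounts to exchanging theta_i and theta_j.
    Written with [swap], the operator is linear over the polynomials in x. *)
Definition I1 f : super n F := [ffun S : {set 'I_n} =>
  \sum_(i < n | i \in S) \sum_(j < n | j != i)
    tofrac (x j) / tofrac (x i - x j) * tofrac (f S - swap i j f S)].

(* The sum of x_j / (x_i - x_j) (theta_i d/d(theta_i) - theta_i d/d(theta_j)); unlike I1, it is
   a derivation. *)
Definition Ider f : super n F :=
  \sum_(i < n) \sum_(j < n | j != i) gscale (tofrac (x j) / tofrac (x i - x j))
    (iota (gproj (fun S : {set 'I_n} => i \in S) f - gmove i j f)).

Lemma gscalerE (a : k) f S : (a *: f) S = a *: f S.
Proof. by rewrite ffunE. Qed.

Lemma swapE2 i j f S : swap i j f S = (-1) ^+ inv_on (tperm i j) (tperm i j @^-1: S) * f (tperm i j @^-1: S).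
Proof. exact: gpermE. Qed.

Lemma swapZ i j (a : k) f : swap i j (a *: f) = a *: swap i j f.
Proof. by apply/ffunP => S; rewrite swapE2 ffunE [RHS]ffunE swapE2 scalerAr. Qed.

Lemma H1D f g : H1 (f + g) = H1 f + H1 g.
Proof.
apply/ffunP => S; rewrite ffunE [RHS]ffunE [H1 f S]ffunE [H1 g S]ffunE addrACA -opprD -mulrDr.
rewrite -!big_split; congr (_ - _ * _); apply: eq_bigr => i _; rewrite -big_split;
  apply: eq_bigr => j _ /=; rewrite -mulrDr -rmorphD; congr (_ * tofrac _).
  by rewrite ffunE !eulD opprD addrACA.
by rewrite swapD opprD addrACA ffunE.
Qed.

Lemma tofracZ (a : k) p : tofrac (a *: p) = fconst a * tofrac p.
Proof. by rewrite -mul_mpolyC rmorphM. Qed.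

Lemma H1Z (a : k) f : H1 (a *: f) = gscale (fconst a) (H1 f).
Proof.
apply/ffunP => S; rewrite ffunE [RHS]ffunE [H1 f S]ffunE [RHS]mulrBr [X in _ = _ - X]mulrCA.
congr (_ - _ * _); rewrite big_distrr; apply: eq_bigr => i _ /=; rewrite big_distrr;
  apply: eq_bigr => j _ /=; rewrite [RHS]mulrCA -tofracZ; congr (_ * tofrac _).
  by rewrite ffunE !eulZ scalerBr.
by rewrite swapZ -scalerBr ffunE.
Qed.

Lemma I1D f g : I1 (f + g) = I1 f + I1 g.
Proof.
apply/ffunP => S; rewrite ffunE [RHS]ffunE [I1 f S]ffunE [I1 g S]ffunE.
rewrite -!big_split; apply: eq_bigr => i _; rewrite -big_split;
  apply: eq_bigr => j _ /=; rewrite -mulrDr -rmorphD; congr (_ * tofrac _).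
by rewrite swapD !gaddE opprD addrACA.
Qed.

Lemma I1Z (a : k) f : I1 (a *: f) = gscale (fconst a) (I1 f).
Proof.
apply/ffunP => S; rewrite ffunE [RHS]ffunE [I1 f S]ffunE big_distrr.
apply: eq_bigr => i _; rewrite big_distrr; apply: eq_bigr => j _ /=.
by rewrite [RHS]mulrCA -tofracZ swapZ scalerBr !gscalerE.
Qed.

Lemma H1_sumE f : H1 f = \sum_(i < n) \sum_(j < n | (i < j)%N)
  (gscale (tofrac (x i + x j) / tofrac (x i - x j)) (iota (geul i f - geul j f))
   + gscale (- (2%:R * (tofrac (x i * x j) / tofrac ((x i - x j) ^+ 2)))) (iota (f - swap i j f))).
Proof.
apply/ffunP => S; rewrite ffunE sum_ffunE big_distrr -sumrB; apply: eq_bigr => i _ /=.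
rewrite sum_ffunE big_distrr -sumrB; apply: eq_bigr => j _ /=.
rewrite [RHS]gaddE ![gscale _ _ _]ffunE ![gmap _ _ _]ffunE [(geul _ _ - _) _]gsubE ![geul _ _ _]ffunE.
by rewrite mulNr mulrA.
Qed.

Lemma gderalong_add (d d' : super n P -> super n F) :
  gderalong tofracr d -> gderalong tofracr d' -> gderalong tofracr (fun f => d f + d' f).
Proof.
move=> hd hd' f g; rewrite hd hd' gmulDl gmulDr !addrA; congr (_ + _).
by rewrite -!addrA; congr (_ + _); rewrite addrC.
Qed.

Lemma gder_sub (d d' : super n P -> super n P) :
  gder d -> gder d' -> gder (fun f => d f - d' f).
Proof.
by move=> hd hd' f g; rewrite hd hd' gmulDl gmulDr gmulNl gmulNr opprD addrACA.
Qed.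

(** Only first-order terms occur: Euler operators are derivations, and so is 1 - [swap i j]. The
    second-order part of H is in H0. *)
Lemma H1_der : gderalong tofracr H1.
Proof.
have hs : gderalong tofracr (fun f => \sum_(i < n) \sum_(j < n | (i < j)%N)
  (gscale (tofrac (x i + x j) / tofrac (x i - x j)) (iota (geul i f - geul j f))
   + gscale (- (2%:R * (tofrac (x i * x j) / tofrac ((x i - x j) ^+ 2)))) (iota (f - swap i j f)))).
  apply: gderalong_sum => i _; apply: gderalong_sum => j ij; apply: gderalong_add.
    apply: (gderalong_scale _ (D := fun f => iota (geul i f - geul j f))).
    by apply: (gderalong_map tofracr (d := fun f => geul i f - geul j f)); apply: gder_sub; exact: gder_eul.
  apply: (gderalong_scale _ (D := fun f => iota (f - swap i j f))).
  apply: (gderalong_map tofracr (d := fun f => f - swap i j f)); apply: gder_antiswap; first exact: nosign_poly.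
  by rewrite -val_eqE /= ltn_eqF.
by move=> f g; rewrite !H1_sumE.
Qed.

Lemma Ider_der : gderalong tofracr Ider.
Proof.
apply: gderalong_sum => i _; apply: gderalong_sum => j ji.
apply: (gderalong_scale _ (D := fun f => iota (gproj (fun S : {set 'I_n} => i \in S) f - gmove i j f))).
apply: (gderalong_map tofracr (d := fun f => gproj (fun S : {set 'I_n} => i \in S) f - gmove i j f)).
by apply: gder_sub; [exact: gder_proj | apply: gder_move; rewrite eq_sym].
Qed.

(** The two operators differ only at i, j both in S: there [gmove i j f] vanishes while [swap i j f]
    is the opposite of f. The surplus - x_j/(x_i - x_j), added to the one with i and j exchanged, is
    1, whence one unit for each pair in S. *)
Lemma Ider_I1 f S : Ider f S = I1 f S + 'C(#|S|, 2)%:R * tofrac (f S).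
Proof.
rewrite sum_ffunE ffunE; under [LHS]eq_bigr do rewrite sum_ffunE.
have -> : \sum_(i < n) \sum_(j < n | j != i) gscale (tofrac (x j) / tofrac (x i - x j))
      (iota (gproj (fun S : {set 'I_n} => i \in S) f - gmove i j f)) S =
   \sum_(i < n | i \in S) \sum_(j < n | j != i) tofrac (x j) / tofrac (x i - x j) * tofrac (f S - swap i j f S) +
   \sum_(i < n | i \in S) \sum_(j < n | j != i) (if j \in S then - (tofrac (x j) / tofrac (x i - x j)) else 0) * tofrac (f S).
  rewrite -big_split [RHS]big_mkcond; apply: eq_bigr => i _ /=.
  case iS: (i \in S); last first.
    rewrite big1 // => j _; rewrite !ffunE iS /= oppr0 addr0 [tofracr 0]rmorph0 mulr0 //.
  rewrite -big_split; apply: eq_bigr => j ji /=.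
  rewrite [LHS]ffunE [iota _ _]ffunE gsubE [gproj _ _ _]ffunE [gmove _ _ _ _]ffunE iS /=.
  case jS: (j \in S) => /=; last by rewrite mul0r addr0.
  rewrite swap_in // 1?eq_sym // opprK subr0 rmorphD /=; ring.
congr (_ + _); under eq_bigr do rewrite -big_distrl /=.
rewrite -big_distrl; congr (_ * _) => /=.
transitivity (\sum_(i < n) \sum_(j < n | j != i)
   (if (i \in S) && (j \in S) then - (tofrac (x j) / tofrac (x i - x j)) else 0 : F)).
  rewrite big_mkcond; apply: eq_bigr => i _; case: (i \in S) => //.
  by rewrite big1.
rewrite -(sum_pairs (fun i j => if (i \in S) && (j \in S) then - (tofrac (x j) / tofrac (x i - x j)) else 0 : F)).
transitivity (\sum_(i < n) \sum_(j < n | (i < j)%N) ((i \in S) && (j \in S))%:R : F).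
  apply: eq_bigr => i _; apply: eq_bigr => j ij; rewrite [(j \in S) && _]andbC.
  case: ifP => _; last by rewrite addr0.
  have nij : i != j by rewrite -val_eqE /= ltn_eqF.
  rewrite -/(tofracr _) -/(tofracr (x j - x i)) !rmorphB /=.
  by apply: antisym_frac; apply: xvar_neq.
under eq_bigr do rewrite -natr_sum; rewrite -natr_sum; congr (_%:R).
have E : ((\sum_(i < n) \sum_(j < n | (i < j)%N) ((i \in S) && (j \in S))) * 2 = #|S| * #|S|.-1)%N.
  rewrite big_distrl /=; under eq_bigr do rewrite big_distrl /=.
  transitivity (\sum_(i < n) \sum_(j < n | j != i) ((i \in S) && (j \in S)))%N.
    rewrite -(sum_pairs (fun i j => nat_of_bool ((i \in S) && (j \in S)))).
    apply: eq_bigr => i _; apply: eq_bigr => j _; rewrite muln2 -addnn; congr addn.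
    by rewrite andbC.
  rewrite (bigID (mem S)) /= [X in (_ + X)%N]big1 ?addn0 => [|i /negbTE->]; last by rewrite big1.
  transitivity (\sum_(i in S) #|S|.-1)%N; last by rewrite sum_nat_const.
  apply: eq_bigr => i iS; rewrite iS /=.
  have := cardsD1 i S; rewrite iS add1n => -> /=; rewrite -sum1_card big_mkcond [RHS]big_mkcond.
  by apply: eq_bigr => j _; rewrite !inE; case: eqP => //= _; case: (j \in S).
by rewrite bin2 -E muln2 doubleK.
Qed.

(** This is H0; [geulin] below is I0. *)
Definition geulsq f : super n P := [ffun S : {set 'I_n} => \sum_i eul i (eul i (f S))].
Definition geulin f : super n P := [ffun S : {set 'I_n} => \sum_(i in S) eul i (f S)].

Lemma mcoeff_geulsq f S c : mcoeff c (geulsq f S) = (\sum_i (c i) ^ 2)%N%:R * mcoeff c (f S).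
Proof.
rewrite ffunE raddf_sum natr_sum big_distrl; apply: eq_bigr => i _ /=.
by rewrite !mcoeff_eul mulrA -natrM mulnn.
Qed.

Lemma mcoeff_geulin f S c : mcoeff c (geulin f S) = (\sum_(i in S) c i)%N%:R * mcoeff c (f S).
Proof.
rewrite ffunE raddf_sum natr_sum big_distrl; apply: eq_bigr => i _ /=.
by rewrite !mcoeff_eul.
Qed.

(** Summed over pairs, c_i + c_j + 2 s c_i c_j is (n - 1) d + s (d^2 - sum of the c_i^2) on a
    monomial of degree d. *)
Lemma H1_structured s d f : structured s f -> homogeneous d f ->
  H1 f = iota (((n%:R - 1) * d%:R + s * d%:R ^+ 2) *: f - s *: geulsq f).
Proof.
move=> hf hd; apply/ffunP => S; rewrite ffunE [RHS]ffunE big_distrr -sumrB /=.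
transitivity (tofracr (\sum_(i < n) \sum_(j < n | (i < j)%N)
    (eul i (f S) + eul j (f S) + (2%:R * s) *: eul i (eul j (f S))))).
  rewrite rmorph_sum; apply: eq_bigr => i _; rewrite rmorph_sum big_distrr -sumrB.
  apply: eq_bigr => j ij /=; have nij : i != j by rewrite -val_eqE /= ltn_eqF.
  have [/(congr1 tofracr) E _] := hf i j S nij.
  rewrite gsubE -/(tofracr _) !(rmorphB, rmorphD, rmorphM, rmorphXn, rmorph_nat) /= in E *.
  by apply: quad_frac E; exact: xvar_neq.
congr (tofracr _); apply/mpolyP => c; rewrite raddf_sum /=; under eq_bigr do rewrite raddf_sum /=.
under eq_bigr do under eq_bigr do rewrite !mcoeffD mcoeffZ !mcoeff_eul !mulrA -!mulrDl -mulrA.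
under eq_bigr do rewrite -big_distrl /=.
rewrite -big_distrl /= (sum_quad_pairs (fun i => (c i)%:R) s).
rewrite gsubE !gscalerE mcoeffB !mcoeffZ mcoeff_geulsq.
have [->|/hd cd] := eqVneq (mcoeff c (f S)) 0; first by rewrite !mulr0 subr0.
rewrite -natr_sum -mdegE cd natr_sum.
have -> : \sum_i (c i ^ 2)%N%:R = \sum_i (c i)%:R ^+ 2 :> k by apply: eq_bigr => i _; rewrite natrX.
ring.
Qed.

(** Each i in S collects s times the sum of the exponents other than c_i, that is s (d - c_i). *)
Lemma I1_structured s d f S : structured s f -> homogeneous d f ->
  I1 f S = tofrac (s *: (((#|S|)%:R * d%:R) *: f S - geulin f S)).
Proof.
move=> hf hd; rewrite ffunE.
transitivity (tofracr (\sum_(i < n | i \in S) \sum_(j < n | j != i) s *: eul j (f S))).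
  rewrite rmorph_sum; apply: eq_bigr => i iS; rewrite rmorph_sum; apply: eq_bigr => j ji /=.
  have nij : i != j by rewrite eq_sym.
  have [_ /(_ iS) /(congr1 tofracr)] := hf i j S nij; rewrite -/(tofracr _) !(rmorphB, rmorphM) /= => E.
  by apply: lin_frac E; exact: xvar_neq.
congr (tofracr _); apply/mpolyP => c; rewrite raddf_sum mcoeffZ mcoeffB mcoeffZ mcoeff_geulin /=.
have [z|/hd cd] := eqVneq (mcoeff c (f S)) 0.
  rewrite z !mulr0 subr0 mulr0 big1 // => i _; rewrite raddf_sum big1 // => j _ /=.
  by rewrite mcoeffZ mcoeff_eul z !mulr0.
have E : #|S|%:R * d%:R - (\sum_(i in S) c i)%N%:R = \sum_(i in S) (d%:R - (c i)%:R) :> k.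
  by rewrite sumrB sumr_const -[d%:R *+ _]mulr_natl natr_sum.
rewrite -mulrBl E big_distrl big_distrr /=.
apply: eq_bigr => i iS; rewrite raddf_sum /= -cd mdegE natr_sum [in RHS](bigD1 i) //= addrAC subrr add0r.
by rewrite big_distrl big_distrr /=; apply: eq_bigr => j _; rewrite mcoeffZ mcoeff_eul.
Qed.
End Operators.

(** * Products of e and etilde *)
Section EProducts.
Variables (n : nat) (k : fieldType).
Hypothesis h2 : nosign_char k.
Notation P := (polyx n k).
Notation F := {fraction P}.
Notation iota := (gmap (tofracr n k)).
Implicit Types (f g : super n P) (S T : {set 'I_n}) (i l : 'I_n) (j : nat) (L W : spart)
  (c : multinom n).

Definition flat f := forall S c, mcoeff c (f S) != 0 -> forall i, (c i <= 1)%N.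

Lemma prod_natr_neq0 (a : 'I_n -> bool) : \prod_i (a i)%:R != 0 :> k -> forall i, a i.
Proof. by move=> h i; apply: contraNT h => /negbTE ai; rewrite (bigD1 i) //= ai mul0r. Qed.

Lemma bos_flat d f : is_bos (fun m => (m <= 1)%N) d f -> flat f.
Proof.
move=> hf S c; rewrite hf mulf_eq0 negb_or => /andP[_ h] i.
exact: (prod_natr_neq0 (a := fun i => (c i <= 1)%N) h).
Qed.

Lemma ferm_support d f S c : is_ferm (fun m => (m <= 1)%N) (fun m => m == 0%N) d f ->
  mcoeff c (f S) != 0 ->
  mdeg c = d /\ exists l, [/\ S = [set l], c l = 0%N & forall i, (c i <= 1)%N].
Proof.
move=> hf; rewrite hf mulf_eq0 negb_or => /andP[cd h].
split; first by apply/eqP; apply: contraNT cd => /negbTE->.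
have [/existsP[l /eqP Sl]|/existsPn h'] := boolP [exists l, S == [set l]]; last first.
  by rewrite big1 ?eqxx // in h => l; rewrite (negbTE (h' l)).
exists l; move: h; rewrite Sl (big_pred1 l); last first.
  by move=> x /=; rewrite eq_sym; apply/eqP/eqP => [/set1_inj|->].
have E i : (if i == l then (c i == 0%N : nat) else (c i <= 1)%N : nat) =
   (if i == l then c i == 0%N else (c i <= 1)%N) :> nat by case: ifP.
under eq_bigr do rewrite E.
move/prod_natr_neq0 => h; split=> // [|i]; first by have := h l; rewrite eqxx => /eqP.
by have := h i; case: eqP => // _ /eqP->.
Qed.

Lemma ferm_flat d f : is_ferm (fun m => (m <= 1)%N) (fun m => m == 0%N) d f -> flat f.
Proof. by move=> hf S c /(ferm_support hf)[_ [l [_ _]]]. Qed.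

Lemma geulsq_flat d f : flat f -> homogeneous d f -> geulsq f = d%:R *: f.
Proof.
move=> ff hf; apply: superP => S c; rewrite mcoeff_geulsq gscalerE mcoeffZ.
have [->|nz] := eqVneq (mcoeff c (f S)) 0; first by rewrite !mulr0.
congr (_%:R * _); rewrite -(hf _ _ nz) mdegE; apply: eq_bigr => i _.
by have := ff _ _ nz i; case: (c i) => [|[|m]].
Qed.

Lemma gscale_iota (a : k) f : gscale (fconst n a) (iota f) = iota (a *: f).
Proof. by apply/ffunP => S; rewrite ffunE [iota f S]ffunE [RHS]ffunE gscalerE -tofracZ. Qed.

(** This is (n - 1) d + s d^2 - s d at s = -1: exponents at most 1 make the sum of their squares
    equal to d. *)
Definition colev (d : nat) : k := d%:R * (n%:R - d%:R).

Lemma H1_flat d f : structured (-1) f -> homogeneous d f -> flat f ->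
  H1 f = gscale (fconst n (colev d)) (iota f).
Proof.
move=> hs hd hf; rewrite (H1_structured hs hd) (geulsq_flat hf hd) gscale_iota.
congr (gmap _ _); apply/ffunP => S; rewrite gsubE !gscalerE scaleN1r opprK -scalerDl.
by congr (_ *: _); rewrite /colev; ring.
Qed.

Lemma H1_esuper d : H1 (esuper n k d) = gscale (fconst n (colev d)) (iota (esuper n k d)).
Proof.
have hb := @esuper_bos n k d.
by apply: H1_flat; [exact: bos_structured (good_wt_e k) hb | exact: bos_hom hb | exact: bos_flat hb].
Qed.

Lemma H1_etsuper d : H1 (etsuper n k d) = gscale (fconst n (colev d)) (iota (etsuper n k d)).
Proof.
have hb := @etsuper_ferm n k d.
by apply: H1_flat; [exact: ferm_structured (good_wt_e k) hb | exact: ferm_hom hb | exact: ferm_flat hb].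
Qed.

Lemma bos_eq0 A d f S : is_bos A d f -> S != finset.set0 -> f S = 0.
Proof. by move=> hf /negbTE S0; apply/mpolyP => c; rewrite hf S0 mul0r mcoeff0. Qed.

Lemma geulin_eq0 f S : f S = 0 -> geulin f S = 0.
Proof. by move=> fS; apply/mpolyP => c; rewrite mcoeff_geulin fS !mcoeff0 mulr0. Qed.

Lemma Ider_esuper d : Ider (esuper n k d) = gscale (fconst n 0) (iota (esuper n k d)).
Proof.
have hb := @esuper_bos n k d.
apply/ffunP => S; rewrite Ider_I1 (I1_structured _ (bos_structured (good_wt_e k) hb) (bos_hom hb)).
rewrite gscale_iota scale0r [RHS]ffunE.
have -> : (0 : super n P) S = 0 by rewrite ffunE.
have [->|S0] := eqVneq S finset.set0.
  rewrite cards0 mul0r scale0r sub0r [geulin _ _]ffunE big_set0 oppr0 scaler0 bin0n mul0r.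
  by rewrite addr0.
by rewrite (geulin_eq0 (bos_eq0 hb S0)) (bos_eq0 hb S0) !(scaler0, subr0, raddf0, mulr0, addr0).
Qed.

Lemma Ider_etsuper d : Ider (etsuper n k d) = gscale (fconst n (- d%:R)) (iota (etsuper n k d)).
Proof.
have hb := @etsuper_ferm n k d.
apply/ffunP => S; rewrite Ider_I1 (I1_structured _ (ferm_structured (good_wt_e k) hb) (ferm_hom hb)).
rewrite gscale_iota [RHS]ffunE gscalerE.
have [/eqP/cards1P[l ->]|S1] := eqVneq #|S| 1%N.
  rewrite cards1 bin_small // mul0r addr0 mul1r; congr (tofrac _).
  have -> : geulin (etsuper n k d) [set l] = 0.
    apply/mpolyP => c; rewrite mcoeff_geulin mcoeff0 big_set1.
    have [->|/(ferm_support hb)[_ [l' [/set1_inj<- -> _]]]] := eqVneq (mcoeff c (etsuper n k d [set l])) 0;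
    by rewrite ?mulr0 ?mul0r.
  by rewrite subr0 scaleN1r scaleNr.
have z : etsuper n k d S = 0.
  apply/mpolyP => c; rewrite mcoeff0; apply/eqP; apply: contraNT S1.
  by move=> /(ferm_support hb)[_ [l' [-> _ _]]]; rewrite cards1.
by rewrite (geulin_eq0 z) z !(scaler0, subr0, raddf0, mulr0, addr0).
Qed.

Lemma cst_sum (I : Type) (r : seq I) (Q : pred I) (a : I -> k) :
  \sum_(x <- r | Q x) fconst n (a x) = fconst n (\sum_(x <- r | Q x) a x).
Proof. by rewrite /fconst -/(tofracr _ _) !raddf_sum. Qed.

Lemma eprod_eigen D (Ef Eb : nat -> k) L : gderalong (tofracr n k) D ->
  (forall d, D (etsuper n k d) = gscale (fconst n (Ef d)) (iota (etsuper n k d))) ->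
  (forall d, D (esuper n k d) = gscale (fconst n (Eb d)) (iota (esuper n k d))) ->
  D (eprod n k L) = gscale (fconst n (\sum_(d <- asym L) Ef d + \sum_(d <- ssym L) Eb d)) (iota (eprod n k L)).
Proof.
move=> hD hf hb; rewrite /eprod hD (gderalong_eigen_prod _ hD hf) (gderalong_eigen_prod _ hD hb).
rewrite gmulZl gmulZr -gmapM !cst_sum; apply/ffunP => S.
by rewrite gaddE ![gscale _ _ _]ffunE -mulrDl /fconst -/(tofracr _ _) !rmorphD.
Qed.

Definition Eev L : k := \sum_(d <- parts L) colev d.
(** The first term is the eigenvalue of the derivation [Ider], the second its difference with
    [I1]. *)
Definition Iev L : k := - (sumn (asym L))%:R - 'C(fdeg L, 2)%:R.

Lemma H1_eprod L : H1 (eprod n k L) = iota (Eev L *: eprod n k L).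
Proof.
rewrite (eprod_eigen _ (H1_der h2) H1_etsuper H1_esuper) gscale_iota.
by rewrite /Eev /parts big_cat.
Qed.

Definition gdeg m f := forall S, #|S| != m -> f S = 0.

Lemma gdeg1 : gdeg 0 (gconst n 1).
Proof. by move=> S; rewrite cards_eq0 ffunE => /negbTE->. Qed.

Lemma gdegM m m' f g : gdeg m f -> gdeg m' g -> gdeg (m + m') (gmul f g).
Proof.
move=> hf hg S Sm; rewrite gmulE big1 // => T sTS.
have [Tm|/hf->] := eqVneq #|T| m; last by rewrite mul0r mulr0.
rewrite [g _]hg ?mulr0 //; apply: contra Sm => /eqP Tm'.
by rewrite -(cardsID T S) (setIidPr sTS) Tm Tm'.
Qed.

Lemma gdeg_eprod L : gdeg (fdeg L) (eprod n k L).
Proof.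
rewrite /eprod -[fdeg L]addn0; apply: gdegM.
  rewrite /fdeg; elim: (asym L) => [|d s IH]; rewrite ?big_nil ?big_cons; first exact: gdeg1.
  rewrite /= -add1n; apply: gdegM => // S S1; apply/mpolyP => c; rewrite mcoeff0.
  apply/eqP; apply: contraNT S1.
  by move=> /(ferm_support (@etsuper_ferm n k d))[_ [l' [-> _ _]]]; rewrite cards1.
elim: (ssym L) => [|d s IH]; rewrite ?big_nil ?big_cons; first exact: gdeg1.
rewrite -[0%N]addn0; apply: gdegM => // S; rewrite cards_eq0 => S1.
exact: (bos_eq0 (@esuper_bos n k d)).
Qed.

Lemma I1_eprod L : I1 (eprod n k L) = iota (Iev L *: eprod n k L).
Proof.
apply/ffunP => S; have := Ider_I1 (eprod n k L) S.
rewrite (eprod_eigen _ (@Ider_der n k) Ider_etsuper Ider_esuper) gscale_iota => /eqP.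
rewrite -subr_eq => /eqP <-; rewrite [iota _ _]ffunE [RHS]ffunE !gscalerE.
rewrite -[_%:R * _]/(_%:R * tofracr n k _) -(rmorph_nat (tofracr n k)) -rmorphM -rmorphB mulr_natl.
congr (tofracr _ _ _); rewrite -scaler_nat -scalerBl.
have [Sm|/gdeg_eprod->] := eqVneq #|S| (fdeg L); last by rewrite !scaler0.
congr (_ *: _); rewrite Sm /Iev; congr (_ - _).
by rewrite [X in _ + X]big1 ?addr0 // sumrN sumnE natr_sum.
Qed.

Lemma symmetric1 : symmetric_super (gconst n (1 : P)).
Proof.
move=> w; apply: superP => S c; rewrite pair_permE !ffunE preim_perm imset_eq0.
have [->|] := eqVneq S finset.set0; last by rewrite msym0 mulr0.
by rewrite imset0 inv_on0 mul1r msym1.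
Qed.

Lemma eprod_symmetric L : symmetric_super (eprod n k L).
Proof.
rewrite /eprod; apply: symmetricM.
  elim: (asym L) => [|d s IH]; rewrite ?big_nil ?big_cons; first exact: symmetric1.
  by apply: symmetricM => //; exact: ferm_symmetric (@etsuper_ferm n k d).
elim: (ssym L) => [|d s IH]; rewrite ?big_nil ?big_cons; first exact: symmetric1.
by apply: symmetricM => //; exact: bos_symmetric (@esuper_bos n k d).
Qed.

Lemma mcoeffM_neq0 (p q : P) c : mcoeff c (p * q) != 0 ->
  exists c1 c2, [/\ c = mnm_add c1 c2, mcoeff c1 p != 0 & mcoeff c2 q != 0].
Proof.
rewrite mcoeffM => h.
have /existsP[x /andP[/eqP cE nz]] : [exists x : (bmultinom n (mdeg c).+1 * bmultinom n (mdeg c).+1)%type,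
   (c == mnm_add (bmnm x.1) (bmnm x.2)) && (mcoeff (bmnm x.1) p * mcoeff (bmnm x.2) q != 0)].
  apply: contraNT h => /existsPn h; apply/eqP; apply: big1 => x xc.
  by have := h x; rewrite xc negbK => /eqP.
by move: nz; rewrite mulf_eq0 negb_or => /andP[]; exists (bmnm x.1), (bmnm x.2).
Qed.

Lemma gmul_support f g S c : mcoeff c (gmul f g S) != 0 ->
  exists T c1 c2, [/\ T \subset S, c = mnm_add c1 c2, mcoeff c1 (f T) != 0 & mcoeff c2 (g (S :\: T)) != 0].
Proof.
rewrite gmulE raddf_sum /= => h.
have /existsP[T /andP[sT nz]] : [exists T : {set 'I_n}, (T \subset S) &&
   (mcoeff c ((-1) ^+ cross T (S :\: T) * (f T * g (S :\: T))) != 0)].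
  apply: contraNT h => /existsPn h; apply/eqP; apply: big1 => T sT.
  by have := h T; rewrite sT negbK => /eqP.
move: nz; rewrite mcoeff_sign mulf_eq0 signr_eq0 /= => /mcoeffM_neq0[c1 [c2 [cE n1 n2]]].
by exists T, c1, c2.
Qed.

Lemma flat_set c d : mdeg c = d -> (forall i, (c i <= 1)%N) ->
  #|[set i | c i != 0%N]| = d /\ forall i, c i = (i \in [set i | c i != 0%N]) :> nat.
Proof.
move=> <- h; have E i : c i = (i \in [set i | c i != 0%N]) :> nat.
  by rewrite inE; have := h i; case: (c i) => [|[]].
split=> //; rewrite -sum1_card big_mkcond mdegE; apply: eq_bigr => i _.
by rewrite [RHS]E; case: (i \in _).
Qed.

(** A monomial of a product of e's comes from a 0-1 matrix, column j being the set of variables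
    taken from the factor j. *)
Lemma eprod_bos_support (js : seq nat) (h : nat -> nat) S c : uniq js ->
  mcoeff c ((\big[@gmul n _/gconst n 1]_(j <- js) esuper n k (h j)) S) != 0 ->
  S = finset.set0 /\ exists C : nat -> {set 'I_n},
    (forall j, j \in js -> #|C j| = h j) /\ (forall i, c i = \sum_(j <- js) (i \in C j))%N.
Proof.
elim: js S c => [|j js IH] S c /=.
  rewrite big_nil ffunE; case: (S =P finset.set0) => [->|_]; last by rewrite mcoeff0 eqxx.
  rewrite mcoeff1; case: (c =P mnm0) => [-> _|_]; last by rewrite eqxx.
  by split=> //; exists (fun _ => finset.set0); split=> // i; rewrite big_nil mnm0E.
case/andP => jjs ujs; rewrite big_cons => /gmul_support[T [c1 [c2 [sT -> n1 /(IH _ _ ujs)[S0 [C [hC cC]]]]]]].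
have T0 : T = finset.set0.
  by apply/eqP; apply: contraNT n1 => /(bos_eq0 (@esuper_bos n k (h j)))->; rewrite mcoeff0.
split; first by rewrite -S0 T0 setD0.
have cd : mdeg c1 = h j by apply: (bos_hom (@esuper_bos n k (h j)) n1).
have [c1C c1E] := flat_set cd (bos_flat (@esuper_bos n k (h j)) n1).
exists (fun j' => if j' == j then [set i | c1 i != 0%N] else C j'); split.
  by move=> j'; rewrite inE; case: eqP => [-> _|_ /hC].
move=> i; rewrite mnmDE big_cons eqxx -c1E cC; congr addn.
by apply: eq_big_seq => j' j'js; case: eqP => // e; rewrite e (negbTE jjs) in j'js.
Qed.

(** The same matrix, with a theta chosen in every column. A factor etilde has no variable at the
    index of its theta, so this place of the matrix holds a 0. *)
Lemma eprod_ferm_support (js : seq nat) (h : nat -> nat) S c : uniq js ->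
  mcoeff c ((\big[@gmul n _/gconst n 1]_(j <- js) etsuper n k (h j)) S) != 0 ->
  exists (C : nat -> {set 'I_n}) (s : nat -> {set 'I_n}),
    [/\ forall j, j \in js -> #|C j| = h j,
     forall j, j \in js -> exists2 l, s j = [set l] & l \notin C j,
     forall i, (i \in S = \sum_(j <- js) (i \in s j) :> nat)%N &
     forall i, (c i = \sum_(j <- js) (i \in C j))%N].
Proof.
elim: js S c => [|j js IH] S c /=.
  rewrite big_nil ffunE; case: (S =P finset.set0) => [->|_]; last by rewrite mcoeff0 eqxx.
  rewrite mcoeff1; case: (c =P mnm0) => [-> _|_]; last by rewrite eqxx.
  by exists (fun _ => finset.set0), (fun _ => finset.set0); split=> // i; rewrite big_nil ?mnm0E ?inE.
case/andP => jjs ujs; rewrite big_cons => /gmul_support[T [c1 [c2 [sT -> n1 /(IH _ _ ujs)[C [s [hC hs hS cC]]]]]]].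
have [cd [l [Tl cl c1le]]] := ferm_support (@etsuper_ferm n k (h j)) n1.
have [c1C c1E] := flat_set cd c1le.
exists (fun j' => if j' == j then [set i | c1 i != 0%N] else C j').
exists (fun j' => if j' == j then [set l] else s j'); split.
- by move=> j'; rewrite inE; case: eqP => [-> _|_ /hC].
- move=> j'; rewrite inE; case: eqP => [-> _|_ /hs //]; exists l => //.
  by rewrite inE cl.
- move=> i; rewrite big_cons eqxx; rewrite -(@eq_big_seq _ _ _ _ _ (fun j' => nat_of_bool (i \in s j'))).
    rewrite -Tl -hS inE; have := subsetP sT i; case: (i \in T) => /=; last by rewrite add0n.
    by move=> ->.
  by move=> j' j'js; case: eqP => // e; rewrite e (negbTE jjs) in j'js.
move=> i; rewrite mnmDE big_cons eqxx -c1E cC; congr addn.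
by apply: eq_big_seq => j' j'js; case: eqP => // e; rewrite e (negbTE jjs) in j'js.
Qed.

Lemma sum_rep L (G : bool * nat -> nat) : (splen L <= n)%N -> G (false, 0%N) = 0%N ->
  (\sum_(i < n) G (i \in rep_set n L, rep_mon n L i) =
   \sum_(v <- asym L) G (true, v) + \sum_(v <- ssym L) G (false, v))%N.
Proof.
move=> Ln G0.
have -> : (\sum_(i < n) G (i \in rep_set n L, rep_mon n L i) =
    \sum_(x <- skey (rep_set n L) (rep_mon n L)) G x)%N.
  by rewrite /skey /= big_map big_enum.
rewrite skey_rep // !big_cat !big_map /=; congr addn; rewrite -[RHS]addn0; congr addn.
by rewrite big_nseq G0; elim: (n - _)%N.
Qed.

Lemma sum_mem (S : {set 'I_n}) (x : 'I_n -> nat) : (\sum_(i < n) (i \in S) * x i = \sum_(i in S) x i)%N.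
Proof. by rewrite [RHS]big_mkcond; apply: eq_bigr => i _; case: (i \in S); rewrite ?mul1n. Qed.

(** W gives the row sums of a 0-1 matrix whose column sums are the column heights of L. As at most t
    columns have index below t, c_i - t is at most the number of ones of row i in the columns from t
    on; summing over i compares the tails. If all tails agree, these bounds are equalities row by
    row, and the zero at the place of each theta bounds the fermionic entries of W by those of L. *)
Lemma eprod_lep L W : (splen W <= n)%N -> scoef W (eprod n k (spconj L)) != 0 -> lep W L.
Proof.
move=> Wn; rewrite /scoef /eprod {1}/asym {1}/ssym /= !big_map.
have := circ_cols_uniq L; rewrite /circ_cols cat_uniq rev_uniq => /and3P[uA dis uB].
case/gmul_support => T [c1 [c2 [sT cE]]].
rewrite -rev_uniq in uA.
case/(eprod_ferm_support (js := rev (asym L)) (h := colht L) uA) => C1 [s [hC1 hs hS cC1]].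
case/(eprod_bos_support (h := colht L) uB) => S0 [C2 [hC2 cC2]].
have TE : T = rep_set n W.
  by apply/eqP; rewrite eqEsubset sT -setD_eq0 S0 eqxx.
subst T.
set c := rep_mon n W in cE.
pose C j := if j \in asym L then C1 j else C2 j.
have hC j : j \in circ_cols L -> #|C j| = colht L j.
  rewrite mem_cat mem_rev /C; case: ifP => jL /= h; first by apply: hC1; rewrite mem_rev.
  exact: hC2.
have cC i : (c i = \sum_(j <- circ_cols L) (i \in C j))%N.
  rewrite cE mnmDE cC1 cC2 big_cat /=; congr addn; apply: eq_big_seq => j.
    by rewrite mem_rev /C => ->.
  by rewrite mem_filter /C => /andP[/negbTE->].
pose B := (tdeg L).+1.
have LB v : v \in parts L -> (v < B)%N by move/parts_le.
have LB' v : v \in parts L -> (v <= B)%N by move/LB/ltnW.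
have tailW t : tail (parts W) t = (\sum_(i < n) (c i - t))%N.
  rewrite tail_cat /tail.
  by rewrite -(@sum_rep W (fun x => x.2 - t)%N) // sub0n.
have tailL t : tail (parts L) t = (\sum_(i < n) \sum_(j <- circ_cols L | t <= j) (i \in C j))%N.
  rewrite exchange_big /= -(sum_colht_tail t LB') big_mkcond.
  rewrite -(@sum_circ_cols L (fun j => if (t <= j)%N then colht L j else 0%N)) //; last first.
    by move=> j ->; rewrite if_same.
  rewrite [RHS]big_mkcond; apply: eq_big_seq => j /hC jC; case: ifP => // _.
  by rewrite -jC -sum1_card big_mkcond; apply: eq_bigr => i _; case: (i \in C j).
have leT t i : (c i - t <= \sum_(j <- circ_cols L | t <= j) (i \in C j))%N.
  rewrite cC leq_subLR (bigID (fun j => (j < t)%N)) /= leq_add //.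
    have -> : (\sum_(j <- circ_cols L | j < t) (i \in C j) <= t)%N.
      apply: leq_trans (_ : \sum_(j <- circ_cols L | j < t) 1 <= _)%N.
        by apply: leq_sum => j _; case: (i \in C j).
      rewrite sum1_count -size_filter -[X in (_ <= X)%N](size_iota 0).
      apply: uniq_leq_size; first by rewrite filter_uniq // circ_cols_uniq.
      by move=> j; rewrite mem_filter mem_iota => /andP[].
    by [].
  rewrite leq_eqVlt; apply/orP; left; apply/eqP; apply: eq_bigl => j; by rewrite -leqNgt.
have hT t : (tail (parts W) t <= tail (parts L) t)%N.
  by rewrite tailW tailL leq_sum.
have szW : fdeg W = fdeg L.
  have -> : fdeg W = (\sum_(i < n) (i \in rep_set n W))%N.
    rewrite (@sum_rep W (fun x => x.1)) //= sum1_size big1_eq addn0 //.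
  under eq_bigr do rewrite hS.
  rewrite exchange_big /= (eq_big_seq (fun=> 1%N)) ?sum1_size ?size_rev //.
  move=> j /hs[l -> _]; rewrite (bigD1 l) //= inE eqxx big1 // => i /negbTE il.
  by rewrite inE il.
have degW : tdeg W = tdeg L.
  rewrite -!tail_parts0 tailW tailL; apply: eq_bigr => i _.
  by rewrite subn0 cC; apply: eq_bigl => j.
apply: lep_count => // eT t.
have eqT i t' : (c i - t' = \sum_(j <- circ_cols L | t' <= j) (i \in C j))%N.
  have := eT t'; rewrite tailW tailL => E.
  have /leqif_sum : forall i : 'I_n, true ->
     (c i - t' <= \sum_(j <- circ_cols L | t' <= j) (i \in C j) ?= iff
      (c i - t' == \sum_(j <- circ_cols L | t' <= j) (i \in C j)))%N.
    by move=> l _; split.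
  by case=> _; rewrite E eqxx => /esym/forall_inP/(_ i isT)/eqP.
(* Row l has a zero in column j, so its ones from column j on are its ones from column j + 1 on. The
   row equalities give c l - j = c l - (j + 1) in truncated subtraction. *)
have cs j l : j \in asym L -> s j = [set l] -> (c l <= j)%N.
  move=> jL sj; have [|l'] := hs j; first by rewrite mem_rev.
  rewrite sj => /set1_inj <- lC.
  rewrite leqNgt; apply/negP => jl.
  have sp : (\sum_(j0 <- circ_cols L | j <= j0) (l \in C j0) =
     \sum_(j0 <- circ_cols L | j < j0) (l \in C j0))%N.
    rewrite big_mkcond [RHS]big_mkcond; apply: eq_bigr => j0 _.
    by case: ltngtP => // <-; rewrite /C jL (negbTE lC).
  by have := eqT l j; have := eqT l j.+1; rewrite sp => <-; lia.
have cnt s' : count (fun v => t < v)%N s' = (\sum_(v <- s') (t < v))%N.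
  by rewrite -sum1_count big_mkcond; apply: eq_bigr => v _; case: ifP.
rewrite !cnt.
have -> : (\sum_(v <- asym W) (t < v) = \sum_(i < n) (i \in rep_set n W) * (t < c i))%N.
  rewrite (@sum_rep W (fun x => x.1 * (t < x.2))%N) //= [X in (_ + X)%N]big1 ?addn0 //.
  by apply: eq_bigr => v _; rewrite mul1n.
rewrite (eq_bigr (fun i : 'I_n => \sum_(j <- rev (asym L)) (i \in s j) * (t < c i))%N); last first.
  by move=> i _; rewrite hS big_distrl.
rewrite exchange_big /= -(perm_big _ (permEl (perm_rev (asym L)))) [X in (X <= _)%N]big_seq [X in (_ <= X)%N]big_seq.
apply: leq_sum => j jL; have [l sj _] := hs j jL.
rewrite (bigD1 l) //= sj inE eqxx mul1n big1 ?addn0 => [|i /negbTE il]; last by rewrite inE il.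
have := cs j l; rewrite -mem_rev => /(_ jL sj) h.
by case: (ltnP t (c l)) => // tl; rewrite (leq_trans tl h).
Qed.
End EProducts.

(** * The leading coefficient of e_(L') *)
Section Top.
Variables (n : nat) (k : fieldType) (omega eta : 'I_n -> nat).
Notation P := (polyx n k).
Implicit Types (f g : super n P) (S T : {set 'I_n}) (c : multinom n) (a b : k).

Definition weight S c := (\sum_i c i * omega i + \sum_(i in S) eta i)%N.

(* The weight being additive, such terms of f and g multiply to one of gmul f g. *)
Definition is_top f S0 c0 a := mcoeff c0 (f S0) = a /\
  forall S c, mcoeff c (f S) != 0 -> (S = S0 /\ c = c0) \/ (weight S c < weight S0 c0)%N.

Lemma weightD S T c1 c2 : T \subset S ->
  weight S (mnm_add c1 c2) = (weight T c1 + weight (S :\: T) c2)%N.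
Proof.
move=> sT; rewrite /weight addnACA -big_split; congr addn.
  by apply: eq_bigr => i _; rewrite mnmDE mulnDl.
by rewrite [LHS](big_setID T) /= (setIidPr sT).
Qed.

Lemma mcoeffM_top (p q : P) c0 c1 :
  (forall k1 k2, mnm_add k1 k2 = mnm_add c0 c1 -> mcoeff k1 p != 0 -> mcoeff k2 q != 0 -> k1 = c0) ->
  mcoeff (mnm_add c0 c1) (p * q) = mcoeff c0 p * mcoeff c1 q.
Proof.
move=> h; pose p' := p - mcoeff c0 p *: mpolyX k c0.
have p'c0 : mcoeff c0 p' = 0 by rewrite mcoeffB mcoeffZ mcoeffX eqxx mulr1 subrr.
have p'c c : c != c0 -> mcoeff c p' = mcoeff c p.
  by move=> nc; rewrite mcoeffB mcoeffZ mcoeffX eq_sym (negbTE nc) mulr0 subr0.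
rewrite -{1}[p](subrK (mcoeff c0 p *: mpolyX k c0)) -/p' mulrDl mcoeffD -scalerAl mcoeffZ.
rewrite [mpolyX k c0 * q]mulrC mcoeffMX [X in X + _](_ : _ = 0) ?add0r //.
apply/eqP; apply: contraT => /mcoeffM_neq0[k1 [k2 [E n1 n2]]].
have nk1 : k1 != c0 by apply: contra n1 => /eqP->; rewrite p'c0.
by case/eqP: (nk1); apply: (h k1 k2) => //; rewrite -(p'c _ nk1).
Qed.

Lemma is_top_le f S0 c0 a S c : is_top f S0 c0 a -> mcoeff c (f S) != 0 ->
  (weight S c <= weight S0 c0)%N.
Proof. by case=> _ h /h[[-> ->]|/ltnW]. Qed.

Lemma is_top_eq f S0 c0 a S c : is_top f S0 c0 a -> mcoeff c (f S) != 0 ->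
  (weight S0 c0 <= weight S c)%N -> S = S0 /\ c = c0.
Proof. by case=> _ h /h[//|]; rewrite ltnNge => /negP. Qed.

Lemma top_mul f g S0 S1 c0 c1 a b : [disjoint S0 & S1] ->
  is_top f S0 c0 a -> is_top g S1 c1 b ->
  is_top (gmul f g) (S0 :|: S1) (mnm_add c0 c1) ((-1) ^+ cross S0 S1 * (a * b)).
Proof.
move=> dis hf hg; have sub0 : S0 \subset S0 :|: S1 by exact: finset.subsetUl.
have SD : (S0 :|: S1) :\: S0 = S1.
  by rewrite setDUl finset.setDv set0U; apply/setDidPl; rewrite disjoint_sym.
have key S c T k1 k2 : T \subset S -> c = mnm_add k1 k2 ->
    mcoeff k1 (f T) != 0 -> mcoeff k2 (g (S :\: T)) != 0 ->
    (weight (S0 :|: S1) (mnm_add c0 c1) <= weight S c)%N ->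
    [/\ T = S0, S :\: T = S1, k1 = c0 & k2 = c1].
  move=> sT -> n1 n2; rewrite (weightD _ _ sub0) SD (weightD _ _ sT) => le.
  have l1 := is_top_le hf n1; have l2 := is_top_le hg n2.
  have [|? ?] := is_top_eq hf n1; first by lia.
  have [|? ?] := is_top_eq hg n2; first by lia.
  by split.
split; last first.
  move=> S c /gmul_support[T [k1 [k2 [sT cE n1 n2]]]].
  have [le|lt] := leqP (weight (S0 :|: S1) (mnm_add c0 c1)) (weight S c); last by right.
  have [TE SE kE1 kE2] := key S c T k1 k2 sT cE n1 n2 le.
  left; rewrite cE kE1 kE2; split=> //.
  by rewrite -(setID S T) (setIidPr sT) SE TE.
rewrite gmulE raddf_sum /= (bigD1 S0) //= SD mcoeff_sign big1 ?addr0.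
  case: (hf) (hg) => <- _ [<- _]; congr (_ * _); apply: mcoeffM_top => k1 k2 E n1 n2.
  have := key (S0 :|: S1) (mnm_add k1 k2) S0 k1 k2 sub0 erefl n1.
  by rewrite SD E => /(_ n2 (leqnn _))[].
move=> T /andP[sT nT]; rewrite mcoeff_sign; apply/eqP; rewrite mulf_eq0 signr_eq0 /=.
apply: contraT => /mcoeffM_neq0[k1 [k2 [E n1 n2]]].
by have [TE] := key _ _ T k1 k2 sT E n1 n2 (leqnn _); rewrite TE eqxx in nT.
Qed.

Lemma top_one : is_top (gconst n (1 : P)) finset.set0 mnm0 1.
Proof.
split; first by rewrite ffunE eqxx mcoeff1 eqxx.
move=> S c; rewrite ffunE; case: (S =P finset.set0) => [->|_]; last by rewrite mcoeff0 eqxx.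
by rewrite mcoeff1; case: (c =P mnm0) => [->|_]; [left|rewrite eqxx].
Qed.
End Top.

Section Leading.
Variables (n : nat) (k : fieldType) (L : spart).
Hypothesis Ln : (splen L <= n)%N.
Notation P := (polyx n k).
Implicit Types (i l p : 'I_n) (C S : {set 'I_n}) (c : multinom n).

Let w i := rep_mon n L i.
(** A unit of the sum of the c_i w_i outweighs the weight of a theta, since eta is at most 2
    [tdeg L] + 1. Doubling w in eta leaves a last bit that prefers the fermionic row among rows of
    equal length. *)
Let omega i := (w i * (tdeg L).*2.+3)%N.
Let eta i := ((w i).*2 + (i \in rep_set n L))%N.

Definition chi C : multinom n := Multinom [tuple nat_of_bool (i \in C) | i < n].
Definition colset j : {set 'I_n} := [set i | j < rep_mon n L i]%N.

Lemma chiE C i : chi C i = (i \in C).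
Proof. by rewrite multinomE tnth_mktuple. Qed.

Lemma mdeg_chi C : mdeg (chi C) = #|C|.
Proof.
rewrite mdegE -sum1_card [RHS]big_mkcond; apply: eq_bigr => i _; rewrite chiE.
by case: (i \in C).
Qed.

Lemma card_colset j : #|colset j| = colht L j.
Proof.
rewrite colhtE -sum1_count -sum1_card big_mkcond /=.
transitivity (\sum_(i < n) (j < rep_mon n L i))%N.
  by apply: eq_bigr => i _; rewrite inE; case: ifP.
rewrite (@sum_rep n L (fun x => (j < x.2)%N : nat)) //= -big_cat.
by rewrite [RHS]big_mkcond; apply: eq_bigr => v _; case: ifP.
Qed.

Lemma rep_mon_le i : (w i <= tdeg L)%N.
Proof.
rewrite /w rep_monE -/(parts L); have [h|h] := ltnP i (size (parts L)).
  by apply: parts_le; apply: mem_nth.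
by rewrite nth_default.
Qed.

(** Rows in [colset j] have w > j and all others w <= j, so at equal size every exchange of rows
    loses. *)
Lemma colset_max C j : #|C| = colht L j -> C <> colset j ->
  (\sum_(i in C) w i < \sum_(i in colset j) w i)%N.
Proof.
move=> hC nC.
rewrite (big_setID (colset j)) [X in (_ < X)%N](big_setID C) /= finset.setIC ltn_add2l.
have cD : #|C :\: colset j| = #|colset j :\: C|.
  have := cardsID (colset j) C; have := cardsID C (colset j).
  by rewrite finset.setIC hC card_colset; lia.
have c0 : (0 < #|colset j :\: C|)%N.
  rewrite lt0n; apply/negP => /eqP c0; apply: nC; apply/eqP.
  move: cD; rewrite c0 => /cards0_eq/eqP; rewrite setD_eq0 => s1.
  by move/cards0_eq/eqP: c0; rewrite setD_eq0 eqEsubset s1.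
apply: (@leq_ltn_trans (\sum_(i in C :\: colset j) j)%N).
  by apply: leq_sum => i; rewrite !inE -leqNgt => /andP[].
rewrite sum_nat_const cD; apply: (@leq_trans (\sum_(i in colset j :\: C) j.+1)%N).
  by rewrite sum_nat_const ltn_pmul2l.
by apply: leq_sum => i; rewrite !inE => /andP[].
Qed.

Lemma weight_chi S C : weight omega eta S (chi C) =
  ((\sum_(i in C) w i) * (tdeg L).*2.+3 + \sum_(i in S) eta i)%N.
Proof.
rewrite /weight; congr addn; rewrite big_distrl [RHS]big_mkcond; apply: eq_bigr => i _ /=.
by rewrite chiE; case: (i \in C); rewrite ?mul1n.
Qed.

Lemma flat_chi c d : mdeg c = d -> (forall i, (c i <= 1)%N) ->
  exists2 C, c = chi C & #|C| = d.
Proof.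
move=> cd h; have [h1 h3] := flat_set cd h; exists [set i | c i != 0%N] => //.
by apply/mnmP => i; rewrite chiE -h3.
Qed.

Lemma top_esuper j : is_top omega eta (esuper n k (colht L j)) finset.set0 (chi (colset j)) 1.
Proof.
have hb := @esuper_bos n k (colht L j); split.
  rewrite hb eqxx mdeg_chi card_colset eqxx mul1r big1 // => i _.
  by rewrite chiE leq_b1.
move=> S c nz; have [->|S0] := eqVneq S finset.set0; last by rewrite (bos_eq0 hb S0) mcoeff0 eqxx in nz.
have [C -> cC] := flat_chi (bos_hom hb nz) (bos_flat hb nz).
case: (C =P colset j) => [->|nC]; first by left.
right; rewrite !weight_chi ltn_add2r ltn_pmul2r //.
exact: colset_max.
Qed.

Lemma top_etsuper p : p \in rep_set n L ->
  is_top omega eta (etsuper n k (colht L (w p))) [set p] (chi (colset (w p))) 1.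
Proof.
move=> pS; have hb := @etsuper_ferm n k (colht L (w p)); split.
  rewrite hb (big_pred1 p) => [|l]; last by rewrite /= eq_sym; apply/eqP/eqP => [/set1_inj|->].
  rewrite mdeg_chi card_colset eqxx mul1r big1 // => i _.
  case: eqP => [->|_]; last by rewrite chiE leq_b1.
  by rewrite chiE inE ltnn.
move=> S c nz; have [cd [l [-> cl c1]]] := ferm_support hb nz.
have [C cE cC] := flat_chi cd c1; rewrite cE in cl *.
have lC : l \notin C by move/eqP: cl; rewrite chiE; case: (l \in C).
have le_eta i : (eta i <= (tdeg L).*2.+1)%N.
  by rewrite /eta -addn1 leq_add ?leq_b1 // leq_double rep_mon_le.
case: (C =P colset (w p)) => [CE|nC]; last first.
  right; rewrite !weight_chi !big_set1.
  have lt := colset_max cC nC.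
  have : ((\sum_(i in C) w i).+1 * (tdeg L).*2.+3 <= (\sum_(i in colset (w p)) w i) * (tdeg L).*2.+3)%N.
    by rewrite leq_mul2r lt orbT.
  by rewrite mulSn; have := le_eta l; lia.
(* The theta avoids [colset (w p)], so w l <= w p. A shorter row loses in eta, and so does a bosonic
   row of equal length; a fermionic row of equal length is p, as fermionic entries are distinct. *)
case: (l =P p) => [->|lp]; first by left; rewrite CE.
right; rewrite !weight_chi CE ltn_add2l !big_set1 /eta pS.
move: lC; rewrite CE inE -leqNgt -/(w l) leq_eqVlt => /orP[/eqP wl|wl]; last first.
  by case: (l \in _); lia.
rewrite wl; case lS: (l \in rep_set n L); last by rewrite ltn_add2l.
by case: lp; apply: (rep_mon_inj lS pS); exact: wl.
Qed.

(** The thetas come in decreasing order: reordering moves the first one past [size ps] others, and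
    so on, which adds up to a binomial coefficient. *)
Lemma top_ferm (ps : seq 'I_n) : sorted (fun a b : 'I_n => b < a)%N ps -> {subset ps <= rep_set n L} ->
  exists c, (forall i, c i = \sum_(p <- ps) (i \in colset (w p)))%N /\
  is_top omega eta (\big[@gmul n _/gconst n 1]_(p <- ps) etsuper n k (colht L (w p)))
    [set p in ps] c ((-1) ^+ 'C(size ps, 2)).
Proof.
elim: ps => [_ _|p ps IH srt sub].
  exists mnm0; split=> [i|]; first by rewrite big_nil mnm0E.
  rewrite big_nil expr0; have -> : [set p in [::] : seq 'I_n] = finset.set0 by apply/setP=> i; rewrite !inE.
  exact: top_one.
have [|q qps|c [hc htop]] := IH; first exact: path_sorted srt.
  by apply: sub; rewrite inE qps orbT.
have tr : transitive (fun a b : 'I_n => b < a)%N by move=> a b d h1 h3; exact: ltn_trans h3 h1.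
have /allP lt := order_path_min tr srt.
have pps : p \notin ps by apply/negP => /lt; rewrite ltnn.
have ups : uniq ps.
  by apply: (sorted_uniq tr _ (path_sorted srt)) => a; rewrite /= ltnn.
exists (mnm_add (chi (colset (w p))) c); split.
  by move=> i; rewrite mnmDE chiE big_cons hc.
rewrite big_cons.
have -> : [set q in p :: ps] = [set p] :|: [set q in ps] by apply/setP => i; rewrite !inE.
have dis : [disjoint [set p] & [set q in ps]] by rewrite disjoints1 inE.
have pS : p \in rep_set n L by apply: sub; rewrite inE eqxx.
have := top_mul dis (top_etsuper pS) htop.
have -> : cross [set p] [set q in ps] = size ps.
  rewrite /cross -(card_uniqP ups) -[RHS]cardsE -[RHS](card_imset _ (f := pair p)); last by move=> a b [].
  congr #|pred_of_set _|; apply/setP => -[a b]; rewrite inE /= !inE.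
  apply/and3P/imsetP => [[/eqP-> bps _]|[q]]; first by exists b => //; rewrite inE.
  by rewrite inE => qps [-> ->]; split=> //; exact: lt.
rewrite mul1r -exprD /= binS bin1 addnC //.
Qed.

Lemma top_bos (js : seq nat) :
  exists c, (forall i, c i = \sum_(j <- js) (i \in colset j))%N /\
  is_top omega eta (\big[@gmul n _/gconst n 1]_(j <- js) esuper n k (colht L j)) finset.set0 c 1.
Proof.
elim: js => [|j js [c [hc htop]]].
  exists mnm0; split=> [i|]; first by rewrite big_nil mnm0E.
  by rewrite big_nil; exact: top_one.
exists (mnm_add (chi (colset j)) c); split=> [i|]; first by rewrite mnmDE chiE big_cons hc.
rewrite big_cons; have := top_mul _ (top_esuper j) htop.
by rewrite finset.set0U cross0l expr0 !mul1r; apply; rewrite -setI_eq0 set0I.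
Qed.

(** Reading the circled columns from left to right takes the fermionic rows of L from last to first.
    The resulting sign is the one that the reversal removes. *)
Lemma scoef_eprod_conj : scoef L (eprod n k (spconj L)) = (-1) ^+ 'C(fdeg L, 2).
Proof.
pose ps := rev [seq i : 'I_n <- enum 'I_n | (i < fdeg L)%N].
have fL : (fdeg L <= n)%N by rewrite (leq_trans _ Ln) // leq_addr.
have psE : [seq w p | p <- ps] = rev (asym L).
  rewrite map_rev; congr rev.
  have -> : [seq w p | p <- [seq i : 'I_n <- enum 'I_n | (i < fdeg L)%N]] =
     [seq nth 0%N (asym L ++ ssym L) j | j <- [seq val i | i <- [seq i : 'I_n <- enum 'I_n | (i < fdeg L)%N]]].
    by rewrite -map_comp; apply: eq_map => i; rewrite /w rep_monE.
  rewrite -(filter_map val (fun j => j < fdeg L)%N) val_enum_ord.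
  have -> : [seq j <- iota 0 n | (j < fdeg L)%N] = iota 0 (fdeg L).
    rewrite -(subnKC fL) iotaD filter_cat add0n.
    rewrite (@eq_in_filter _ _ predT) ?filter_predT; last by move=> j; rewrite mem_iota add0n.
    rewrite (@eq_in_filter _ _ pred0) ?filter_pred0 ?cats0 //.
    by move=> j; rewrite mem_iota => /andP[]; rewrite leqNgt => /negbTE.
  apply: (@eq_from_nth _ 0%N); first by rewrite size_map size_iota.
  move=> j; rewrite size_map size_iota => jL.
  by rewrite (nth_map 0%N) ?size_iota // nth_iota // add0n nth_cat jL.
have srt : sorted (fun a b : 'I_n => b < a)%N ps.
  rewrite rev_sorted; apply: sorted_filter; first by move=> a b d; apply: ltn_trans.
  by have := iota_ltn_sorted 0 n; rewrite -val_enum_ord sorted_map.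
have psS : [set p in ps] = rep_set n L.
  by apply/setP => i; rewrite !inE mem_rev mem_filter mem_enum andbT.
have [|c1 [hc1 top1]] := top_ferm srt; first by move=> p; rewrite -psS inE.
have [c2 [hc2 top2]] := top_bos [seq j <- iota 0 (ncols L) | j \notin asym L].
have dis : [disjoint [set p in ps] & (finset.set0 : {set 'I_n})] by rewrite -setI_eq0 setI0.
have [E _] := top_mul dis top1 top2; move: E.
rewrite cross0r expr0 mul1r mulr1 finset.setU0 psS.
have -> : size ps = fdeg L by rewrite -(size_map w) psE size_rev.
have -> : mnm_add c1 c2 = rep_mon n L.
  apply/mnmP => i; rewrite mnmDE hc1 hc2.
  rewrite -(big_map w predT (fun j => nat_of_bool (i \in colset j))) psE -big_cat /= -/(circ_cols L).
  have wB : (w i <= (tdeg L).+1)%N by apply: leqW; exact: rep_mon_le.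
  rewrite (@sum_circ_cols L (fun j => nat_of_bool (i \in colset j)) (tdeg L).+1) //.
  - rewrite -[RHS]card_ord -sum1_card (big_ord_widen _ (fun=> 1%N) wB) [RHS]big_mkcond.
    by apply: eq_bigr => j _; rewrite inE; case: ifP.
  - by move=> v /parts_le.
  - by move=> j; rewrite -card_colset => /cards0_eq->; rewrite inE.
rewrite /scoef /eprod {1}/asym {1}/ssym /= !big_map -psE big_map => ->.
by [].
Qed.
End Leading.

(** * Stability in the number of variables *)
Section Restriction.
Variables (n n' : nat) (le_nn' : (n <= n')%N) (k : fieldType).
Implicit Types (c : multinom n) (m : multinom n') (S T : {set 'I_n}).

Definition natmon c (j : nat) : nat := if insub j is Some i then c i else 0%N.
Definition wmon c : multinom n' := Multinom [tuple natmon c i | i < n'].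
Definition wset S : {set 'I_n'} := widen_ord le_nn' @: S.

Lemma natmon_ord c (i : 'I_n) : natmon c i = c i.
Proof. by rewrite /natmon valK. Qed.

Lemma natmon_ge c j : (n <= j)%N -> natmon c j = 0%N.
Proof. by move=> h; rewrite /natmon insubF // ltnNge h. Qed.

Lemma wmonE c i : wmon c i = natmon c i.
Proof. by rewrite multinomE tnth_mktuple. Qed.

Lemma wmon_inj : injective wmon.
Proof.
move=> c d /mnmP h; apply/mnmP => i.
by have := h (widen_ord le_nn' i); rewrite !wmonE !natmon_ord.
Qed.

Lemma widen_inj : injective (widen_ord le_nn').
Proof. by move=> i j /(congr1 val) /= h; apply: val_inj. Qed.

Lemma big_widen (R : Type) (idx : R) (op : Monoid.com_law idx) (G : nat -> R) :
  (forall j, (n <= j)%N -> G j = idx) -> \big[op/idx]_(i < n') G i = \big[op/idx]_(i < n) G i.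
Proof.
move=> h; rewrite (bigID (fun i : 'I_n' => (i < n)%N)) /= [X in op _ X]big1 => [|i]; last first.
  by rewrite -leqNgt => /h.
by rewrite Monoid.mulm1 (big_ord_widen n').
Qed.

Definition rvar (j : nat) : polyx n k := if insub j is Some i then xvar k i else 0.
(* Sets to zero the variables of index at least n. *)
Definition rho : {rmorphism polyx n' k -> polyx n k} := mmap (@mpolyC n k) (fun i : 'I_n' => rvar i).

Lemma rho_mon m c : mcoeff c (mmap1 (fun i : 'I_n' => rvar i) m) = (m == wmon c)%:R.
Proof.
rewrite /mmap1; have [/existsP[i /andP[ni mi]]|/existsPn h] := boolP [exists i : 'I_n', (n <= i)%N && (m i != 0%N)].
  rewrite (bigD1 i) //= /rvar insubF ?ltnNge ?ni // expr0n (negbTE mi) mul0r mcoeff0.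
  by case: eqP => // e; move: mi; rewrite e wmonE natmon_ge ?eqxx.
pose d : multinom n := Multinom [tuple m (widen_ord le_nn' i) | i < n].
have mE : m = wmon d.
  apply/mnmP => i; rewrite wmonE; have [ni|ni] := ltnP i n.
    by rewrite -[val i]/(val (Ordinal ni)) natmon_ord multinomE tnth_mktuple; congr (m _); apply: val_inj.
  by rewrite natmon_ge //; have := h i; rewrite ni negbK => /eqP.
have -> : \prod_(i < n') rvar i ^+ m i = \prod_(i < n') (fun j => rvar j ^+ natmon d j) i.
  by apply: eq_bigr => i _; rewrite mE wmonE.
rewrite (big_widen _ (G := fun j => rvar j ^+ natmon d j)) => [|j /natmon_ge->]; last by rewrite expr0.
have -> : \prod_(i < n) rvar i ^+ natmon d i = mpolyX k d.
  by rewrite mpolyXE_id; apply: eq_bigr => i _; rewrite natmon_ord /rvar valK.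
by rewrite mcoeffX mE (inj_eq wmon_inj).
Qed.

Lemma mcoeff_rho p c : mcoeff c (rho p) = mcoeff (wmon c) p.
Proof.
rewrite /rho /= /mmap raddf_sum /=.
under eq_bigr do rewrite mul_mpolyC mcoeffZ rho_mon.
have [h|h] := boolP (wmon c \in msupp p).
  rewrite (bigD1_seq (wmon c)) ?msupp_uniq //= eqxx mulr1 big1 ?addr0 // => m /negbTE->.
  by rewrite mulr0.
rewrite big_seq big1 => [|m mp]; first by move: h; rewrite -mcoeff_eq0 => /eqP.
by case: eqP => e; rewrite ?mulr0 //; rewrite -e mp in h.
Qed.

Definition grestr (f : super n' (polyx n' k)) : super n (polyx n k) :=
  [ffun S : {set 'I_n} => rho (f (wset S))].

Lemma cross_wset S T : cross (wset S) (wset T) = cross S T.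
Proof.
rewrite /cross -[RHS](card_imset _ (f := fun p => (widen_ord le_nn' p.1, widen_ord le_nn' p.2))); last first.
  by move=> [a b] [a' b'] [] h1 h2; congr pair; apply: val_inj.
congr #|pred_of_set _|; apply/setP => -[a b]; rewrite inE /=; apply/and3P/imsetP.
  case=> /imsetP[a' aS ->] /imsetP[b' bT ->] lt; exists (a', b') => //.
  by rewrite inE /= aS bT.
by case=> -[a' b']; rewrite inE /= => /and3P[aS bT lt] [-> ->]; split=> //; apply: imset_f.
Qed.

Lemma wsetK S : [set i | widen_ord le_nn' i \in wset S] = S.
Proof. by apply/setP => i; rewrite inE mem_imset //; exact: widen_inj. Qed.

Lemma wsetD S T : wset S :\: wset T = wset (S :\: T).
Proof.
apply/setP => i; rewrite inE; apply/andP/imsetP => [[iT /imsetP[j jS ij]]|[j jST ->]].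
  rewrite ij in iT *; exists j => //; by rewrite inE jS andbT; apply: contra iT; exact: imset_f.
by move: jST; rewrite inE => /andP[jT jS]; rewrite !(mem_imset _ _ widen_inj).
Qed.

(** Subsets of [wset S] are exactly the [wset T] with T inside S, and the embedding preserves the
    order of indices, hence all crossing signs. *)
Lemma grestrM f g : grestr (gmul f g) = gmul (grestr f) (grestr g).
Proof.
apply/ffunP => S; rewrite ffunE !gmulE rmorph_sum /=.
rewrite (reindex_onto wset (fun T : {set 'I_n'} => [set i | widen_ord le_nn' i \in T])) /=; last first.
  move=> T sT; apply/setP => i; apply/imsetP/idP => [[j]|iT].
    by rewrite inE => jT ->.
  by have /imsetP[j _ ij] := subsetP sT i iT; exists j; rewrite ?inE -?ij.
apply: eq_big => [T|T _].
  rewrite wsetK eqxx andbT; apply/idP/idP => [/subsetP h|]; last exact: imsetS.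
  by apply/subsetP => i iT; have := h _ (imset_f _ iT); rewrite mem_imset //; exact: widen_inj.
by rewrite wsetD cross_wset rmorphM rmorph_sign rmorphM !ffunE.
Qed.

Lemma grestr1 : grestr (gconst n' 1) = gconst n 1.
Proof.
by apply/ffunP => S; rewrite !ffunE imset_eq0; case: ifP; rewrite ?rmorph1 ?rmorph0.
Qed.

Lemma mdeg_wmon c : mdeg (wmon c) = mdeg c.
Proof.
rewrite !mdegE; under eq_bigr do rewrite wmonE.
rewrite (big_widen _ (G := natmon c)); last by move=> j /natmon_ge.
by apply: eq_bigr => i _; rewrite natmon_ord.
Qed.

Lemma bos_grestr A d f g : A 0%N = 1%N -> is_bos A d f -> is_bos A d g -> grestr f = g.
Proof.
move=> A0 hf hg; apply: superP => S c; rewrite ffunE mcoeff_rho hf hg imset_eq0 mdeg_wmon.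
congr (_ * _); under eq_bigr do rewrite wmonE.
rewrite (big_widen _ (G := fun j => (A (natmon c j))%:R)); last by move=> j /natmon_ge->; rewrite A0.
by apply: eq_bigr => i _; rewrite natmon_ord.
Qed.

Lemma ferm_grestr A G d f g : A 0%N = 1%N -> is_ferm A G d f -> is_ferm A G d g -> grestr f = g.
Proof.
move=> A0 hf hg; apply: superP => S c; rewrite ffunE mcoeff_rho hf hg mdeg_wmon.
congr (_ * _).
have pE (l : 'I_n) : \prod_(i < n') (if i == widen_ord le_nn' l then G (wmon c i) else A (wmon c i))%:R =
   \prod_(i < n) (if i == l then G (c i) else A (c i))%:R :> k.
  rewrite (eq_bigr (fun i : 'I_n' => (fun j => (if j == l :> nat then G (natmon c j) else A (natmon c j))%:R : k) i)); last first.
    by move=> i _; rewrite wmonE.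
  rewrite (big_widen _ (G := fun j => (if j == l :> nat then G (natmon c j) else A (natmon c j))%:R : k)).
    by apply: eq_bigr => i _; rewrite natmon_ord.
  by move=> j nj; rewrite gtn_eqF ?(leq_trans (ltn_ord l) nj) // natmon_ge // A0.
have [/existsP[l /eqP Sl]|/existsPn h] := boolP [exists l, S == [set l]].
  rewrite (big_pred1 (widen_ord le_nn' l)) => [|x]; last first.
    by rewrite Sl /wset imset_set1 /= eq_sym; apply/eqP/eqP => [/set1_inj|->].
  rewrite pE [RHS](big_pred1 l) // => x; rewrite Sl /= eq_sym; apply/eqP/eqP => [/set1_inj|->] //.
rewrite [RHS]big1 => [|l]; last by rewrite (negbTE (h l)).
rewrite big1 // => l /eqP E; have /imsetP[j jS lj] : l \in wset S by rewrite E inE.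
have := h j; rewrite -(inj_eq (imset_inj widen_inj)) imset_set1 -lj -/(wset S) E eqxx.
by [].
Qed.

Lemma grestr_eprod L : grestr (eprod n' k L) = eprod n k L.
Proof.
rewrite /eprod grestrM; congr gmul.
  elim: (asym L) => [|d s IH]; rewrite ?big_nil ?grestr1 // !big_cons grestrM IH; congr gmul.
  exact: ferm_grestr (@etsuper_ferm n' k d) (@etsuper_ferm n k d).
elim: (ssym L) => [|d s IH]; rewrite ?big_nil ?grestr1 // !big_cons grestrM IH; congr gmul.
exact: bos_grestr (@esuper_bos n' k d) (@esuper_bos n k d).
Qed.

Lemma scoef_grestr L f : (splen L <= n)%N -> scoef L (grestr f) = scoef L f.
Proof.
move=> Ln; rewrite /scoef ffunE mcoeff_rho.
have fL : (fdeg L <= n)%N by rewrite (leq_trans _ Ln) // leq_addr.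
congr (mcoeff _ (f _)).
  apply/mnmP => i; rewrite wmonE rep_monE; have [ni|ni] := ltnP i n.
    by rewrite -[val i]/(val (Ordinal ni)) natmon_ord rep_monE.
  by rewrite natmon_ge // nth_default // size_cat -/(splen L) (leq_trans Ln).
apply/setP => i; rewrite inE; apply/imsetP/idP => [[j]|iL]; first by rewrite inE => h ->.
by exists (Ordinal (leq_trans iL fL)); [rewrite inE | apply: val_inj].
Qed.
End Restriction.

(** Discarding variables is an algebra morphism that takes each e and etilde to its namesake, and it
    keeps the coefficients of the superpartitions that still fit. *)
Lemma scoef_eprod_stable k L W n n' : (splen W <= n)%N -> (splen W <= n')%N ->
  scoef W (eprod n k L) = scoef W (eprod n' k L).
Proof.
wlog le : n n' / (n <= n')%N => [H|] Wn Wn'.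
  by case/orP: (leq_total n n') => h; [apply: H | symmetry; apply: H].
by rewrite -(grestr_eprod le k L) scoef_grestr.
Qed.

(** * Supermonomial coefficients of h and htilde *)

Section HCoef.
Variables (n : nat) (k : fieldType).
Implicit Types (L : spart) (f : super n (polyx n k)).

Lemma card_rep_set L : (splen L <= n)%N -> #|rep_set n L| = fdeg L.
Proof.
move=> Ln; rewrite -sum1_card big_mkcond /=.
transitivity (\sum_(i < n) (i \in rep_set n L))%N.
  by apply: eq_bigr => i _; case: ifP.
by rewrite (@sum_rep n L (fun x => x.1 : nat)) //= sum1_size big1_eq addn0.
Qed.

Lemma mdeg_rep_mon L : (splen L <= n)%N -> mdeg (rep_mon n L) = tdeg L.
Proof.
move=> Ln; rewrite mdegE (@sum_rep n L (fun x => x.2)) //=.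
by rewrite /tdeg !sumnE.
Qed.

Lemma scoef_hsuper L d : (splen L <= n)%N ->
  scoef L (hsuper n k d) = ((fdeg L == 0%N) && (tdeg L == d))%:R.
Proof.
move=> Ln; rewrite /scoef hsuper_bos mdeg_rep_mon // -cards_eq0 card_rep_set //.
by rewrite big1 ?mulr1.
Qed.

Lemma scoef_htsuper L d : (splen L <= n)%N ->
  scoef L (htsuper n k d) = ((fdeg L == 1%N) && (tdeg L == d))%:R * (nth 0%N (asym L) 0).+1%:R.
Proof.
move=> Ln; rewrite /scoef htsuper_ferm mdeg_rep_mon //.
have [f1|f1] := eqVneq (fdeg L) 1%N; last first.
  rewrite big1 ?mulr0 ?mul0r // => l /eqP E.
  by move: f1; rewrite -(card_rep_set Ln) E cards1 eqxx.
have n0 : (0 < n)%N by rewrite (leq_trans _ Ln) // /splen -/(fdeg L) f1.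
pose o := Ordinal n0.
have E : rep_set n L = [set o] by apply/setP => i; rewrite !inE f1 ltnS leqn0 -val_eqE.
rewrite E (big_pred1 o) => [|l]; last by rewrite /= eq_sym; apply/eqP/eqP => [/set1_inj|->].
congr (_ * _); rewrite (bigD1 o) //= big1 ?mulr1 => [|i /negbTE->] //.
by rewrite rep_monE nth_cat -/(fdeg L) f1.
Qed.
End HCoef.

(** * Splitting of H and I *)
Section FracRepr.
Variable R : idomainType.

Lemma pi_tofrac (r : {ratio R}) : \pi_({fraction R})%qT r * tofrac (fraction.frac r).2 = tofrac (fraction.frac r).1.
Proof.
unlock FracField.tofrac; rewrite -[LHS]FracField.pi_mul; apply/eqmodP.
by rewrite /FracField.mulf /= FracField.equivfE !numden_Ratio ?mulf_neq0 ?oner_neq0 ?denom_ratioP // !mulr1 mulrC.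
Qed.

Lemma fraction_repr (z : {fraction R}) :
  z = tofrac (fraction.frac (repr z)).1 / tofrac (fraction.frac (repr z)).2.
Proof.
by rewrite -pi_tofrac reprK mulfK // tofrac_eq0 denom_ratioP.
Qed.

Lemma tofrac_div_eq (a b u d : R) : b != 0 -> d != 0 ->
  (tofrac a / tofrac b == tofrac u / tofrac d) = (a * d == u * b).
Proof. by move=> b0 d0; rewrite eqr_div ?tofrac_eq0 // -!tofracM tofrac_eq. Qed.

Lemma tofrac_div_add (a b u d : R) : b != 0 -> d != 0 ->
  tofrac a / tofrac b + tofrac u / tofrac d = tofrac (a * d + u * b) / tofrac (b * d).
Proof. by move=> b0 d0; rewrite addf_div ?tofrac_eq0 // tofracD !tofracM. Qed.

Lemma tofrac_div_mul (a b u d : R) :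
  tofrac a / tofrac b * (tofrac u / tofrac d) = tofrac (a * u) / tofrac (b * d).
Proof. by rewrite mulf_div !tofracM. Qed.

Lemma fraction_ex (z : {fraction R}) : exists a b, b != 0 /\ z = tofrac a / tofrac b.
Proof. by do 2!eexists; split; last exact: fraction_repr; exact: denom_ratioP. Qed.

Section FracMap.
Variable sigma : {rmorphism R -> R}.
Hypothesis sigma_inj : injective sigma.

(** Uses the chosen representative exactly as [frac_sym] does, so that the two are convertible for
    [msym w]. Injectivity of sigma yields independence of the representative and the morphism
    laws. *)
Definition fracmap (z : {fraction R}) : {fraction R} :=
  tofrac (sigma (fraction.frac (repr z)).1) / tofrac (sigma (fraction.frac (repr z)).2).

Let sigma_neq0 b : b != 0 -> sigma b != 0.
Proof. by apply: contra => /eqP h; apply/eqP/sigma_inj; rewrite h rmorph0. Qed.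

Lemma fracmap_div a b : b != 0 -> fracmap (tofrac a / tofrac b) = tofrac (sigma a) / tofrac (sigma b).
Proof.
move=> b0; rewrite /fracmap; move: (fraction_repr (tofrac a / tofrac b)).
have : (fraction.frac (repr (tofrac a / tofrac b : {fraction R}))).2 != 0 by exact: denom_ratioP.
move: (fraction.frac _).1 (fraction.frac _).2 => u d d0 /eqP.
rewrite tofrac_div_eq // => /eqP E; apply/eqP; rewrite tofrac_div_eq ?sigma_neq0 //.
by rewrite -!rmorphM E.
Qed.

Lemma fracmap_tofrac a : fracmap (tofrac a) = tofrac (sigma a).
Proof. by have := fracmap_div a (oner_neq0 _); rewrite !rmorph1 !divr1. Qed.

Lemma fracmapD : {morph fracmap : z1 z2 / z1 + z2}.
Proof.
move=> z1 z2; have [a [b [b0 ->]]] := fraction_ex z1; have [u [d [d0 ->]]] := fraction_ex z2.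
rewrite tofrac_div_add // !fracmap_div ?mulf_neq0 //.
by rewrite tofrac_div_add ?sigma_neq0 // rmorphD !rmorphM.
Qed.

Lemma fracmapM : {morph fracmap : z1 z2 / z1 * z2}.
Proof.
move=> z1 z2; have [a [b [b0 ->]]] := fraction_ex z1; have [u [d [d0 ->]]] := fraction_ex z2.
rewrite tofrac_div_mul !fracmap_div ?mulf_neq0 //.
by rewrite tofrac_div_mul !rmorphM.
Qed.
End FracMap.
End FracRepr.

(** * The operators over an arbitrary field *)

Section SymmetrizedOps.
Variables (n : nat) (k : fieldType) (beta0 : k).
Notation P := (polyx n.+1 k).
Notation F := {fraction P}.
Notation x i := (xvar k i).
Implicit Types (w : 'S_n.+1) (p q a b : P) (i j : 'I_n.+1).

Definition msymr w : {rmorphism P -> P} := msym w.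
Definition fsym w : F -> F := fracmap (msymr w).

Lemma msym_xvar w i : msym w (x i) = x (w i).
Proof.
apply/mpolyP => c; rewrite mcoeff_sym !mcoeffX; congr (nat_of_bool _)%:R.
apply/eqP/eqP => /mnmP h; apply/mnmP => l; have := h.
  by move/(_ (w^-1 l)%g); rewrite !mnm1E multinomE tnth_mktuple permKV -(inj_eq (@perm_inj _ w)) permKV.
by move/(_ (w l)); rewrite !mnm1E multinomE tnth_mktuple (inj_eq (@perm_inj _ w)).
Qed.

Lemma msym_eul w i p : msym w (eul i p) = eul (w i) (msym w p).
Proof.
apply/mpolyP => c; rewrite mcoeff_eul !mcoeff_sym mcoeff_eul.
by rewrite multinomE tnth_mktuple.
Qed.

Definition Di i p : F := tofrac (eul i p) + fconst n.+1 beta0 * \sum_(j < n.+1 | j != i)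
  tofrac (x j) / tofrac (x i - x j) * tofrac (p - msym (tperm i j) p).

Lemma xsub_neq0 i j : i != j -> x i - x j != 0.
Proof. by move=> h; have := @xvar_neq n.+1 k i j h; rewrite tofrac_eq subr_eq0. Qed.

(** Conjugation by w turns the exchange of ord0 and j into that of w ord0 and w j. *)
Lemma fsym_Di w p : fsym w (Di ord0 p) = Di (w ord0) (msym w p).
Proof.
have si : injective (msymr w) by exact: inj_msym.
rewrite /fsym /Di (fracmapD si) (fracmap_tofrac si) /= msym_eul; congr (_ + _).
rewrite (fracmapM si) /fconst (fracmap_tofrac si) /=.
have -> : msym w (mpolyC n.+1 beta0) = mpolyC n.+1 beta0.
  by rewrite -[mpolyC _ _]mulr1 mul_mpolyC msymZ msym1.
have z : fracmap (msymr w) 0 = 0 by rewrite -tofrac0 (fracmap_tofrac si) rmorph0.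
congr (_ * _); rewrite (big_morph _ (fracmapD si) z).
rewrite [RHS](reindex_inj (@perm_inj _ w)) /=; apply: eq_big => j.
  by rewrite (inj_eq (@perm_inj _ w)).
move=> nj; rewrite (fracmapM si) (fracmap_tofrac si) (fracmap_div si) ?xsub_neq0 1?eq_sym //=.
rewrite !msymB !msym_xvar; congr (_ / _ * tofrac (_ - _)).
by rewrite -!msymMm conjgC tpermJ.
Qed.

Lemma Di_sign i m p : Di i ((-1) ^+ m * p) = (-1) ^+ m * Di i p.
Proof.
rewrite -signr_odd -[in RHS]signr_odd; case: (odd m); rewrite ?expr0 ?expr1 ?mul1r ?mulN1r //.
rewrite /Di opprD -mulrN -sumrN; congr (_ + _ * _); first by rewrite -tofracN /eul mderivN mulrN.
by apply: eq_bigr => j _; rewrite -mulrN -tofracN msymN opprD.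
Qed.

(** Multiplication by a transposition maps the permutations with one value at ord0 onto those with
    another, so all n + 1 values are equally frequent. *)
Lemma card_perm_at i : #|[pred w : 'S_n.+1 | w ord0 == i]| = n`!.
Proof.
have E j : #|[pred w : 'S_n.+1 | w ord0 == j]| = #|[pred w : 'S_n.+1 | w ord0 == i]|.
  rewrite -!sum1_card (reindex_inj (mulIg (tperm i j))) /=; apply: eq_bigl => w.
  by rewrite !inE permM; apply/eqP/eqP => [|->]; rewrite ?tpermL // => h;
     rewrite -(tpermK i j (w ord0)) h tpermR.
have : (\sum_(j < n.+1) #|[pred w : 'S_n.+1 | w ord0 == j]| = n.+1`!)%N.
  rewrite -(card_Sn n.+1) -sum1_card (partition_big (fun w : 'S_n.+1 => w ord0) predT) //=.
  by apply: eq_bigr => j _; rewrite -sum1_card; apply: eq_bigl => w; rewrite !inE.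
under eq_bigr do rewrite E.
by rewrite sum_nat_const card_ord factS => /eqP; rewrite eqn_pmul2l // => /eqP.
Qed.

Definition D0part (f : super n.+1 P) : super n.+1 F :=
  [ffun S : {set 'I_n.+1} => if ord0 \in S then Di ord0 (f S) else 0].

(** [Hop] and then [Iop] with a generic field and parameter; at [Qbeta] and [beta] they are
    convertible to the originals. *)
Definition Hgen (f : super n.+1 P) : super n.+1 F :=
  [ffun S : {set 'I_n.+1} =>
     \sum_(i < n.+1) tofrac (eul i (eul i (f S)))
     + fconst n.+1 beta0 * \sum_(i < n.+1) \sum_(j < n.+1 | (i < j)%N)
         tofrac (x i + x j) / tofrac (x i - x j)
         * tofrac (eul i (f S) - eul j (f S))
     - 2%:R * fconst n.+1 beta0 * \sum_(i < n.+1) \sum_(j < n.+1 | (i < j)%N)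
         tofrac (x i * x j) / tofrac ((x i - x j) ^+ 2)
         * tofrac ((f - swap i j f) S)].

Definition Igen (f : super n.+1 P) : super n.+1 F :=
  [ffun S : {set 'I_n.+1} => (n`!%:R)^-1 *
     (\sum_(w : 'S_n.+1) gperm (fsym w) w (D0part (pair_perm (w^-1)%g f))) S].

Lemma Hgen_split f : Hgen f = gmap (tofracr n.+1 k) (geulsq f) + gscale (fconst n.+1 beta0) (H1 f).
Proof.
apply/ffunP => S; rewrite [LHS]ffunE gaddE [gmap _ _ _]ffunE [geulsq _ _]ffunE [gscale _ _ _]ffunE [H1 _ _]ffunE.
rewrite rmorph_sum mulrBr addrA; congr (_ - _).
by rewrite mulrA [fconst _ _ * _]mulrC.
Qed.

(** For symmetric f the term of w is the operator at index w ord0 applied to f S, when that index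
    lies in S. Each index arises n! times, which cancels the prefactor. *)
Lemma Igen_split f : (n`!%:R : F) != 0 -> symmetric_super f ->
  Igen f = gmap (tofracr n.+1 k) (geulin f) + gscale (fconst n.+1 beta0) (I1 f).
Proof.
move=> nf fs; apply/ffunP => S; rewrite [LHS]ffunE gaddE [gmap _ _ _]ffunE [geulin _ _]ffunE
  [gscale _ _ _]ffunE [I1 _ _]ffunE.
transitivity (\sum_(i < n.+1 | i \in S) Di i (f S)); last first.
  rewrite rmorph_sum big_distrr -big_split; apply: eq_bigr => i iS /=; congr (_ + _ * _).
  by apply: eq_bigr => j _; rewrite sym_swap.
rewrite sum_ffunE.
have E (w : 'S_n.+1) : gperm (fsym w) w (D0part (pair_perm (w^-1)%g f)) S =
    if w ord0 \in S then Di (w ord0) (f S) else 0.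
  have si : injective (msymr w) by exact: inj_msym.
  rewrite gpermE fs ffunE inE; case: ifP => _; last first.
    by rewrite /fsym -tofrac0 (fracmap_tofrac si) rmorph0 tofrac0 mulr0.
  by rewrite fsym_Di -Di_sign -pair_permE fs.
under eq_bigr do rewrite E.
rewrite (partition_big (fun w : 'S_n.+1 => w ord0) predT) //=.
have {}E i : \sum_(w : 'S_n.+1 | w ord0 == i) (if w ord0 \in S then Di (w ord0) (f S) else 0) =
    n`!%:R * (if i \in S then Di i (f S) else 0).
  rewrite -(card_perm_at i) -sum1_card natr_sum big_distrl /=; apply: eq_big => // w.
  by move=> /eqP->; rewrite mulr1n; symmetry; apply: mul1r.
under eq_bigr do rewrite E.
by rewrite -big_distrr mulKf // [RHS]big_mkcond.
Qed.
End SymmetrizedOps.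

Section JackOps.
Variable n : nat.
Notation P := (polyx n.+1 Qbeta).

Lemma Hop_split (f : super n.+1 P) :
  Hop f = gmap (tofracr n.+1 Qbeta) (geulsq f) + gscale (fconst n.+1 beta) (H1 f).
Proof. exact: (@Hgen_split n Qbeta beta f). Qed.

Lemma Iop_split (f : super n.+1 P) : symmetric_super f ->
  Iop f = gmap (tofracr n.+1 Qbeta) (geulin f) + gscale (fconst n.+1 beta) (I1 f).
Proof.
move=> fs; apply: (@Igen_split n Qbeta beta f _ fs).
have -> : (n`!%:R : {fraction P}) = tofracr n.+1 Qbeta n`!%:R by rewrite rmorph_nat.
rewrite /= tofrac_eq0 -mpolyC1 -mpolyCMn mpolyC_eq0.
rewrite -tofrac1 -tofracMn tofrac_eq0 -polyC1 -polyCMn polyC_eq0.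
by rewrite pnatr_eq0 -lt0n fact_gt0.
Qed.
End JackOps.

(** * Triangular systems and specialisations *)
Section Triangular.
Variables (I : choiceType) (X : seq I) (rank : I -> nat) (K : fieldType) (kap : {rmorphism rat -> K}).
Hypothesis uX : uniq X.
Variables (V : lmodType K) (m e : I -> V) (u : I -> I -> rat) (E : I -> rat) (Rel : V -> V -> Prop).
Hypothesis Rel_lin : forall (a : K) f g f' g', Rel f g -> Rel f' g' -> Rel (a *: f + f') (a *: g + g').
Hypothesis Rel0 : Rel 0 0.
Hypothesis eE : forall W, W \in X -> e W = \sum_(G <- X) kap (u W G) *: m G.
Hypothesis uWW : forall W, W \in X -> u W W = 1.
Hypothesis u_rank : forall W G, W \in X -> G \in X -> u W G != 0 -> G = W \/ (rank G < rank W)%N.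
Hypothesis RelE : forall W, W \in X -> Rel (e W) (kap (E W) *: e W).

Lemma Rel_sum (r : seq I) (Q : pred I) (a : I -> K) (f g : I -> V) :
  (forall G, G \in r -> Q G -> Rel (f G) (g G)) ->
  Rel (\sum_(G <- r | Q G) a G *: f G) (\sum_(G <- r | Q G) a G *: g G).
Proof.
elim: r => [|G r IH] h; first by rewrite !big_nil.
have hr : Rel (\sum_(G <- r | Q G) a G *: f G) (\sum_(G <- r | Q G) a G *: g G).
  by apply: IH => H Hr; apply: h; rewrite inE Hr orbT.
rewrite !big_cons; case: ifP => // QG; apply: Rel_lin => //.
by apply: h => //; rewrite inE eqxx.
Qed.

Definition tri_row W (A : I -> rat) := [/\ Rel (m W) (\sum_(G <- X) kap (A G) *: m G), A W = E W &
  forall G, G \in X -> A G != 0 -> G = W \/ (rank G < rank W)%N].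

(** Strong induction on the rank, solving e_W = m_W + lower terms for m_W. The relation [Rel f g]
    stands for D f = g, where D takes values in another space. *)
Lemma triangular_row W : W \in X -> exists A, tri_row W A.
Proof.
have [n] := ubnP (rank W); elim: n W => // n IH W rW WX.
have ex G : exists A, (G \in X) && (G != W) && (u W G != 0) -> tri_row G A.
  (* When the condition fails any witness will do; [E] is a dummy. *)
  case: (boolP ((G \in X) && (G != W) && (u W G != 0))) => [/andP[/andP[GX GW] uG]|_]; last by exists E.
  have [|A hA] := IH G _ GX; last by exists A.
  by case: (u_rank WX GX uG) => [GE|lt]; [rewrite GE eqxx in GW | rewrite (leq_trans lt) // -ltnS].
have [B hB] := choice ex.
pose A H := E W * u W H - \sum_(G <- X | (G != W) && (u W G != 0)) u W G * B G H.
exists A; split.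
- have mE : m W = e W - \sum_(G <- X | (G != W) && (u W G != 0)) kap (u W G) *: m G.
    rewrite eE // (bigD1_seq W) //= uWW // rmorph1 scale1r -addrA.
    rewrite [X in _ + (X - _)](bigID (fun G => u W G != 0)) /= addrAC subrr add0r.
    by rewrite big1 ?addr0 // => G /andP[_]; rewrite negbK => /eqP->; rewrite rmorph0 scale0r.
  have -> : \sum_(G <- X) kap (A G) *: m G = kap (E W) *: e W -
      \sum_(G <- X | (G != W) && (u W G != 0)) kap (u W G) *: (\sum_(H <- X) kap (B G H) *: m H).
    rewrite eE // scaler_sumr; under [X in _ = _ - X]eq_bigr do rewrite scaler_sumr.
    rewrite exchange_big -sumrB; apply: eq_bigr => H _ /=.
    rewrite /A rmorphB rmorphM scalerBl scalerA; congr (_ - _).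
    by rewrite rmorph_sum scaler_suml; apply: eq_bigr => G _; rewrite rmorphM scalerA.
  rewrite mE -scaleN1r [X in Rel _ X]addrC -[X in Rel _ (X + _)]scaleN1r addrC; apply: Rel_lin; last exact: RelE.
  apply: Rel_sum => G GX /andP[GW uG]; have [] := hB G; first by rewrite GX GW uG.
  by [].
- rewrite /A uWW // mulr1 big_seq_cond big1 ?subr0 // => G /andP[GX /andP[GW uG]].
  have [|_ _ h] := hB G; first by rewrite GX GW uG.
  have [->|/(h W WX)[WG|lt]] := eqVneq (B G W) 0; first by rewrite mulr0.
    by rewrite WG eqxx in GW.
  case: (u_rank WX GX uG) => [GE|lt']; first by rewrite GE eqxx in GW.
  by have := ltn_trans lt lt'; rewrite ltnn.
move=> H HX; rewrite /A.
have [z|uH] := eqVneq (u W H) 0; last by move=> _; exact: u_rank.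
rewrite z mulr0 sub0r oppr_eq0 => nz.
have : has (fun G => [&& G != W, u W G != 0 & B G H != 0]) X.
  apply: contraNT nz => /hasPn h; rewrite big_seq_cond big1 // => G /andP[GX /andP[GW uG]].
  by have := h G GX; rewrite GW uG /= negbK => /eqP->; rewrite mulr0.
case/hasP => G GX /and3P[GW uG BG]; right.
case: (u_rank WX GX uG) => [GE|lt']; first by rewrite GE eqxx in GW.
have [|_ _ h] := hB G; first by rewrite GX GW uG.
by case: (h H HX BG) => [->|lt] //; exact: ltn_trans lt lt'.
Qed.
End Triangular.

(** * The recursion on the coefficients *)

Section Recursion.
Variables (I : choiceType) (X : seq I) (rank : I -> nat) (K : fieldType) (kap : {rmorphism rat -> K}).
Hypothesis uX : uniq X.

Definition eig_eq (a : I -> rat) (A : I -> I -> rat) (s t eta : K) (c : I -> K) :=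
  forall G, G \in X -> s * kap (a G) * c G + t * \sum_(W <- X) c W * kap (A W G) = eta * c G.

Definition tri_mat (E : I -> rat) (A : I -> I -> rat) :=
  (forall W, W \in X -> A W W = E W) /\
  (forall W G, W \in X -> G \in X -> A W G != 0 -> G = W \/ (rank G < rank W)%N).

(** The equation at L identifies the eigenvalue as s a_L + t E_L, since no other index contributes
    there by triangularity. Substituted into the equation at G, it isolates c G. *)
Lemma recursion a E A s t eta c L : tri_mat E A -> eig_eq a A s t eta c ->
  L \in X -> c L = 1 -> (forall W, W \in X -> c W != 0 -> W = L \/ (rank W < rank L)%N) ->
  forall G, G \in X -> (s * (kap (a L) - kap (a G)) + t * (kap (E L) - kap (E G))) * c G =
    t * \sum_(W <- X | W != G) c W * kap (A W G).
Proof.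
move=> [AE Ar] h LX cL cr G GX.
have hL := h L LX; rewrite (bigD1_seq L) //= cL AE // !mulr1 mul1r in hL.
rewrite big_seq_cond big1 ?addr0 in hL; last first.
  move=> W /andP[WX WL]; have [->|/(cr W WX)[WE|lt]] := eqVneq (c W) 0; first by rewrite mul0r.
    by rewrite WE eqxx in WL.
  have [->|/(Ar W L WX LX)[LW|lt']] := eqVneq (A W L) 0; first by rewrite rmorph0 mulr0.
    by rewrite LW eqxx in WL.
  by have := ltn_trans lt lt'; rewrite ltnn.
have hG := h G GX; rewrite (bigD1_seq G) //= AE // -hL in hG.
set Z := \sum_(W <- X | W != G) _ in hG *.
have -> : t * Z = (s * kap (a G) * c G + t * (c G * kap (E G) + Z)) - s * kap (a G) * c G - t * (c G * kap (E G)).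
  by ring.
by rewrite hG; ring.
Qed.
End Recursion.

(** * Specialisation of solutions of the recursion *)

Section Places.
Variables (K : fieldType) (kap : {rmorphism rat -> K}) (rel : K -> rat -> Prop).

(** A partially defined specialisation of K to the rationals, such as a value or a limit in beta. By
    [place0], an element with a nonzero value is itself nonzero. *)
Record place : Prop := Place {
  place_const : forall q, rel (kap q) q;
  place_add : forall x v y w, rel x v -> rel y w -> rel (x + y) (v + w);
  place_mul : forall x v y w, rel x v -> rel y w -> rel (x * y) (v * w);
  place_div : forall x v y w, rel x v -> rel y w -> w != 0 -> rel (x / y) (v / w);
  place0 : forall v, rel 0 v -> v = 0 }.

Variables (I : choiceType) (X : seq I) (rank : I -> nat).
Hypothesis (uX : uniq X) (hp : place).

Lemma place_sum (r : seq I) (Q : pred I) (f : I -> K) (g : I -> rat) :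
  (forall W, W \in r -> Q W -> rel (f W) (g W)) ->
  rel (\sum_(W <- r | Q W) f W) (\sum_(W <- r | Q W) g W).
Proof.
have z : rel 0 0 by rewrite -(rmorph0 kap); exact: place_const hp _.
elim: r => [|W r IH] h; first by rewrite !big_nil.
rewrite !big_cons; case: ifP => QW.
  apply: (place_add hp); first by apply: h => //; rewrite inE eqxx.
  by apply: IH => W' W'r; apply: h; rewrite inE W'r orbT.
by apply: IH => W' W'r; apply: h; rewrite inE W'r orbT.
Qed.

(** Downward induction on the rank, starting from L. At each index one divides by whichever of the
    two denominators has a nonzero value. *)
Lemma place_eigen (a E a' E' : I -> rat) (A A' : I -> I -> rat) (s t eta eta' : K) (s0 t0 eta0 eta0' : rat)
    (c : I -> K) (g : I -> rat) (L : I) :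
  tri_mat X rank E A -> tri_mat X rank E' A' ->
  eig_eq X kap a A s t eta c -> eig_eq X kap a' A' s t eta' c ->
  eig_eq X idfun a A s0 t0 eta0 g -> eig_eq X idfun a' A' s0 t0 eta0' g ->
  rel s s0 -> rel t t0 -> L \in X -> c L = 1 -> g L = 1 ->
  (forall W, W \in X -> c W != 0 -> W = L \/ (rank W < rank L)%N) ->
  (forall W, W \in X -> g W != 0 -> W = L \/ (rank W < rank L)%N) ->
  (forall W, W \in X -> W != L -> (c W != 0) || (g W != 0) ->
     (s0 * (a L - a W) + t0 * (E L - E W) != 0) || (s0 * (a' L - a' W) + t0 * (E' L - E' W) != 0)) ->
  forall G, G \in X -> rel (c G) (g G).
Proof.
move=> tA tA' ec ec' eg eg' rs rt LX cL gL cr gr sep G.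
have z : rel 0 0 by rewrite -(rmorph0 kap); exact: place_const hp _.
have o : rel 1 1 by rewrite -(rmorph1 kap); exact: place_const hp _.
(* A crude bound on all ranks, so that B minus the rank can serve as induction measure. *)
pose B := (\sum_(W <- X) rank W)%N.
have rB W : W \in X -> (rank W <= B)%N by move=> WX; rewrite /B (bigD1_seq W) //= leq_addr.
have sub x v y w : rel x v -> rel y w -> rel (x - y) (v - w).
  move=> h1 h3; have := place_mul hp (place_const hp (-1)) h3.
  by rewrite rmorphN1 !mulN1r => h4; exact: place_add hp _ _ _ _ h1 h4.
(* In each of the pairs [th] and [th0] one component is an eigenvalue, of c or of g; the other is a
   dummy. *)
have step (b F : I -> rat) (D : I -> I -> rat) (th th0 : K * rat) H :
    tri_mat X rank F D -> eig_eq X kap b D s t th.1 c -> eig_eq X idfun b D s0 t0 th0.2 g ->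
    H \in X -> s0 * (b L - b H) + t0 * (F L - F H) != 0 ->
    (forall W, W \in X -> (rank H < rank W)%N -> rel (c W) (g W)) -> rel (c H) (g H).
  move=> tD e1 e2 HX nz ih.
  have r1 := recursion uX tD e1 LX cL cr HX.
  have r2 := recursion uX tD e2 LX gL gr HX; rewrite /= in r2.
  set d := s * _ + _ in r1; set d0 := s0 * _ + _ in r2 nz.
  have rd : rel d d0.
    by apply: (place_add hp); apply: (place_mul hp) => //; rewrite -!rmorphB; exact: place_const hp _.
  (* A denominator with nonzero value is nonzero in K, so both recursions can be solved for their
     coefficient at H. *)
  have dn : d != 0.
    by apply: contra nz => /eqP d_0; move: rd; rewrite d_0 => /(place0 hp)->.
  rewrite -[c H](mulKf dn) r1 -[g H](mulKf nz) r2 mulrC [_^-1 * _]mulrC.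
  apply: (place_div hp) => //; apply: (place_mul hp) => //; apply: place_sum => W WX WH.
  have [->|nD] := eqVneq (D W H) 0; first by rewrite rmorph0 !mulr0.
  apply: (place_mul hp); last exact: place_const hp _.
  by apply: ih => //; case: tD => _ /(_ W H WX HX nD)[HW|//]; rewrite HW eqxx in WH.
have [n] := ubnP (B - rank G)%N; elim: n G => // n IH G le GX.
have [->|GL] := eqVneq G L; first by rewrite cL gL.
have [cg|] := boolP ((c G != 0) || (g G != 0)); last first.
  by rewrite negb_or !negbK => /andP[/eqP-> /eqP->].
have ih W : W \in X -> (rank G < rank W)%N -> rel (c W) (g W).
  by move=> WX lt; apply: IH => //; have := rB W WX; have := rB G GX; lia.
case/orP: (sep G GX GL cg) => nz.
  exact: (step a E A (eta, 0) (0, eta0)).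
exact: (step a' E' A' (eta', 0) (0, eta0')).
Qed.
End Places.

(** * Values and limits of rational functions of beta *)

Import numFieldNormedType.Exports.
Definition ratQ : {rmorphism rat -> Qbeta} := ((@tofrac {poly rat}) \o polyC).

Lemma place_value b : place ratQ (coef_value b).
Proof.
split.
- move=> q; exists q%:P, 1; rewrite !hornerE oner_neq0; split=> //.
  by rewrite tofrac1 divr1.
- move=> x v y w [p [q [q0 -> ->]]] [p' [q' [q0' -> ->]]].
  have nq : q != 0 by apply: contraNneq q0 => ->; rewrite horner0.
  have nq' : q' != 0 by apply: contraNneq q0' => ->; rewrite horner0.
  exists (p * q' + p' * q), (q * q'); rewrite hornerM mulf_neq0 //; split=> //.
    by rewrite addf_div ?tofrac_eq0 // tofracD !tofracM.
  by rewrite addf_div // hornerD !hornerM.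
- move=> x v y w [p [q [q0 -> ->]]] [p' [q' [q0' -> ->]]].
  exists (p * p'), (q * q'); rewrite hornerM mulf_neq0 //; split=> //.
    by rewrite mulf_div !tofracM.
  by rewrite mulf_div !hornerM.
- move=> x v y w [p [q [q0 -> ->]]] [p' [q' [q0' -> ->]]] nz.
  have p0' : p'.[b] != 0 by apply: contraNneq nz => ->; rewrite mul0r.
  exists (p * q'), (q * p'); rewrite hornerM mulf_neq0 //; split=> //.
    by rewrite invf_div mulf_div !tofracM.
  by rewrite invf_div mulf_div !hornerM.
move=> v [p [q [q0 /esym/eqP h ->]]].
have nq : q != 0 by apply: contraNneq q0 => ->; rewrite horner0.
rewrite mulf_eq0 invr_eq0 !tofrac_eq0 (negbTE nq) orbF in h.
by rewrite (eqP h) horner0 mul0r.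
Qed.

Lemma value_beta b : coef_value b beta b.
Proof. by exists 'X, 1; rewrite !hornerE oner_neq0 tofrac1 !divr1. Qed.

Section Limits.
Variables (R : realType) (F : set_system R).
Context {FF : ProperFilter F}.
Hypothesis Fneq : forall r : R, (\forall b \near F, b != r)%classic.

(** Induction on the degree: a polynomial without root vanishes nowhere, and otherwise a factor X -
    r splits off, whose zero the filter avoids. *)
Lemma near_horner_neq0 (p : {poly R}) : p != 0 -> (\forall b \near F, p.[b] != 0)%classic.
Proof.
have [n] := ubnP (size p); elim: n p => // n IH p sp p0.
have [[r /factor_theorem[q pE]]|nr] := pselect (exists r, root p r); last first.
  by apply: nearW => b; apply/negP => /rootP h; apply: nr; exists b; apply/rootP.
have q0 : q != 0 by apply: contraNneq p0 => q0; rewrite pE q0 mul0r.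
have sq : (size q < n)%N.
  by move: sp; rewrite pE size_Mmonic ?monicXsubC // size_XsubC addn2.
have h := IH q sq q0; have h' := Fneq r.
near=> b; rewrite pE hornerM hornerXsubC mulf_neq0 //; first by near: b.
by rewrite subr_eq0; near: b.
Unshelve. all: by end_near. Qed.

Lemma eval_realM p q (b : R) : eval_real (p * q) b = eval_real p b * eval_real q b.
Proof. by rewrite /eval_real rmorphM hornerM. Qed.

Lemma eval_realD p q (b : R) : eval_real (p + q) b = eval_real p b + eval_real q b.
Proof. by rewrite /eval_real rmorphD hornerD. Qed.

Lemma near_eval_neq0 q : q != 0 -> (\forall b \near F, eval_real q b != 0 :> R)%classic.
Proof. by move=> q0; apply: near_horner_neq0; rewrite map_poly_eq0. Qed.

(** Identities between fractions hold off the zeros of the denominators, hence eventually along F. A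
    nonzero limit forces a nonzero numerator because limits are unique. *)
Lemma place_cvg : place ratQ (@coef_cvg R F).
Proof.
split.
- move=> q; exists q%:P, 1; rewrite oner_neq0; split=> //.
    by rewrite tofrac1 divr1.
  rewrite (_ : (fun b => _) = fun=> ratr q); first exact: cvg_cst.
  by apply/funext => b; rewrite /eval_real rmorph1 map_polyC !hornerE divr1.
- move=> x v y w [p [q [q0 -> hp]]] [p' [q' [q0' -> hp']]].
  exists (p * q' + p' * q), (q * q'); rewrite mulf_neq0 //; split=> //.
    by rewrite addf_div ?tofrac_eq0 // tofracD !tofracM.
  rewrite rmorphD; apply: cvg_trans (cvgD hp hp'); apply: near_eq_cvg.
  have h := near_eval_neq0 q0; have h' := near_eval_neq0 q0'.
  near=> b; have qb : eval_real q b != 0 :> R by near: b.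
  have qb' : eval_real q' b != 0 :> R by near: b.
  by rewrite eval_realD !eval_realM -addf_div.
- move=> x v y w [p [q [q0 -> hp]]] [p' [q' [q0' -> hp']]].
  exists (p * p'), (q * q'); rewrite mulf_neq0 //; split=> //.
    by rewrite mulf_div !tofracM.
  rewrite rmorphM; apply: cvg_trans (cvgM hp hp'); apply: near_eq_cvg; near=> b.
  by rewrite !eval_realM -mulf_div.
- move=> x v y w [p [q [q0 -> hp]]] [p' [q' [q0' -> hp']]] nz.
  have p0' : p' != 0.
    apply: contraNneq nz => p0'; rewrite p0' in hp'.
    have h0 : ((fun b : R => eval_real 0 b / eval_real q' b) @ F --> (0 : R))%classic.
      rewrite (_ : (fun b => _) = fun=> 0); first exact: cvg_cst.
      by apply/funext => b; rewrite /eval_real rmorph0 horner0 mul0r.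
    have E : ratr w = 0 :> R := cvg_unique (@norm_hausdorff _ _) hp' h0.
    by apply/eqP/(fmorph_inj (ratr : {rmorphism rat -> R})); rewrite /= E rmorph0.
  exists (p * q'), (q * p'); rewrite mulf_neq0 //; split=> //.
    by rewrite invf_div mulf_div !tofracM.
  rewrite rmorphM fmorphV.
  have nz' : (ratr w : R) != 0 by rewrite fmorph_eq0.
  apply: cvg_trans (cvgM hp (cvgV nz' hp')); apply: near_eq_cvg; near=> b.
  by rewrite !eval_realM -mulf_div -[X in _ = _ * X]invf_div.
move=> v [p [q [q0 /esym/eqP h hv]]].
rewrite mulf_eq0 invr_eq0 !tofrac_eq0 (negbTE q0) orbF in h.
have h0 : ((fun b : R => eval_real p b / eval_real q b) @ F --> (0 : R))%classic.
  rewrite (_ : (fun b => _) = fun=> 0); first exact: cvg_cst.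
  by apply/funext => b; rewrite /eval_real (eqP h) rmorph0 horner0 mul0r.
have E : ratr v = 0 :> R := cvg_unique (@norm_hausdorff _ _) hv h0.
by apply/(fmorph_inj (ratr : {rmorphism rat -> R})); rewrite /= E rmorph0.
Unshelve. all: by end_near. Qed.
End Limits.

Section ThreeLimits.
Variable R : realType.

Lemma place_cvg0 : place ratQ (@coef_cvg R (0^')%classic).
Proof.
apply: place_cvg => r; have [->|r0] := eqVneq r 0; first exact: nbhs_dnbhs_neq.
have r1 : 0 < `|r| by rewrite normr_gt0.
near=> b; have hb : `|b| < `|r| by near: b; exact: dnbhs0_lt.
by apply: contraTneq hb => ->; rewrite ltxx.
Unshelve. all: by end_near. Qed.

Lemma cvg0_beta : @coef_cvg R (0^')%classic beta 0.
Proof.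
exists 'X, 1; rewrite oner_neq0 tofrac1 divr1; split=> //.
rewrite (_ : (fun b => _) = id); last first.
  by apply/funext => b; rewrite /eval_real map_polyX rmorph1 !hornerE divr1.
by rewrite rmorph0 => P hP; exact: nbhs_dnbhs.
Qed.

Lemma place_cvgpy : place ratQ (@coef_cvg R (+oo)%classic).
Proof. by apply: place_cvg => r; near=> b; rewrite gt_eqF //; near: b; apply: nbhs_pinfty_gt; exact: num_real. Unshelve. all: by end_near. Qed.

Lemma place_cvgny : place ratQ (@coef_cvg R (-oo)%classic).
Proof. by apply: place_cvg => r; near=> b; rewrite lt_eqF //; near: b; apply: nbhs_ninfty_lt; exact: num_real. Unshelve. all: by end_near. Qed.

Lemma coef_cvg_inv (F : set_system R) {FF : ProperFilter F} :
  (forall e : R, 0 < e -> \forall b \near F, `|b^-1| < e)%classic -> @coef_cvg R F beta^-1 0.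
Proof.
move=> h; exists 1, 'X; rewrite polyX_eq0 tofrac1 div1r; split=> //.
rewrite (_ : (fun b => _) = (fun b => b^-1)); last first.
  by apply/funext => b; rewrite /eval_real map_polyX rmorph1 !hornerE ?div1r.
rewrite rmorph0; apply/cvgrPdist_lt => e e0; have := h e e0.
by apply: filterS => b; rewrite sub0r normrN.
Qed.

Lemma cvgpy_beta : @coef_cvg R (+oo)%classic beta^-1 0.
Proof.
apply: coef_cvg_inv => e e0; near=> b.
have b0 : e^-1 < b by near: b; apply: nbhs_pinfty_gt; exact: num_real.
have bp : 0 < b by apply: lt_trans b0; rewrite invr_gt0.
by rewrite gtr0_norm ?invr_gt0 // invf_plt ?posrE.
Unshelve. all: by end_near. Qed.

Lemma cvgny_beta : @coef_cvg R (-oo)%classic beta^-1 0.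
Proof.
apply: coef_cvg_inv => e e0; near=> b.
have b0 : b < - e^-1 by near: b; apply: nbhs_ninfty_lt; exact: num_real.
have bp : b < 0 by apply: lt_trans b0 _; rewrite oppr_lt0 invr_gt0.
by rewrite ltr0_norm ?invr_lt0 // -invrN invf_plt ?posrE ?oppr_gt0 // ltrNr.
Unshelve. all: by end_near. Qed.
End ThreeLimits.

(** * The common eigenvectors *)
Section SpartEnum.
Variables d m : nat.

Fixpoint all_seqs l : seq (seq nat) :=
  if l is l'.+1 then [seq x :: s | x <- iota 0 d.+1, s <- all_seqs l'] else [:: [::]].

Lemma mem_all_seqs s : {in s, forall x, x <= d}%N -> s \in all_seqs (size s).
Proof.
elim: s => [|x s IH] h //.
change (x :: s \in [seq y :: u | y <- iota 0 d.+1, u <- all_seqs (size s)]).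
apply/allpairsP; exists (x, s); split=> //.
  by rewrite mem_iota add0n ltnS h // inE eqxx.
by apply: IH => y ys; apply: h; rewrite inE ys orbT.
Qed.

(** The candidates need only be exhaustive, as the filter does the rest: m fermionic entries at most
    d, and at most d nonzero bosonic entries, each at most d. *)
Definition spart_enum : seq spart :=
  undup [seq L <- pmap insub [seq (a, b) | a <- all_seqs m, b <- flatten [seq all_seqs l | l <- iota 0 d.+1]]
    | (tdeg L == d) && (fdeg L == m)].

Lemma size_ssym_le (L : spart) : (size (ssym L) <= sumn (ssym L))%N.
Proof.
have := ssym_n0 L; elim: (ssym L) => //= x s IH; rewrite inE negb_or => /andP[x0 /IH h].
by case: x x0 => // x _; rewrite addSn ltnS (leq_trans h) // leq_addl.
Qed.

Lemma mem_spart_enum (L : spart) : (L \in spart_enum) = (tdeg L == d) && (fdeg L == m).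
Proof.
rewrite mem_undup mem_filter andb_idr // => /andP[/eqP td /eqP fm].
rewrite mem_pmap; apply/mapP; exists (spval L); last by rewrite valK.
apply/allpairsP; exists (asym L, ssym L); split; last by rewrite /asym /ssym -surjective_pairing.
  by rewrite [_.1]/= -fm; apply: mem_all_seqs => x /asym_le; rewrite td.
have sd : (sumn (ssym L) <= d)%N by rewrite -td leq_addl.
rewrite [_.2]/=; apply/flattenP; exists (all_seqs (size (ssym L))).
  by apply: map_f; rewrite mem_iota add0n ltnS (leq_trans (size_ssym_le L)).
by apply: mem_all_seqs => x /mem_leq_sumn h; exact: leq_trans h sd.
Qed.

Lemma spart_enum_uniq : uniq spart_enum.
Proof. exact: undup_uniq. Qed.

Lemma spart_enum_splen (L : spart) : L \in spart_enum -> (splen L <= d + m)%N.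
Proof.
rewrite mem_spart_enum => /andP[/eqP<- /eqP<-]; rewrite /splen addnC leq_add2r.
by rewrite (leq_trans (size_ssym_le L)) // leq_addl.
Qed.
End SpartEnum.

Lemma nosign_rat : nosign_char rat.
Proof. by move=> x /eqP; rewrite -subr_eq0 opprK -mulr2n mulrn_eq0 => /eqP. Qed.

Lemma nosign_Qbeta : nosign_char Qbeta.
Proof.
move=> x /eqP; rewrite -subr_eq0 opprK -mulr2n -mulr_natr mulf_eq0 -tofrac1 -tofracMn tofrac_eq0.
by rewrite -polyC1 -polyCMn polyC_eq0 pnatr_eq0 orbF => /eqP.
Qed.

(** * Change of base field *)

Section MapCoef.
Variables (n : nat) (k k' : fieldType) (phi : {rmorphism k -> k'}).

Definition mapP : {rmorphism polyx n k -> polyx n k'} := map_mpoly phi.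

Lemma mcoeff_mapP c p : mcoeff c (mapP p) = phi (mcoeff c p).
Proof. exact: mcoeff_map_mpoly. Qed.

Lemma bos_map A d f g : is_bos (k := k) A d f -> is_bos A d g -> gmap mapP f = g.
Proof.
move=> hf hg; apply: superP => S c; rewrite ffunE mcoeff_mapP hf hg rmorphM rmorph_nat rmorph_prod.
by congr (_ * _); apply: eq_bigr => i _; rewrite rmorph_nat.
Qed.

Lemma ferm_map A G d f g : is_ferm (k := k) A G d f -> is_ferm A G d g -> gmap mapP f = g.
Proof.
move=> hf hg; apply: superP => S c; rewrite ffunE mcoeff_mapP hf hg rmorphM rmorph_nat rmorph_sum.
congr (_ * _); apply: eq_bigr => l _; rewrite rmorph_prod.
by apply: eq_bigr => i _; rewrite rmorph_nat.
Qed.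

Lemma gmap_eprod L : gmap mapP (eprod n k L) = eprod n k' L.
Proof.
have g1 : gmap mapP (gconst n 1) = gconst n 1 by rewrite gmap_const rmorph1.
rewrite /eprod gmapM; congr gmul.
  elim: (asym L) => [|d s IH]; rewrite ?big_nil ?g1 // !big_cons gmapM IH; congr gmul.
  exact: ferm_map (@etsuper_ferm n k d) (@etsuper_ferm n k' d).
elim: (ssym L) => [|d s IH]; rewrite ?big_nil ?g1 // !big_cons gmapM IH; congr gmul.
exact: bos_map (@esuper_bos n k d) (@esuper_bos n k' d).
Qed.

Lemma scoef_eprod_map L W : scoef W (eprod n k' L) = phi (scoef W (eprod n k L)).
Proof. by rewrite -gmap_eprod /scoef ffunE mcoeff_mapP. Qed.
End MapCoef.

(** * H0 and I0 on supermonomials *)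

Section ScoefEuler.
Variables (n : nat) (k : fieldType).
Implicit Types (f : super n (polyx n k)) (G L : spart).

Lemma scoef_geulsq f G : (splen G <= n)%N -> scoef G (geulsq f) = (sqparts G)%:R * scoef G f.
Proof.
move=> Gn; rewrite /scoef mcoeff_geulsq; congr (_%:R * _).
by rewrite (@sum_rep n G (fun x => x.2 ^ 2)%N) //= /sqparts big_cat.
Qed.

Lemma scoef_geulin f G : (splen G <= n)%N -> scoef G (geulin f) = (sumn (asym G))%:R * scoef G f.
Proof.
move=> Gn; rewrite /scoef mcoeff_geulin; congr (_%:R * _).
rewrite -sum_mem (@sum_rep n G (fun x => x.1 * x.2)%N) //= [X in (_ + X)%N]big1 // addn0 sumnE.
by apply: eq_bigr => v _; rewrite mul1n.
Qed.

Lemma msuper_skey_sum (H : bool * nat -> nat) L S c : mcoeff c (msuper n k L S) != 0 -> H (false, 0%N) = 0%N ->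
  (\sum_(i < n) H (i \in S, c i) = \sum_(v <- asym L) H (true, v) + \sum_(v <- ssym L) H (false, v))%N.
Proof.
move=> /mcoeff_msuper_neq0[Ln pe] H0; rewrite -(sum_rep Ln H0).
have E (T : {set 'I_n}) (c' : multinom n) :
    (\sum_(i < n) H (i \in T, c' i) = \sum_(x <- skey T c') H x)%N.
  by rewrite /skey /= big_map big_enum.
by rewrite !E; apply: perm_big.
Qed.

Lemma geulsq_msuper L : geulsq (msuper n k L) = (sqparts L)%:R *: msuper n k L.
Proof.
apply: superP => S c; rewrite mcoeff_geulsq gscalerE mcoeffZ.
have [->|nz] := eqVneq (mcoeff c (msuper n k L S)) 0; first by rewrite !mulr0.
congr (_%:R * _); rewrite (@msuper_skey_sum (fun x => x.2 ^ 2)%N L S c nz) //=.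
by rewrite /sqparts big_cat.
Qed.

Lemma geulin_msuper L : geulin (msuper n k L) = (sumn (asym L))%:R *: msuper n k L.
Proof.
apply: superP => S c; rewrite mcoeff_geulin gscalerE mcoeffZ.
have [->|nz] := eqVneq (mcoeff c (msuper n k L S)) 0; first by rewrite !mulr0.
congr (_%:R * _); rewrite -sum_mem (@msuper_skey_sum (fun x => x.1 * x.2)%N L S c nz) //=.
rewrite [X in (_ + X)%N]big1 // addn0 sumnE.
by apply: eq_bigr => v _; rewrite mul1n.
Qed.
End ScoefEuler.

Lemma fdeg_spconj L : fdeg (spconj L) = fdeg L.
Proof. by rewrite /fdeg size_map size_rev. Qed.

Lemma sum_parts_spconj L : (\sum_(v <- parts (spconj L)) v = tdeg L)%N.
Proof.
rewrite parts_spconj big_map (@sum_circ_cols L (colht L) (tdeg L).+1) => [|v /parts_le //|//].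
rewrite -[RHS]tail_parts0 -(@sum_colht_tail L 0 (tdeg L).+1) //.
by move=> v /parts_le/leqW.
Qed.

Lemma scoef_eig (n : nat) (k : fieldType) (X : seq spart) (f h : super n (polyx n k))
    (s t eta : k) (B : spart -> spart -> k) (c : spart -> k) (G : spart) (b : k) :
  uniq X -> (splen G <= n)%N -> G \in X -> scoef G f = c G -> scoef G h = b * c G ->
  s *: h + t *: (\sum_(W <- X) c W *: (\sum_(G' <- X) B W G' *: msuper n k G')) = eta *: f ->
  s * b * c G + t * \sum_(W <- X) c W * B W G = eta * c G.
Proof.
move=> uX Gn GX fc hb /(congr1 (@scoef n k G)); rewrite scoefZ fc => <-.
have -> (f1 f2 : super n (polyx n k)) : scoef G (f1 + f2) = scoef G f1 + scoef G f2.
  by rewrite /scoef gaddE mcoeffD.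
rewrite !scoefZ hb mulrA scoef_sum; congr (_ + _ * _).
apply: eq_bigr => W _; rewrite scoefZ scoef_sum (bigD1_seq G) //=.
rewrite scoefZ scoef_msuper // eqxx mulr1 big1 ?addr0 // => G' /negbTE GG'.
by rewrite scoefZ scoef_msuper // GG' mulr0.
Qed.

(** * Matrices of H1 and I1 on the supermonomials *)

Section Expansion.
Variables (n d m : nat).
Hypothesis dmn : (d + m <= n)%N.
Notation K := Qbeta.
Notation X := (spart_enum d m).
Notation P := (polyx n K).
Notation F := {fraction P}.
Notation iota := (@gmap n _ _ (tofracr n K)).
Local Notation scoef := (@scoef n _).
Implicit Types (f g : super n P) (W G L : spart).

Let Xsplen W : W \in X -> (splen W <= n)%N.
Proof. by move=> /spart_enum_splen h; exact: leq_trans h dmn. Qed.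

Lemma iota_inj : injective iota.
Proof.
move=> f g h; apply/ffunP => S; have := congr1 (fun e : super n F => e S) h.
by rewrite ![gmap _ _ _]ffunE /= => /eqP; rewrite tofrac_eq => /eqP.
Qed.

Lemma sym_expansion f (c : spart -> K) : symmetric_super f ->
  (forall G, (splen G <= n)%N -> scoef G f = if G \in X then c G else 0) ->
  f = \sum_(G <- X) c G *: msuper n K G.
Proof.
move=> fs fc; apply/eqP; rewrite -subr_eq0; apply/eqP; apply: (symmetric_ext nosign_Qbeta).
  rewrite -scaleN1r; apply: symmetricD => //; apply: symmetricZ; apply: symmetric_sum => G _.
  by apply: symmetricZ; exact: msuper_symmetric.
move=> G Gn; rewrite scoefB fc // scoef_sum.
under eq_bigr do rewrite scoefZ scoef_msuper //.
case: ifP => GX; last first.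
  rewrite big_seq big1 ?subrr // => W WX; case: eqP => [WG|]; last by rewrite mulr0.
  by rewrite -WG WX in GX.
rewrite (bigD1_seq G) ?spart_enum_uniq //= eqxx mulr1 big1 ?addr0 ?subrr // => W /negbTE->.
by rewrite mulr0.
Qed.

Definition ecoef W G : rat := scoef G (reversal (fdeg W) (eprod n rat (spconj W))).

Lemma ecoef_self W : W \in X -> ecoef W W = 1.
Proof.
move=> WX; rewrite /ecoef /reversal scoefZ scoef_eprod_conj ?Xsplen // bin2 -exprD addnn.
by rewrite -mul2n exprM sqrrN expr1n.
Qed.

Lemma ecoef_lep W G : (splen G <= n)%N -> ecoef W G != 0 -> lep G W.
Proof.
move=> Gn; rewrite /ecoef /reversal scoefZ mulf_eq0 negb_or => /andP[_]; exact: eprod_lep.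
Qed.

Definition erev W : super n P := reversal (fdeg W) (eprod n K (spconj W)).

Lemma scoef_erev W G : scoef G (erev W) = ratQ (ecoef W G).
Proof.
rewrite /erev /ecoef /reversal !scoefZ rmorphM rmorph_sign; congr (_ * _).
exact: scoef_eprod_map.
Qed.

Lemma erev_symmetric W : symmetric_super (erev W).
Proof. by apply: symmetricZ; exact: eprod_symmetric. Qed.

Lemma erev_expansion W : W \in X -> erev W = \sum_(G <- X) ratQ (ecoef W G) *: msuper n K G.
Proof.
move=> WX; apply: sym_expansion (erev_symmetric W) _ => G Gn; rewrite scoef_erev.
case: ifP => // GX; have [->|/(ecoef_lep Gn)[hf ht _ _]] := eqVneq (ecoef W G) 0; first by rewrite rmorph0.
by move: GX WX; rewrite !mem_spart_enum hf ht => ->.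
Qed.

Definition oprel (D : super n P -> super n F) f g := D f = iota g.

Definition op_linear (D : super n P -> super n F) :=
  (forall f g, D (f + g) = D f + D g) /\ (forall (a : K) f, D (a *: f) = gscale (fconst n a) (D f)).

Lemma H1_linear : op_linear (@H1 n K).
Proof. by split; [exact: H1D | exact: H1Z]. Qed.

Lemma I1_linear : op_linear (@I1 n K).
Proof. by split; [exact: I1D | exact: I1Z]. Qed.

Lemma oprel_lin D (a : K) f g f' g' : op_linear D -> oprel D f g -> oprel D f' g' ->
  oprel D (a *: f + f') (a *: g + g').
Proof.
by move=> [hD hZ] h h'; rewrite /oprel hD hZ h h' gscale_iota gmapD.
Qed.

Lemma oprel0 D : op_linear D -> oprel D 0 0.
Proof.
move=> [hD hZ]; have := hZ 0 0; rewrite scaler0 /oprel => ->.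
apply/ffunP => S; rewrite ffunE [RHS]ffunE.
have -> : fconst n (0 : K) = 0 by rewrite /fconst mpolyC0 tofrac0.
have -> : (0 : super n P) S = 0 by rewrite ffunE.
by rewrite mul0r rmorph0.
Qed.

Definition op_matrix D (A : spart -> spart -> rat) := forall W, W \in X ->
  oprel D (msuper n K W) (\sum_(G <- X) ratQ (A W G) *: msuper n K G).

(** Inverts the unitriangular expansion of the eigenvectors [erev W]. Their coefficients and
    eigenvalues are rational, hence so is the matrix, although D acts over Q(beta). *)
Lemma op_matrix_exists D (E : spart -> rat) : op_linear D ->
  (forall W, W \in X -> oprel D (erev W) (ratQ (E W) *: erev W)) ->
  exists A, op_matrix D A /\ tri_mat X sprank E A.
Proof.
move=> lD hE.
have ex W : exists A, W \in X ->
    tri_row X sprank ratQ (fun G => msuper n K G) E (oprel D) W A.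
  case: (boolP (W \in X)) => [WX|_]; last by exists E.
  have [|||||| A hA] := @triangular_row _ X sprank K ratQ (spart_enum_uniq d m) _ (fun G => msuper n K G)
    erev ecoef E (oprel D) _ _ _ _ _ _ W WX; last by exists A.
  - by move=> a f g f' g'; exact: oprel_lin.
  - exact: oprel0.
  - exact: erev_expansion.
  - exact: ecoef_self.
  - move=> V G VX GX nz; have [->|GV] := eqVneq G V; [by left | right].
    by apply: lep_rank; [exact: ecoef_lep (Xsplen GX) nz | exact/eqP].
  - exact: hE.
have [A hA] := choice ex; exists A; split; first by move=> W WX; case: (hA W WX).
split; first by move=> W WX; case: (hA W WX).
by move=> W G WX GX; case: (hA W WX) => _ _; apply.
Qed.

(** The equation holds between fractions; injectivity of [iota] brings it back to polynomials, where
    coefficients can be compared. *)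
Lemma op_eig_eq D H0 (a : spart -> rat) A s t eta f (c : spart -> K) : op_linear D -> op_matrix D A ->
  (forall G, (splen G <= n)%N -> scoef G (H0 f) = ratQ (a G) * scoef G f) ->
  symmetric_super f ->
  (forall G, (splen G <= n)%N -> scoef G f = if G \in X then c G else 0) ->
  gscale (fconst n s) (iota (H0 f)) + gscale (fconst n t) (D f) = iota (eta *: f) ->
  eig_eq X ratQ a A s t eta c.
Proof.
move=> lD hA h0 fs fc hop G GX.
have fE := sym_expansion fs fc.
have Df : D f = iota (\sum_(W <- X) c W *: (\sum_(G' <- X) ratQ (A W G') *: msuper n K G')).
  rewrite [in LHS]fE.
  apply: (@Rel_sum _ K _ (oprel D) _ (oprel0 lD) X predT c) => [a' h h' h1 h2|W WX _]; first exact: oprel_lin.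
  exact: hA.
move: hop; rewrite Df !gscale_iota -gmapD => /iota_inj hop.
have fG : scoef G f = c G by rewrite fc ?GX // Xsplen.
have hG : scoef G (H0 f) = ratQ (a G) * c G by rewrite h0 ?fG // Xsplen.
exact: (scoef_eig (spart_enum_uniq d m) (Xsplen GX) GX fG hG hop).
Qed.
End Expansion.

(** * Rescaled eigenvector equations *)

Section GenericScaling.
Variables (n : nat) (k : fieldType).
Notation P := (polyx n k).
Notation F := {fraction P}.
Notation iota := (@gmap n _ _ (tofracr n k)).
Implicit Types (f : super n P) (v : super n F).

Lemma eigen_scale v f (a e : k) : v = iota (e *: f) -> gscale (fconst n a) v = iota (e *: (a *: f)).
Proof. by move=> ->; rewrite gscale_iota !scalerA mulrC. Qed.

(** Applied with b = beta: the factor s = 1 keeps the pair (1, beta), and s = 1/beta turns it into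
    (1/beta, 1). *)
Lemma split_scale u v f (s b e : k) : iota u + gscale (fconst n b) v = iota (e *: f) ->
  gscale (fconst n s) (iota u) + gscale (fconst n (s * b)) v = iota ((s * e) *: f).
Proof.
move=> h; rewrite -scalerA -gscale_iota -h; apply/ffunP => S.
rewrite !gaddE ![gscale _ _ _]ffunE gaddE [gscale _ _ _]ffunE mulrDr; congr (_ + _).
by rewrite mulrA /fconst mpolyCM tofracM.
Qed.

Lemma split_left u v f (e : k) : u = e *: f ->
  gscale (fconst n 1) (iota u) + gscale (fconst n 0) v = iota (e *: f).
Proof.
move=> ->; rewrite gscale_iota scale1r; apply/ffunP => S; rewrite gaddE [gscale _ _ _]ffunE.
by rewrite /fconst mpolyC0 tofrac0 mul0r addr0.
Qed.

Lemma split_right u v f (e : k) : v = iota (e *: f) ->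
  gscale (fconst n 0) (iota u) + gscale (fconst n 1) v = iota (e *: f).
Proof.
move=> ->; rewrite !gscale_iota scale1r scale0r; apply/ffunP => S; rewrite gaddE.
by rewrite [X in X + _](_ : _ = 0) ?add0r // ffunE [X in tofracr _ _ X]ffunE rmorph0.
Qed.

Lemma split_both u v f (e : k) : v = iota (e *: f - u) ->
  gscale (fconst n 1) (iota u) + gscale (fconst n 1) v = iota (e *: f).
Proof. by move=> ->; rewrite !gscale_iota !scale1r -gmapD addrC subrK. Qed.
End GenericScaling.

(** Serves to treat the limits at both ends of the line as one specialisation, with a common family
    of limit coefficients. *)
Lemma place_and (K : fieldType) (kap : {rmorphism rat -> K}) (r1 r2 : K -> rat -> Prop) :
  place kap r1 -> place kap r2 -> place kap (fun z q => r1 z q /\ r2 z q).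
Proof.
move=> p1 p2; split.
- by move=> q; split; apply: place_const.
- by move=> x v y w [h1 h2] [h3 h4]; split; [exact: (place_add p1) | exact: (place_add p2)].
- by move=> x v y w [h1 h2] [h3 h4]; split; [exact: (place_mul p1) | exact: (place_mul p2)].
- by move=> x v y w [h1 h2] [h3 h4] w0; split; [exact: (place_div p1) | exact: (place_div p2)].
by move=> v [h1 _]; exact: (place0 p1).
Qed.

Lemma Eev_spconj n (k : fieldType) W :
  Eev n k (spconj W) = n%:R * (tdeg W)%:R - (sqparts (spconj W))%:R.
Proof.
rewrite -sum_parts_spconj /Eev /colev /sqparts !natr_sum big_distrr -sumrB.
by apply: eq_bigr => v _ /=; rewrite natrX; ring.
Qed.

Lemma rmorph_Eev n (k k' : fieldType) (phi : {rmorphism k -> k'}) W : phi (Eev n k W) = Eev n k' W.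
Proof.
by rewrite rmorph_sum; apply: eq_bigr => v _; rewrite rmorphM rmorphB !rmorph_nat.
Qed.

Lemma rmorph_Iev (k k' : fieldType) (phi : {rmorphism k -> k'}) W : phi (Iev k W) = Iev k' W.
Proof. by rewrite /Iev rmorphB rmorphN !rmorph_nat. Qed.

Section ErevEigen.
Variable n : nat.

Lemma erev_H1 W : oprel (@H1 n Qbeta) (erev n W) (ratQ (Eev n rat (spconj W)) *: erev n W).
Proof.
rewrite (rmorph_Eev n ratQ) /oprel.
have -> : H1 (erev n W) = gscale (fconst n ((-1) ^+ (fdeg W * (fdeg W).-1)./2)) (H1 (eprod n Qbeta (spconj W))).
  exact: H1Z.
apply: eigen_scale; exact: H1_eprod nosign_Qbeta _.
Qed.

Lemma erev_I1 W : oprel (@I1 n Qbeta) (erev n W) (ratQ (Iev rat (spconj W)) *: erev n W).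
Proof.
rewrite (rmorph_Iev ratQ) /oprel.
have -> : I1 (erev n W) = gscale (fconst n ((-1) ^+ (fdeg W * (fdeg W).-1)./2)) (I1 (eprod n Qbeta (spconj W))).
  exact: I1Z.
apply: eigen_scale; exact: I1_eprod.
Qed.
End ErevEigen.

Lemma lep_separated n (s t : rat) W L : 0 <= s -> 0 <= t -> 0 < s + t -> lep W L -> W != L ->
  (s * ((sqparts L)%:R - (sqparts W)%:R) + t * (Eev n rat (spconj L) - Eev n rat (spconj W)) != 0) ||
  (s * ((sumn (asym L))%:R - (sumn (asym W))%:R) + t * (Iev rat (spconj L) - Iev rat (spconj W)) != 0).
Proof.
move=> s0 t0 st h /eqP WL; have [hf ht _ _] := h.
have pos (x y : rat) : 0 < x -> 0 < y -> s * x + t * y != 0.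
  move=> x0 y0; rewrite gt_eqF //.
  have [s1|] := ltP 0 s; first by apply: ltr_pwDl; [exact: mulr_gt0 | exact: mulr_ge0 (ltW y0)].
  move=> s1; have s_0 : s = 0 by apply/le_anti/andP.
  by rewrite s_0 mul0r add0r mulr_gt0 //; move: st; rewrite s_0 add0r.
rewrite !Eev_spconj /Iev !fdeg_spconj hf ht.
have [[h1 h2]|[_ _ h1 h2]] := lep_sep h WL; apply/orP; [left | right]; apply: pos.
all: by move: h1 h2; rewrite -!(ltr_nat rat); lra.
Qed.

Lemma scoef_geulsq_map n (k : fieldType) (phi : {rmorphism rat -> k}) f G : (splen G <= n)%N ->
  scoef G (geulsq f) = phi (sqparts G)%:R * @scoef n k G f.
Proof. by move=> Gn; rewrite scoef_geulsq // rmorph_nat. Qed.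

Lemma scoef_geulin_map n (k : fieldType) (phi : {rmorphism rat -> k}) f G : (splen G <= n)%N ->
  scoef G (geulin f) = phi (sumn (asym G))%:R * @scoef n k G f.
Proof. by move=> Gn; rewrite scoef_geulin // rmorph_nat. Qed.

(** * Comparison of a Jack superpolynomial with a target *)

Section JackPlace.
Variables (N : nat) (c : spart -> {fsfun spart -> Qbeta with 0}).
Hypothesis hc : jack_basis N c.
Variable L : spart.
Hypothesis LN : (tdeg L + fdeg L <= N.+1)%N.
Notation X := (spart_enum (tdeg L) (fdeg L)).
Notation M := N.+1.
Notation iota := (@gmap M _ _ (tofracr M Qbeta)).

Let LX : L \in X.
Proof. by rewrite mem_spart_enum !eqxx. Qed.

Let LM : (splen L <= M)%N.
Proof. exact: leq_trans (spart_enum_splen LX) LN. Qed.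

Lemma jack_lep W : c L W != 0 -> W \in X /\ lep W L.
Proof.
have [_ /(_ L LM)[_ h _ _]] := hc; move=> /h[/sp_le_lep hl _]; split => //.
by case: hl => hf ht _ _; rewrite mem_spart_enum hf ht !eqxx.
Qed.

Lemma jack_coef_outside W : W \notin X -> c L W = 0.
Proof. by move=> WX; apply/eqP; apply: contraNT WX => /jack_lep[]. Qed.

Lemma jack_scoef G : (splen G <= M)%N ->
  scoef G (smon_comb M (c L)) = if G \in X then c L G else 0.
Proof.
by move=> GM; rewrite scoef_comb //; case: ifPn => // /jack_coef_outside.
Qed.

Lemma jack_eigen s : exists eta eta',
  gscale (fconst M s) (iota (geulsq (smon_comb M (c L)))) +
    gscale (fconst M (s * beta)) (H1 (smon_comb M (c L))) = iota (eta *: smon_comb M (c L)) /\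
  gscale (fconst M s) (iota (geulin (smon_comb M (c L)))) +
    gscale (fconst M (s * beta)) (I1 (smon_comb M (c L))) = iota (eta' *: smon_comb M (c L)).
Proof.
have [_ /(_ L LM)[_ _ [_ [e he]] [_ [e' he']]]] := hc.
rewrite Hop_split in he; rewrite Iop_split in he'; last exact: smon_comb_symmetric.
exists (s * e), (s * e'); split; apply: split_scale.
  by rewrite he; apply/ffunP => S; rewrite !ffunE.
by rewrite he'; apply/ffunP => S; rewrite !ffunE.
Qed.

(** The target appears twice: as the rational series T with coefficients g, and as f, the same
    combination over Q(beta) in the M variables where the operators act and the eigenvector
    equations are checked. *)
Lemma jack_place (rel : Qbeta -> rat -> Prop) s s0 t0 (T : sseries) (g : spart -> rat)
    (f : super M (polyx M Qbeta)) (eta eta' : rat) :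
  place ratQ rel -> rel s s0 -> rel (s * beta) t0 -> 0 <= s0 -> 0 <= t0 -> 0 < s0 + t0 ->
  (forall n, symmetric_super (T n)) ->
  (forall n G, (splen G <= n)%N -> scoef G (T n) = if G \in X then g G else 0) ->
  g L = 1 -> (forall G, G \in X -> g G != 0 -> lep G L) ->
  symmetric_super f ->
  (forall G, (splen G <= M)%N -> scoef G f = if G \in X then ratQ (g G) else 0) ->
  gscale (fconst M (ratQ s0)) (iota (geulsq f)) + gscale (fconst M (ratQ t0)) (H1 f) =
    iota (ratQ eta *: f) ->
  gscale (fconst M (ratQ s0)) (iota (geulin f)) + gscale (fconst M (ratQ t0)) (I1 f) =
    iota (ratQ eta' *: f) ->
  coefwise rel (c L) T.
Proof.
move=> hp rs rt s00 t00 st0 Ts Tg gL glep fs fg fH fI.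
have [A [hA tA]] := op_matrix_exists LN (@H1_linear M) (fun W _ => @erev_H1 M W).
have [A' [hA' tA']] := op_matrix_exists LN (@I1_linear M) (fun W _ => @erev_I1 M W).
have asq h G := @scoef_geulsq_map M Qbeta ratQ h G.
have ain h G := @scoef_geulin_map M Qbeta ratQ h G.
have [e [e' [cH cI]]] := jack_eigen s.
have js := @smon_comb_symmetric M Qbeta (c L).
have eH := op_eig_eq LN (@H1_linear M) hA (asq _) js jack_scoef cH.
have eI := op_eig_eq LN (@I1_linear M) hA' (ain _) js jack_scoef cI.
have gH := op_eig_eq LN (@H1_linear M) hA (asq _) fs fg fH.
have gI := op_eig_eq LN (@I1_linear M) hA' (ain _) fs fg fI.
(* [ratQ] is injective, so equations with rational entries descend from Q(beta) to the rationals. *)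
have pull (a : spart -> rat) B z : eig_eq X ratQ a B (ratQ s0) (ratQ t0) (ratQ z) (fun G => ratQ (g G)) ->
    eig_eq X idfun a B s0 t0 z g.
  move=> h G /h {}h; apply: (fmorph_inj ratQ); rewrite rmorphD !rmorphM -h; congr (_ + _ * _).
  by rewrite rmorph_sum; apply: eq_bigr => W _; rewrite rmorphM.
have rank W : lep W L -> W = L \/ (sprank W < sprank L)%N.
  by move=> h; have [->|/eqP ne] := eqVneq W L; [left | right; exact: lep_rank].
have key : forall G, G \in X -> rel (c L G) (g G).
  apply: (place_eigen (spart_enum_uniq _ _) hp tA tA' eH eI (pull _ _ _ gH) (pull _ _ _ gI) rs rt LX).
  - by have [_ /(_ L LM)[]] := hc.
  - exact: gL.
  - by move=> W _ /jack_lep[_ /rank].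
  - by move=> W WX /(glep W WX)/rank.
  move=> W WX WL nz; apply: lep_separated => //.
  by case/orP: nz => [/jack_lep[]|/(glep W WX)].
pose S := [fset W | W in X]%fset.
pose a := [fsfun W in S => g W | 0] : {fsfun spart -> rat with 0}.
have aE W : a W = if W \in X then g W else 0.
  by rewrite fsfunE inE.
exists a; split => [W|n].
  rewrite aE; case: ifPn => [/key //|/jack_coef_outside ->].
  by rewrite -(rmorph0 ratQ); exact: place_const hp _.
by apply: symmetric_comb nosign_rat (Ts n) _ => G Gn; rewrite aE Tg.
Qed.
End JackPlace.

(** * Eigenvector equations of the targets *)

Section Targets.
Variables (n : nat) (k : fieldType) (phi : {rmorphism rat -> k}).
Notation P := (polyx n k).
Notation F := {fraction P}.
Notation iota := (@gmap n _ _ (tofracr n k)).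
Implicit Types (f : super n P) (v : super n F) (G L : spart).

Lemma split_left_map u v f (e : rat) : u = phi e *: f ->
  gscale (fconst n (phi 1)) (iota u) + gscale (fconst n (phi 0)) v = iota (phi e *: f).
Proof. by rewrite rmorph1 rmorph0; exact: split_left. Qed.

Lemma split_right_map u v f (e : rat) : v = iota (phi e *: f) ->
  gscale (fconst n (phi 0)) (iota u) + gscale (fconst n (phi 1)) v = iota (phi e *: f).
Proof. by rewrite rmorph1 rmorph0; exact: split_right. Qed.

Lemma split_both_map u v f (e : rat) : v = iota (phi e *: f - u) ->
  gscale (fconst n (phi 1)) (iota u) + gscale (fconst n (phi 1)) v = iota (phi e *: f).
Proof. by rewrite rmorph1; exact: split_both. Qed.

Lemma geulsq_msuper_map L : geulsq (msuper n k L) = phi (sqparts L)%:R *: msuper n k L.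
Proof. by rewrite geulsq_msuper rmorph_nat. Qed.

Lemma geulin_msuper_map L : geulin (msuper n k L) = phi (sumn (asym L))%:R *: msuper n k L.
Proof. by rewrite geulin_msuper rmorph_nat. Qed.

Lemma scoef_msuper_map L G : (splen G <= n)%N ->
  scoef G (msuper n k L) =
    if G \in spart_enum (tdeg L) (fdeg L) then phi (L == G)%:R else 0.
Proof.
move=> Gn; rewrite scoef_msuper // rmorph_nat mem_spart_enum.
by have [->|_] := eqVneq L G; rewrite ?eqxx //; case: ifP.
Qed.

Lemma geulsqZ (a : k) f : geulsq (a *: f) = a *: geulsq f.
Proof. by apply: superP => S m; rewrite mcoeff_geulsq !gscalerE !mcoeffZ mcoeff_geulsq mulrCA. Qed.

Lemma geulinZ (a : k) f : geulin (a *: f) = a *: geulin f.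
Proof. by apply: superP => S m; rewrite mcoeff_geulin !gscalerE !mcoeffZ mcoeff_geulin mulrCA. Qed.

(** At s = 1 the formula for H1 contains - H0, so H0 + H1 is scalar on f. This is what singles out
    beta = 1 for h and htilde. *)
Lemma H1_structured_map d f (a : k) : structured 1 f -> homogeneous d f ->
  H1 (a *: f) = iota (phi ((n%:R - 1) * d%:R + d%:R ^+ 2) *: (a *: f) - geulsq (a *: f)).
Proof.
move=> hs hd; rewrite H1Z (H1_structured hs hd) gscale_iota mul1r scale1r; congr (gmap _ _).
by rewrite geulsqZ scalerBr !scalerA [a * _]mulrC rmorphD rmorphM rmorphXn rmorphB rmorph1 !rmorph_nat.
Qed.

Lemma I1_structured_map d m f (a : k) : structured 1 f -> homogeneous d f -> gdeg m f ->
  I1 (a *: f) = iota (phi (m%:R * d%:R) *: (a *: f) - geulin (a *: f)).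
Proof.
move=> hs hd hm; rewrite I1Z.
have -> : I1 f = iota ((m%:R * d%:R) *: f - geulin f).
  apply/ffunP => S; rewrite (I1_structured S hs hd) scale1r [RHS]ffunE gsubE gscalerE /=.
  by have [<-//|/hm->] := eqVneq #|S| m; rewrite !scaler0.
rewrite gscale_iota; congr (gmap _ _).
by rewrite geulinZ scalerBr !scalerA [a * _]mulrC rmorphM !rmorph_nat.
Qed.

Lemma gdeg_hsuper d : gdeg 0 (hsuper n k d).
Proof.
move=> S; rewrite cards_eq0 => /negbTE S0; apply/mpolyP => m.
by rewrite hsuper_bos S0 mul0r mcoeff0.
Qed.

Lemma gdeg_htsuper d : gdeg 1 (htsuper n k d).
Proof.
move=> S S1; apply/mpolyP => m; rewrite htsuper_ferm mcoeff0 big1 ?mulr0 // => l /eqP SE.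
by rewrite SE cards1 eqxx in S1.
Qed.

Lemma scoef_hsuper_map d G : (splen G <= n)%N ->
  scoef G (hsuper n k d) = if G \in spart_enum d 0 then phi 1 else 0.
Proof.
by move=> Gn; rewrite scoef_hsuper // mem_spart_enum andbC rmorph1; case: ifP.
Qed.

Lemma scoef_htsuper_map d (a : rat) G : (splen G <= n)%N ->
  scoef G (phi a *: htsuper n k d) =
    if G \in spart_enum d 1 then phi (a * (nth 0%N (asym G) 0).+1%:R) else 0.
Proof.
move=> Gn; rewrite scoefZ scoef_htsuper // mem_spart_enum andbC rmorphM rmorph_nat.
by case: ifP => _; rewrite ?mul1r ?mul0r ?mulr0.
Qed.
End Targets.

(** Truncating each entry removes at least as much as truncating the total; hence a single row has
    the largest tails of its size. *)
Lemma tail_le_sub s t : (tail s t <= sumn s - t)%N.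
Proof.
elim: s => [|v s IH]; first by rewrite /tail big_nil.
by rewrite /tail big_cons /= -/(tail s t); lia.
Qed.

Lemma lep_row d G : G \in spart_enum d 0 -> lep G (spart_row d).
Proof.
rewrite mem_spart_enum => /andP[/eqP td /eqP fd].
have tE : tdeg (spart_row d) = d by case: d {td} => // d; rewrite /tdeg /= addn0.
split; [by rewrite fd | by rewrite td tE | move=> t | move=> _ i].
  apply: leq_trans (tail_le_sub _ _) _; rewrite sumn_cat -/(tdeg G) td.
  by rewrite /tail /parts; case: d {td tE} => [|d] //=; rewrite big_cons leq_addr.
by rewrite [asym G](size0nil fd) nth_nil.
Qed.

Lemma lep_arow d G : G \in spart_enum d 1 -> lep G (spart_arow d).
Proof.
rewrite mem_spart_enum => /andP[/eqP td /eqP fd].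
split; [by rewrite fd | by rewrite td /tdeg /= !addn0 | move=> t | move=> _ [|i]].
- apply: leq_trans (tail_le_sub _ _) _; rewrite sumn_cat -/(tdeg G) td.
  by rewrite /tail /parts big_cons leq_addr.
- by rewrite /= -td; apply: asym_le; rewrite mem_nth // [size _]fd.
by rewrite nth_default // [size _]fd.
Qed.

Lemma beta_neq0 : beta != 0.
Proof. by rewrite tofrac_eq0 polyX_eq0. Qed.

(** * The two limits and the values at one *)

Section JackTargets.
Variables (N : nat) (c : spart -> {fsfun spart -> Qbeta with 0}).
Hypothesis hc : jack_basis N c.
Notation M := N.+1.

Lemma jack_msuper rel L : place ratQ rel -> rel beta 0 -> (tdeg L + fdeg L <= M)%N ->
  coefwise rel (c L) (fun n => msuper n rat L).
Proof.
move=> hp hb LN.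
have rs : rel (ratQ 1) 1 by exact: place_const.
have rt : rel (ratQ 1 * beta) 0 by have := place_mul hp rs hb; rewrite mulr0.
have LE := fun G => @scoef_msuper_map M Qbeta ratQ L G.
have TE := fun n G => @scoef_msuper_map n rat idfun L G.
apply: (jack_place hc LN (f := msuper M Qbeta L) (eta := (sqparts L)%:R)
  (eta' := (sumn (asym L))%:R) hp rs rt _ _ _ _ TE _ _ _ LE).
- exact: ler01.
- exact: lexx.
- by rewrite addr0 ltr01.
- by move=> n; exact: msuper_symmetric.
- by rewrite eqxx.
- move=> G _; have [<- _|_] := eqVneq L G; last by rewrite eqxx.
  exact: lep_refl.
- exact: msuper_symmetric.
- by apply: split_left_map; exact: geulsq_msuper_map.
by apply: split_left_map; exact: geulin_msuper_map.
Qed.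

(** The equations are divided by beta, so that the pair (1/beta, 1) specialises to (0, 1), where the
    reversed e_(L') is a common eigenvector. *)
Lemma jack_eprod rel L : place ratQ rel -> rel beta^-1 0 -> (tdeg L + fdeg L <= M)%N ->
  coefwise rel (c L) (fun n => reversal (fdeg L) (eprod n rat (spconj L))).
Proof.
move=> hp hb LN.
have rt : rel (beta^-1 * beta) 1.
  by rewrite mulVf ?beta_neq0 // -(rmorph1 ratQ); exact: place_const.
have LX : L \in spart_enum (tdeg L) (fdeg L) by rewrite mem_spart_enum !eqxx.
have inX n (k : fieldType) G : (splen G <= n)%N -> scoef G (eprod n k (spconj L)) != 0 ->
    G \in spart_enum (tdeg L) (fdeg L).
  by move=> Gn /(eprod_lep Gn)[hf ht _ _]; rewrite mem_spart_enum hf ht !eqxx.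
have TE n G : (splen G <= n)%N -> scoef G (reversal (fdeg L) (eprod n rat (spconj L))) =
    if G \in spart_enum (tdeg L) (fdeg L) then ecoef M L G else 0.
  move=> Gn; rewrite /ecoef /reversal !scoefZ; case: ifPn => GX.
    congr (_ * _); apply: scoef_eprod_stable => //.
    by apply: leq_trans LN; exact: spart_enum_splen.
  have [->|/(inX _ _ _ Gn)] := eqVneq (scoef G (eprod n rat (spconj L))) 0; first by rewrite mulr0.
  by rewrite (negbTE GX).
have LE G : (splen G <= M)%N -> scoef G (erev M L) =
    if G \in spart_enum (tdeg L) (fdeg L) then ratQ (ecoef M L G) else 0.
  move=> GM; rewrite scoef_erev; case: ifPn => [//|GX].
  suff -> : ecoef M L G = 0 by exact: (rmorph0 ratQ).
  by rewrite /ecoef TE // (negbTE GX).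
apply: (jack_place hc LN (f := erev M L) (eta := Eev M rat (spconj L))
  (eta' := Iev rat (spconj L)) hp hb rt _ _ _ _ TE _ _ _ LE).
- exact: lexx.
- exact: ler01.
- by rewrite add0r ltr01.
- by move=> n; apply: symmetricZ; exact: eprod_symmetric.
- by exact (ecoef_self LN LX).
- move=> G GX; apply: ecoef_lep; apply: leq_trans LN; exact: spart_enum_splen.
- exact: erev_symmetric.
- by apply: split_right_map; exact: erev_H1.
by apply: split_right_map; exact: erev_I1.
Qed.

Lemma jack_row rel d : place ratQ rel -> rel beta 1 -> (d <= M)%N ->
  coefwise rel (c (spart_row d)) (fun n => hsuper n rat d).
Proof.
move=> hp hb dN.
have rs : rel (ratQ 1) 1 by exact: place_const.
have rt : rel (ratQ 1 * beta) 1 by have := place_mul hp rs hb; rewrite mulr1.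
have tE : tdeg (spart_row d) = d by case: d {dN} => // d; rewrite /tdeg /= addn0.
have LN : (tdeg (spart_row d) + fdeg (spart_row d) <= M)%N by rewrite tE addn0.
have hb' k n := @hsuper_bos n k d.
have hst k n : structured 1 (hsuper n k d) := bos_structured (good_wt_h k) (hb' k n).
have hh k n : homogeneous d (hsuper n k d) := bos_hom (hb' k n).
have TE n G : (splen G <= n)%N -> scoef G (hsuper n rat d) =
    if G \in spart_enum (tdeg (spart_row d)) (fdeg (spart_row d)) then 1 else 0.
  by rewrite tE; exact: (@scoef_hsuper_map n rat idfun d G).
have LE G : (splen G <= M)%N -> scoef G (hsuper M Qbeta d) =
    if G \in spart_enum (tdeg (spart_row d)) (fdeg (spart_row d)) then ratQ 1 else 0.
  by rewrite tE; exact: (@scoef_hsuper_map M Qbeta ratQ d G).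
apply: (jack_place hc LN (g := fun=> 1) (f := hsuper M Qbeta d)
  (eta := (M%:R - 1) * d%:R + d%:R ^+ 2) (eta' := 0%:R * d%:R) hp rs rt _ _ _ _ TE _ _ _ LE).
- exact: ler01.
- exact: ler01.
- by rewrite addr_gt0 ?ltr01.
- by move=> n; exact: bos_symmetric (hb' _ _).
- by [].
- by move=> G GX _; apply: lep_row; rewrite tE in GX.
- exact: bos_symmetric (hb' _ _).
- apply: split_both_map; rewrite -[hsuper _ _ _]scale1r.
  exact: H1_structured_map (hst _ _) (hh _ _).
apply: split_both_map; rewrite -[hsuper _ _ _]scale1r.
exact: I1_structured_map (hst _ _) (hh _ _) (@gdeg_hsuper _ _ d).
Qed.

(** In htilde_d the coefficient of m_G is one plus the circled entry of G, so the factor 1/(d + 1)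
    makes the coefficient of m_(d;0) equal to one. *)
Lemma jack_arow rel d : place ratQ rel -> rel beta 1 -> (d + 1 <= M)%N ->
  coefwise rel (c (spart_arow d)) (fun n => (d.+1%:R)^-1 *: htsuper n rat d).
Proof.
move=> hp hb dN.
have rs : rel (ratQ 1) 1 by exact: place_const.
have rt : rel (ratQ 1 * beta) 1 by have := place_mul hp rs hb; rewrite mulr1.
have tE : tdeg (spart_arow d) = d by rewrite /tdeg /= !addn0.
have LN : (tdeg (spart_arow d) + fdeg (spart_arow d) <= M)%N by rewrite tE.
have hb' k n := @htsuper_ferm n k d.
have hst k n : structured 1 (htsuper n k d) := ferm_structured (good_wt_h k) (hb' k n).
have hh k n : homogeneous d (htsuper n k d) := ferm_hom (hb' k n).
have TE n G : (splen G <= n)%N -> scoef G ((d.+1%:R)^-1 *: htsuper n rat d) =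
    if G \in spart_enum (tdeg (spart_arow d)) (fdeg (spart_arow d))
    then (d.+1%:R)^-1 * (nth 0%N (asym G) 0).+1%:R else 0.
  by rewrite tE; exact: (@scoef_htsuper_map n rat idfun d (d.+1%:R)^-1 G).
have LE G : (splen G <= M)%N -> scoef G (ratQ (d.+1%:R)^-1 *: htsuper M Qbeta d) =
    if G \in spart_enum (tdeg (spart_arow d)) (fdeg (spart_arow d))
    then ratQ ((d.+1%:R)^-1 * (nth 0%N (asym G) 0).+1%:R) else 0.
  by rewrite tE; exact: (@scoef_htsuper_map M Qbeta ratQ d (d.+1%:R)^-1 G).
apply: (jack_place hc LN (f := ratQ (d.+1%:R)^-1 *: htsuper M Qbeta d)
  (g := fun G => (d.+1%:R)^-1 * (nth 0%N (asym G) 0).+1%:R)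
  (eta := (M%:R - 1) * d%:R + d%:R ^+ 2) (eta' := 1%:R * d%:R) hp rs rt _ _ _ _ TE _ _ _ LE).
- exact: ler01.
- exact: ler01.
- by rewrite addr_gt0 ?ltr01.
- by move=> n; apply: symmetricZ; exact: ferm_symmetric (hb' _ _).
- by rewrite /= mulVf // pnatr_eq0.
- by move=> G GX _; apply: lep_arow; rewrite tE in GX.
- by apply: symmetricZ; exact: ferm_symmetric (hb' _ _).
- by apply: split_both_map; exact: H1_structured_map (hst _ _) (hh _ _).
by apply: split_both_map; exact: I1_structured_map (hst _ _) (hh _ _) (@gdeg_htsuper _ _ d).
Qed.
End JackTargets.

(** The bounds say that the size plus the number of circles is at most the number N + 1 of
    variables. Every superpartition of the same bidegree then has at most N + 1 parts, so N + 1
    variables see all coefficients of the expansion. *)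
Theorem theorem61 (R : realType) (N : nat)
    (c : spart -> {fsfun spart -> Qbeta with 0}) (hc : jack_basis N c) :
  (forall L : spart, (tdeg L + fdeg L <= N.+1)%N ->
     limit_at_0 R (c L) (fun n => msuper n rat L) /\
     limit_at_infty R (c L) (fun n => reversal (fdeg L) (eprod n rat (spconj L)))) /\
  (forall d : nat, (d <= N.+1)%N ->
     value_at_1 (c (spart_row d)) (fun n => hsuper n rat d)) /\
  (forall d : nat, (d + 1 <= N.+1)%N ->
     value_at_1 (c (spart_arow d)) (fun n => (d.+1%:R)^-1 *: htsuper n rat d)).
Proof.
split=> [L LN|]; last split=> d dN.
- split; first exact (jack_msuper hc (place_cvg0 R) (cvg0_beta R) LN).
  exact (jack_eprod hc (place_and (place_cvgpy R) (place_cvgny R))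
    (conj (cvgpy_beta R) (cvgny_beta R)) LN).
- exact (jack_row hc (place_value 1) (value_beta 1) dN).
- exact (jack_arow hc (place_value 1) (value_beta 1) dN).
Qed.
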